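(* Let $T>0$, $\eta>0$, let $\gamma\in L^\infty(\mathbb{R}_{\ge0};\mathbb{R}_{\ge0})\cap L^1(\mathbb{R}_{\ge0})$ be monotonically decreasing, let $V\in C^3(\mathbb{R})$ with $V'\le0$, and let $q_0\in L^\infty(\mathbb{R};\mathbb{R}_{\ge0})\cap TV(\mathbb{R})$ be monotone. Let $q_\eta$ be the weak solution on $(0,T)\times\mathbb{R}$ of $$\partial_tq+\partial_x\big(q\,\mathcal{W}_\eta[V(q),\gamma]\big)=0,\quad q(0,\cdot)=q_0,\qquad \mathcal{W}_\eta[V(q),\gamma](t,x)=\tfrac1\eta\int_x^\infty\gamma\big(\tfrac{y-x}{\eta}\big)V(q(t,y))\,dy .$$ Then the dynamics preserve monotonicity on the entire time horizon: if $q_0$ is monotonically increasing (respectively decreasing), then $q_\eta(t,\cdot)$ is monotonically increasing (respectively decreasing) for every $t\in[0,T]$.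
   Context: $\Omega_T:=(0,T)\times\mathbb{R}$. $TV(\mathbb{R})$ denotes the set of functions of finite total variation. Monotone is meant in the non-strict sense and, for elements of $L^1_{\mathrm{loc}}$, up to null sets. Weak solution: a function $q\in C([0,T];L^1_{\mathrm{loc}}(\mathbb{R}))\cap L^\infty((0,T);L^\infty(\mathbb{R})\cap TV(\mathbb{R}))$ such that $W:=\mathcal{W}_\eta[V(q),\gamma]\in C([0,T];L^1_{\mathrm{loc}}(\mathbb{R}))$ and, for all $\phi\in C^1_c((-42,T)\times\mathbb{R})$, $$\iint_{\Omega_T}q\,(\partial_t\phi+W\,\partial_x\phi)\,dx\,dt+\int_{\mathbb{R}}q_0(x)\phi(0,x)\,dx=0 .$$ Under the stated assumptions there is a unique weak solution on every finite time horizon. *)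

(* Defs.v *)
From mathcomp Require Import all_boot all_order all_algebra.
From mathcomp Require Import all_classical all_reals all_analysis.

Set Implicit Arguments.
Unset Strict Implicit.
Unset Printing Implicit Defensive.

Import Order.TTheory GRing.Theory Num.Theory.
Import numFieldNormedType.Exports.

Local Open Scope classical_set_scope.
Local Open Scope ring_scope.

(* Elements of L^infty and L^1_loc are represented by Borel functions; apart
   from measurability, the predicates on them depend only on their almost
   everywhere classes. *)

Definition Linfty {R : realType} (D : set R) (f : R -> R) : Prop :=
  measurable_fun D f /\
  ('N[@lebesgue_measure R]_(+oo)[EFin \o (f \_ D)] < +oo)%E.

Definition ae_nneg {R : realType} (D : set R) (f : R -> R) : Prop :=
  \forall x \ae @lebesgue_measure R, D x -> 0 <= f x.

Definition ae_nondecreasing {R : realType} (D : set R) (f : R -> R) : Prop :=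
  exists2 g : R -> R, {in D &, nondecreasing_fun g} &
    f = g %[ae @lebesgue_measure R in D].

Definition ae_nonincreasing {R : realType} (D : set R) (f : R -> R) : Prop :=
  exists2 g : R -> R, {in D &, nonincreasing_fun g} &
    f = g %[ae @lebesgue_measure R in D].

Definition line_variation {R : realType} (f : R -> R) : \bar R :=
  ereal_sup [set v | exists a b : R, a <= b /\ v = total_variation a b f].

(* Total variation of an almost everywhere class: the infimum over its
   representatives. *)
Definition ess_total_variation {R : realType} (f : R -> R) : \bar R :=
  ereal_inf [set line_variation g | g in
    [set g : R -> R | f = g %[ae @lebesgue_measure R]]].

Definition finite_total_variation {R : realType} (f : R -> R) : Prop :=
  (ess_total_variation f < +oo)%E.

Definition class_C {R : realType} (n : nat) (f : R -> R) : Prop :=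
  (forall k, (k < n)%N -> forall x, derivable (derive1n k f) x 1) /\
  continuous (derive1n n f).

(* C([0,T]; L^1_loc(R)) *)
Definition continuous_L1loc {R : realType} (T : R) (f : R -> R -> R) : Prop :=
  (forall t, t \in `[0, T] ->
     locally_integrable [set: R] (f t)) /\
  (forall t0, t0 \in `[0, T] -> forall K : set R, compact K ->
     (\int[@lebesgue_measure R]_(x in K) (`|f t x - f t0 x|%:E))%E
       @[t --> within `[0, T] (nbhs t0)] --> 0%E).

(* L^infty((0,T); L^infty(R) `&` TV(R)) *)
Definition bounded_LinftyTV {R : realType} (T : R) (f : R -> R -> R) : Prop :=
  exists M : R, \forall t \ae @lebesgue_measure R, 0 < t < T ->
    [/\ measurable_fun [set: R] (f t),
        ('N[@lebesgue_measure R]_(+oo)[EFin \o f t] <= M%:E)%E &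
        (ess_total_variation (f t) <= M%:E)%E].

Definition nonlocal {R : realType} (eta : R) (gamma : R -> R) (u : R -> R -> R)
    (t x : R) : R :=
  eta^-1 * \int[@lebesgue_measure R]_(y in `[x, +oo[)
             (gamma ((y - x) / eta) * u t y).

(* C^1_c(`]a, b[ `*` R), each function being extended by zero to the plane *)
Definition C1c_strip {R : realType} (a b : R) (phi : R * R -> R) : Prop :=
  [/\ forall p, derivable phi p (1, 0) /\ derivable phi p (0, 1),
      continuous ('D_(1, 0) phi),
      continuous ('D_(0, 1) phi),
      compact (closure [set p | phi p != 0]) &
      closure [set p | phi p != 0] `<=` `]a, b[ `*` [set: R]].

(* The joint measurability required of q only selects a representative: each
   element of C([0,T]; L^1_loc(R)) has one, such as
   limsup_k k * \int_x^(x + 1/k) q t y dy where that is finite. *)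
Definition weak_solution {R : realType} (T eta : R) (gamma V q0 : R -> R)
    (q : R -> R -> R) : Prop :=
  let W := nonlocal eta gamma (fun t x => V (q t x)) in
  [/\ measurable_fun (`[0, T] `*` [set: R]) (fun p : R * R => q p.1 p.2),
      continuous_L1loc T q,
      bounded_LinftyTV T q,
      continuous_L1loc T W &
      forall phi : R * R -> R, C1c_strip (- 42%:R) T phi ->
        \int[(@lebesgue_measure R \x @lebesgue_measure R)%E]_(p in
            `]0, T[ `*` [set: R])
          (q p.1 p.2 * ('D_(1, 0) phi p + W p.1 p.2 * 'D_(0, 1) phi p))
        + \int[@lebesgue_measure R]_(x in [set: R]) (q0 x * phi (0, x)) = 0].

(* Main.v *)
(** Write m(t; a, b) for the mass of q(t) on [a, b] and W for the nonlocal
    velocity, which is bounded, Lipschitz in x and continuous in t.  Testing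
    the equation with smoothed indicators of moving strips shows that, over a
    short time step tau, m(t + tau; a, b) equals
    m(t; a - tau W(t, a), b - tau W(t, b)) up to o(tau), locally uniformly;
    chaining such backward Euler steps replaces the characteristic flow.
    Monotonicity of q(t) means that the gap
    m(t; x, x + l) - m(t; y, y + l) is nonpositive whenever x comes before y
    (x <= y in the increasing case, y <= x in the decreasing one).  If all gaps
    are at most l D exp(la t), then, the kernel being nonincreasing on [0, oo)
    and V nonincreasing and Lipschitz, the two velocity increments satisfy
    (W(x + l) - W(x)) - (W(y + l) - W(y)) >= - 2 C l D exp(la t) wherever the
    gap is nonnegative.  A Gronwall argument along the backward steps, started
    from nonpositive gaps at time 0, then improves D to D / 2 once la is large.
    Iterating, all gaps are nonpositive, and Lebesgue differentiation turns
    this into monotonicity of q(t) almost everywhere. *)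
Require Import Defs.
From mathcomp Require Import all_boot all_order all_algebra.
From mathcomp Require Import all_classical all_reals all_analysis.
From mathcomp Require Import measurable_realfun ess_sup_inf ring lra.
Import Order.TTheory GRing.Theory Num.Theory.
Import numFieldNormedType.Exports.
Local Open Scope classical_set_scope.
Local Open Scope ring_scope.

(** * Backward Euler steps *)

(** Interval masses are compared because q(t) is only a class modulo null sets, so that a violation
    of monotonicity has no meaning at a point. No ordinary differential equation is solved:
    consistency of a single short step suffices, since the errors sum to e t with e arbitrary. The
    obstacle is that the velocity is nonlocal: its increment near x feels the gaps everywhere ahead
    of x, so a single worst gap cannot be followed in time. This is why a bound D on all gaps is
    assumed and then improved. The increment W(x + h) - W(x) integrates V(q) against K(s - h) -
    K(s), where K is the rescaled kernel. This weight has mean zero, so the bound D on the far gaps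
    cancels, and its negative part lives on [0, h]; what survives is of size h D. Going back one
    step of length tau, the interval at x thus becomes longer than the one at y by at most O(tau l
    D). The coefficient does not depend on D, so one value of la serves all the iterations. The
    comparison is needed only for gaps that are positive at the end of the step; the others satisfy
    the claim already. *)

Definition before {R : realType} (up : bool) (x y : R) : bool :=
  if up then x <= y else y <= x.

(* m t a b is the mass of [a, b] at time t, W the velocity.  In [tr_strip] the
   sides of the strip are straight lines of slopes c and c'; w measures how far
   they are from being characteristics. *)
Record transported {R : realType} (T M L B A : R) (m : R -> R -> R -> R)
    (W : R -> R -> R) : Prop := Transported {
  tr_M : 0 <= M;
  tr_L : 0 <= L;
  tr_B : 0 <= B;
  tr_A : 0 <= A;
  tr_lip : forall t x y : R, 0 <= t <= T -> `|W t x - W t y| <= L * `|x - y|;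
  tr_bound : forall t x : R, 0 <= t <= T -> `|W t x| <= B;
  tr_unif : forall K e : R, 0 < e -> exists2 d : R, 0 < d &
    forall s t x : R, 0 <= s <= T -> 0 <= t <= T -> `|s - t| <= d -> `|x| <= K ->
      `|W s x - W t x| <= e;
  tr_add : forall t a b c : R, 0 <= t <= T -> a <= b -> b <= c ->
    m t a c = m t a b + m t b c;
  tr_mass : forall t a b : R, 0 <= t <= T -> a <= b -> `|m t a b| <= M * (b - a);
  tr_strip : forall t1 t2 a b c c' w : R, 0 <= t1 -> t1 <= t2 -> t2 <= T ->
    a <= b -> a - (t2 - t1) * c <= b - (t2 - t1) * c' ->
    (forall s, t1 <= s <= t2 -> `|W s (a - (t2 - s) * c) - c| <= w /\
       `|W s (b - (t2 - s) * c') - c'| <= w) ->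
    `|m t2 a b - m t1 (a - (t2 - t1) * c) (b - (t2 - t1) * c')| <=
      A * w * (t2 - t1);
  tr_init : forall a b : R, a <= b -> 0 <= m 0 a b }.

Section BackwardEuler.
Context {R : realType}.
Implicit Types (T M L B A C : R) (m : R -> R -> R -> R) (W : R -> R -> R).

(** Discrete induction on the number of steps: a time in ]n d, (n + 1) d] is reached from n d. *)
Lemma short_step_ind T (Q : R -> Prop) (d : R) : 0 < d -> Q 0 ->
  (forall t1 t2 : R, 0 <= t1 -> t1 <= t2 -> t2 <= T -> t2 - t1 <= d -> Q t1 -> Q t2) ->
  forall t : R, 0 <= t <= T -> Q t.
Proof.
move=> d0 Q0 Qs.
have H n : forall t : R, 0 <= t <= T -> t <= n%:R * d -> Q t.
  elim: n => [|n IH] t /andP[t0 tT] tn.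
    by have -> : t = 0 by lra.
  have [tn'|tn'] := leP t (n%:R * d); first by apply: IH => //; rewrite t0.
  have n0 : 0 <= n%:R * d by rewrite mulr_ge0// ltW.
  apply: (Qs (n%:R * d)) => //; first exact: ltW.
    by move: tn; rewrite -natr1; lra.
  by apply: IH => //; rewrite n0/=; lra.
move=> t tT; apply: (H (Num.bound (t / d))) => //.
case/andP: tT => t0 _; rewrite -ler_pdivrMr//.
by apply/ltW/archi_boundP; rewrite divr_ge0// ltW.
Qed.

(** The restriction tau L <= 1 makes the map from a point to its foot monotone, so that the feet of
    an interval bound an interval and the relation [before] survives a step. *)
Lemma foot_le T L W
    (W_lip : forall t x y : R, 0 <= t <= T -> `|W t x - W t y| <= L * `|x - y|)
    (t tau x y : R) :
  0 <= t <= T -> 0 <= tau -> tau * L <= 1 -> x <= y ->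
  x - tau * W t x <= y - tau * W t y.
Proof.
move=> tT tau0 tauL xy.
have := W_lip t y x tT; rewrite (ger0_norm (_ : 0 <= y - x)) ?subr_ge0// => h.
have h1 : W t y - W t x <= L * (y - x) by apply: le_trans h; rewrite ler_norm.
have h2 : tau * (W t y - W t x) <= tau * (L * (y - x)) by apply: ler_wpM2l.
have h3 : tau * L * (y - x) <= 1 * (y - x) by apply: ler_wpM2r => //; rewrite subr_ge0.
lra.
Qed.

(** A backward cone of dependence: the window may shrink in time at rate B. It confines the argument
    to a compact window, where [tr_unif] applies. *)
Lemma foot_bound T B W
    (W_bound : forall t x : R, 0 <= t <= T -> `|W t x| <= B) (t tau x K : R) :
  0 <= t <= T -> 0 <= tau ->
  `|x| <= K - B * (t + tau) -> `|x - tau * W t x| <= K - B * t.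
Proof.
move=> tT tau0 xK; apply: le_trans (ler_normB _ _) _.
rewrite normrM (ger0_norm tau0).
have := W_bound t x tT => h.
have : tau * `|W t x| <= tau * B by apply: ler_wpM2l.
lra.
Qed.

(** The sides of the strip get the constant slopes W(t1, a) and W(t1, b). Along a side the velocity
    departs from its slope by at most L B tau, due to the displacement, plus the oscillation of W in
    time; a short step makes each of them at most [e1]. *)
Lemma euler_consistent T M L B A m W (H : transported T M L B A m W) (K e : R) :
  0 < e -> exists2 d : R, 0 < d & d * L <= 1 /\
  forall t1 t2 a b : R, 0 <= t1 -> t1 <= t2 -> t2 <= T -> t2 - t1 <= d ->
    a <= b -> `|a| <= K -> `|b| <= K ->
    `|m t2 a b - m t1 (a - (t2 - t1) * W t1 a) (b - (t2 - t1) * W t1 b)| <=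
      e * (t2 - t1).
Proof.
have [M0 L0 B0 A0 W_lip W_bound W_unif m_add m_bound m_transport m0_ge0] := H.
move=> e0.
(* The strip estimate will be used with w = 2 e1; the 1 keeps the denominator positive. *)
pose e1 := e / (2 * (A + 1)).
have e10 : 0 < e1 by rewrite /e1 divr_gt0// mulr_gt0//; lra.
have Ae : A * (2 * e1) <= e.
  rewrite /e1 (_ : A * (2 * (e / (2 * (A + 1)))) = e * (A / (A + 1))); last by field; lra.
  by rewrite ler_piMr ?(ltW e0)// ler_pdivrMr; lra.
have [d d0 Hd] := W_unif K e1 e10.
pose d' := Num.min d (Num.min (1 / (L + 1)) (e1 / (L * B + 1))).
have LB0 : 0 <= L * B by rewrite mulr_ge0.
have d'0 : 0 < d' by rewrite !lt_min d0 !divr_gt0//; lra.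
have d'd : d' <= d by rewrite ge_min lexx.
have d'L : d' <= 1 / (L + 1) by rewrite !ge_min lexx orbT.
have d'e : d' <= e1 / (L * B + 1) by rewrite !ge_min lexx !orbT.
have d'L1 : d' * L <= 1 by move: d'L; rewrite ler_pdivlMr; lra.
exists d' => //; split => //.
move=> t1 t2 a b t10 t12 t2T dt ab aK bK.
have t1T : 0 <= t1 <= T by rewrite t10 (le_trans t12).
apply: le_trans (_ : A * (2 * e1) * (t2 - t1) <= _); last first.
  by apply: ler_wpM2r => //; rewrite subr_ge0.
apply: m_transport => //.
  apply: (foot_le _ _ _ W_lip) => //; first lra.
  by apply: le_trans d'L1; apply: ler_wpM2r.
have D'e : d' * (L * B) <= e1 by move: d'e; rewrite ler_pdivlMr; lra.
have key (s x : R) : t1 <= s <= t2 -> `|x| <= K ->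
    `|W s (x - (t2 - s) * W t1 x) - W t1 x| <= 2 * e1.
  move=> /andP[s1 s2] xK.
  have sT : 0 <= s <= T by apply/andP; split; lra.
  rewrite (_ : _ - _ = (W s (x - (t2 - s) * W t1 x) - W s x) + (W s x - W t1 x)); last by ring.
  apply: le_trans (ler_normD _ _) _.
  rewrite (_ : 2 * e1 = e1 + e1); last by ring.
  apply: lerD.
    apply: le_trans (W_lip _ _ _ sT) _.
    rewrite (_ : x - _ - x = - ((t2 - s) * W t1 x)); last by ring.
    rewrite normrN normrM (ger0_norm (_ : 0 <= t2 - s)) ?subr_ge0//.
    apply: le_trans D'e.
    rewrite mulrCA.
    apply: ler_pM; rewrite ?subr_ge0 ?mulr_ge0//; first lra.
    by apply: ler_wpM2l => //; apply: W_bound.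
  by apply: Hd => //; rewrite ger0_norm ?subr_ge0//; lra.
by move=> s st; split; apply: key.
Qed.

(** Positivity is carried from time 0 to t along the backward steps with a loss e t. *)
Lemma m_ge0 T M L B A m W (H : transported T M L B A m W) (t a b : R) :
  0 <= t <= T -> a <= b -> 0 <= m t a b.
Proof.
have [M0 L0 B0 A0 W_lip W_bound W_unif m_add m_bound m_transport m0_ge0] := H.
move=> tT ab.
pose K : R := Num.max `|a| `|b| + B * T.
have He (e : R) : 0 < e -> - (e * t) <= m t a b.
  move=> e0.
  have [d d0 [dL Hd]] := euler_consistent _ _ _ _ _ _ _ H K e e0.
  pose Q (t : R) := forall a b : R, a <= b -> `|a| <= K - B * t -> `|b| <= K - B * t ->
    - (e * t) <= m t a b.
  suff : Q t.
    have BtT : B * t <= B * T by apply: ler_wpM2l => //; case/andP: tT.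
    have ha : `|a| <= Num.max `|a| `|b| by rewrite le_max lexx.
    have hb : `|b| <= Num.max `|a| `|b| by rewrite le_max lexx orbT.
    by move=> Qt; apply: Qt => //; rewrite /K; lra.
  apply: (@short_step_ind T Q d) => //.
    by move=> a' b' ab' _ _; rewrite mulr0 oppr0 m0_ge0.
  move=> t1 t2 t10 t12 t2T dt Q1 x y xy xK yK.
  have t1T : 0 <= t1 <= T by rewrite t10 (le_trans t12).
  have Bt2 : 0 <= B * t2 by rewrite mulr_ge0// (le_trans t10).
  have k (z : R) : `|z| <= K - B * t2 -> `|z| <= K by move=> /le_trans; apply; lra.
  have /ler_normlP[h _] := Hd t1 t2 x y t10 t12 t2T dt xy (k _ xK) (k _ yK).
  have tau0 : 0 <= t2 - t1 by rewrite subr_ge0.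
  have := Q1 (x - (t2 - t1) * W t1 x) (y - (t2 - t1) * W t1 y).
  move=> /(_ (foot_le _ _ _ W_lip _ _ _ _ t1T tau0 (le_trans (ler_wpM2r L0 dt) dL) xy)).
  have f (z : R) : `|z| <= K - B * t2 -> `|z - (t2 - t1) * W t1 z| <= K - B * t1.
    by move=> zK; apply: (foot_bound _ _ _ W_bound) => //; rewrite subrKC.
  move=> /(_ (f _ xK) (f _ yK)); lra.
case/andP: (tT) => t0 _.
apply/ler_addgt0Pl => e e0.
have t1 : 0 < t + 1 by lra.
have := He (e / (t + 1)) (divr_gt0 e0 t1).
have : e / (t + 1) * t <= e by rewrite mulrAC ler_pdivrMr//; lra.
lra.
Qed.

(* One step of the Gronwall argument of [deviation_halves], with E and F the
   values of exp(la t) at its two ends. *)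
Lemma euler_step_arith (a1 a2 b1 b1' b2 M L C D E F la e g0 tau t l l1 : R) :
  0 <= e -> 0 <= D * E -> 0 <= l -> 0 <= tau -> L + 4 * M * C <= la ->
  E * (1 + la * tau) <= F -> 0 <= D ->
  tau * (M * C * g0) * tau <= e / 4 * tau ->
  l1 <= l * (1 + L * tau) ->
  a2 - a1 <= e / 4 * tau -> - (b2 - b1) <= e / 4 * tau ->
  b1' <= b1 + M * (tau * (C * (2 * (l * (D * E)) + g0 * tau))) ->
  a1 - b1' <= l1 * (D / 2 * E) + e * t ->
  a2 - b2 <= l * (D / 2 * F) + e * (t + tau).
Proof.
move=> e0 DE0 l0 tau0 laC EF D0 e1tau l1L hx hy My Q1.
have l1D : l1 * (D / 2 * E) <= l * (1 + L * tau) * (D / 2 * E).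
  by apply: ler_wpM2r => //; clear -DE0; lra.
(* Since 2 M C D = 4 M C (D / 2), the rate acting on l (D / 2) E is L + 4 M C, the L coming from the
   stretching of l into l1. *)
have laE : (L + 4 * M * C) * (l * (D * E) * tau) <= la * (l * (D * E) * tau).
  by apply: ler_wpM2r => //; rewrite mulr_ge0// mulr_ge0.
have lDE : l * (D / 2) * (E * (1 + la * tau)) <= l * (D / 2) * F.
  by apply: ler_wpM2l => //; rewrite mulr_ge0// divr_ge0.
have et0 := mulr_ge0 e0 tau0.
clear -et0 e1tau hx hy My Q1 l1D laE lDE; lra.
Qed.

(* Backwards in time, the gap grows at rate at most 2 M C l D exp(la t) while
   the intervals stretch at rate at most L; starting from 0, it stays below
   l (D / 2) exp(la t) as soon as la >= L + 4 M C. *)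
Lemma deviation_halves T M L B A C m W (H : transported T M L B A m W) up (D la : R) :
  0 <= C -> 0 <= D -> L + 4 * M * C <= la ->
  (forall t x y l : R, 0 <= t <= T -> before up x y -> 0 <= l ->
     m t x (x + l) - m t y (y + l) <= l * (D * expR (la * t))) ->
  (forall t D x y l g : R, 0 <= t <= T -> 0 <= D ->
    (forall x y l : R, before up x y -> 0 <= l ->
      m t x (x + l) - m t y (y + l) <= l * D) ->
    before up x y -> 0 <= l -> 0 <= g -> - g <= m t x (x + l) - m t y (y + l) ->
    - (C * (2 * (l * D) + g)) <=
      (W t (x + l) - W t x) - (W t (y + l) - W t y)) ->
  (forall x y l : R, before up x y -> 0 <= l -> m 0 x (x + l) - m 0 y (y + l) <= 0) ->
  forall t x y l : R, 0 <= t <= T -> before up x y -> 0 <= l ->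
     m t x (x + l) - m t y (y + l) <= l * (D / 2 * expR (la * t)).
Proof.
have [M0 L0 B0 A0 W_lip W_bound W_unif m_add m_bound m_transport m0_ge0] := H.
move=> C0 D0 laC HD Hcomp H0 t x y l tT xy l0.
have la0 : 0 <= la by apply: le_trans laC; rewrite addr_ge0// !mulr_ge0.
(* The rate is 3 B rather than B because the point y' + l1 below is not a foot: it differs from y +
   l by tau times a combination of three velocities. *)
pose K : R := Num.max (Num.max `|x| `|x + l|) (Num.max `|y| `|y + l|) + 3 * B * T.
have He (e : R) : 0 < e -> m t x (x + l) - m t y (y + l) <= l * (D / 2 * expR (la * t)) + e * t.
  move=> e0.
  pose e1 := e / 4.
  have e10 : 0 < e1 by rewrite /e1 divr_gt0.
  have [d1 d10 [dL Hd]] := euler_consistent _ _ _ _ _ _ _ H K e1 e10.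
  (* The mass of a fixed interval changes by at most A B tau in one step ([static]), so a gap that
     is positive at t2 is at least - 2 A B tau at t. The 1 makes [g0] positive. *)
  pose g0 := 2 * A * B + 1.
  have AB0 : 0 <= A * B by rewrite mulr_ge0.
  have g00 : 0 < g0 by rewrite /g0; clear -AB0; lra.
  have MC0 : 0 <= M * C by rewrite mulr_ge0.
  have MCg0 : 0 <= M * C * g0 by rewrite mulr_ge0// ltW.
  (* The term g0 tau in the velocity comparison costs M C g0 tau^2 of mass, which is at most e1 tau
     for such steps. *)
  pose d := Num.min d1 (e1 / (M * C * g0 + 1)).
  have d0 : 0 < d by rewrite lt_min d10 divr_gt0//; clear -MCg0; lra.
  have dd1 : d <= d1 by rewrite ge_min lexx.
  have de1 : d * (M * C * g0) <= e1.
    have : d <= e1 / (M * C * g0 + 1) by rewrite ge_min lexx orbT.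
    by clearbody d g0; rewrite ler_pdivlMr; [clear -d0; lra|clear -MCg0; lra].
  pose Q (t : R) := forall x y l : R, before up x y -> 0 <= l -> `|x| <= K - 3 * B * t
    -> `|x + l| <= K - 3 * B * t ->
    `|y| <= K - 3 * B * t -> `|y + l| <= K - 3 * B * t ->
    m t x (x + l) - m t y (y + l) <= l * (D / 2 * expR (la * t)) + e * t.
  suff : Q t.
    have BtT : 3 * B * t <= 3 * B * T by apply: ler_wpM2l; [rewrite mulr_ge0|case/andP: tT].
    have h1 : `|x| <= K - 3 * B * T by rewrite /K addrK !le_max lexx.
    have h2 : `|x + l| <= K - 3 * B * T by rewrite /K addrK !le_max lexx !orbT.
    have h3 : `|y| <= K - 3 * B * T by rewrite /K addrK !le_max lexx !orbT.
    have h4 : `|y + l| <= K - 3 * B * T by rewrite /K addrK !le_max lexx !orbT.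
    by apply => //; [apply: le_trans h1 _|apply: le_trans h2 _|apply: le_trans h3 _|apply: le_trans h4 _]; rewrite lerD2l lerN2.
  apply: (@short_step_ind T Q d) => //.
    move=> x' y' l' xy' l'0 _ _ _ _; apply: le_trans (H0 _ _ _ xy' l'0) _.
    by rewrite !mulr0 addr0 expR0 mulr1 !mulr_ge0// invr_ge0.
  clearbody K; clear t x y l tT xy l0.
  move=> t t2 t10 t12 t2T dt Q1 x y l xy l0 xK xlK yK ylK.
  have tT : 0 <= t <= T by rewrite t10 (le_trans t12).
  have Bt2 : 0 <= 3 * B * t2 by rewrite !mulr_ge0// (le_trans t10).
  pose tau := t2 - t.
  have tau0 : 0 <= tau by rewrite subr_ge0.
  have taud : tau <= d1 by apply: le_trans dt _.
  have tauL : tau * L <= 1 := le_trans (ler_wpM2r L0 taud) dL.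
  have xxl : x <= x + l by rewrite lerDl.
  have yyl : y <= y + l by rewrite lerDl.
  have f (z c : R) : `|z| <= K - 3 * B * t2 -> `|c| <= 3 * B -> `|z - tau * c| <= K - 3 * B * t.
    move=> zK cB; apply: le_trans (ler_normB _ _) _; rewrite normrM (ger0_norm tau0).
    have := ler_wpM2l tau0 cB; rewrite /tau; clear -zK; lra.
  have W3 (z : R) : `|W t z| <= 3 * B by apply: le_trans (W_bound _ _ tT) _; clear -B0; lra.
  have k (z : R) : `|z| <= K - 3 * B * t2 -> `|z| <= K by move=> /le_trans; apply; clear -Bt2; lra.
  have /ler_normlP[_ hx] := Hd t t2 x (x + l) t10 t12 t2T taud xxl (k _ xK) (k _ xlK).
  have /ler_normlP[hy _] := Hd t t2 y (y + l) t10 t12 t2T taud yyl (k _ yK) (k _ ylK).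
  have static (z z' : R) : z <= z' -> `|m t2 z z' - m t z z'| <= A * B * tau.
    move=> zz'.
    have := m_transport t t2 z z' 0 0 B t10 t12 t2T zz'.
    rewrite !mulr0 !subr0; apply => // s /andP[s1 s2]; rewrite !mulr0 !subr0.
    by split; apply: W_bound; rewrite (le_trans t10 s1) (le_trans s2 t2T).
  have /ler_normlP[sx1 sx2] := static _ _ xxl.
  have /ler_normlP[sy1 sy2] := static _ _ yyl.
  pose E := expR (la * t).
  have E0 : 0 < E by apply: expR_gt0.
  have EE : E * (1 + la * tau) <= expR (la * t2).
    rewrite (_ : la * t2 = la * t + la * tau); last by rewrite /tau; ring.
    by rewrite expRD ler_wpM2l ?expR_ge0// expR_ge1Dx.
  have DE0 : 0 <= D * E by rewrite mulr_ge0// ltW.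
  have [Gneg|Gpos] := leP (m t2 x (x + l) - m t2 y (y + l)) 0.
    apply: le_trans Gneg _; apply: addr_ge0; apply: mulr_ge0 => //;
      [|exact: ltW|exact: le_trans t12].
    by apply: mulr_ge0; [exact: divr_ge0|exact: expR_ge0].
  have cmp := Hcomp t (D * E) x y l (g0 * tau) tT DE0 (fun x y l => HD t x y l tT) xy l0
     (mulr_ge0 (ltW g00) tau0) (ltac:(rewrite /g0; clear -Gpos sx2 sy1 tau0; lra)).
  pose x' := x - tau * W t x; pose y' := y - tau * W t y.
  pose l1 := l - tau * (W t (x + l) - W t x).
  pose l2 := l - tau * (W t (y + l) - W t y).
  have xl' : x + l - tau * W t (x + l) = x' + l1 by rewrite /x' /l1; ring.
  have yl' : y + l - tau * W t (y + l) = y' + l2 by rewrite /y' /l2; ring.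
  rewrite -/tau -/x' xl' in hx; rewrite -/tau -/y' yl' in hy.
  have l1l2 : l1 <= l2 + tau * (C * (2 * (l * (D * E)) + g0 * tau)).
    rewrite /l1 /l2.
    by have := ler_wpM2l tau0 cmp; clear; lra.
  have l10 : 0 <= l1 by have := foot_le _ _ _ W_lip t tau x (x + l) tT tau0 tauL xxl;
    rewrite xl' -/x'; clear; lra.
  have l20 : 0 <= l2 by have := foot_le _ _ _ W_lip t tau y (y + l) tT tau0 tauL yyl;
    rewrite yl' -/y'; clear; lra.
  have l1L : l1 <= l * (1 + L * tau).
    have : `|W t (x + l) - W t x| <= L * l.
      by have := W_lip t (x + l) x tT; rewrite [x + l - x]addrAC subrr add0r (ger0_norm l0).
    move=> /ler_normlP[+ _] => h; have := ler_wpM2l tau0 h; rewrite /l1; clear; lra.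
  have xy' : before up x' y'.
    by move: xy; rewrite /before /x' /y'; case: up {HD Hcomp H0 Q Q1} => h;
      apply: (foot_le _ _ _ W_lip).
  have ylK' : `|y' + l1| <= K - 3 * B * t.
    rewrite (_ : y' + l1 = y + l - tau * (W t y + (W t (x + l) - W t x)));
      last by rewrite /y' /l1; ring.
    apply: f => //; apply: le_trans (ler_normD _ _) _.
    have h1 := W_bound t y tT; have h2 := W_bound t x tT; have h3 := W_bound t (x + l) tT.
    have := ler_normB (W t (x + l)) (W t x); clear -h1 h2 h3; lra.
  have := Q1 x' y' l1 xy' l10.
  rewrite -xl' => /(_ (f _ _ xK (W3 _)) (f _ _ xlK (W3 _)) (f _ _ yK (W3 _)) ylK');
    rewrite -/E => Q1'.
  clearbody x' y' l1 l2.
  have err0 : 0 <= tau * (C * (2 * (l * (D * E)) + g0 * tau)).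
    by rewrite !mulr_ge0// addr_ge0// !mulr_ge0// ltW.
  (* The induction hypothesis compares intervals of equal length l1, but the foot at y' has length
     l2. If l1 <= l2, positivity of the mass suffices; otherwise the extra piece has mass at most M
     (l1 - l2), which the velocity comparison controls. *)
  have My : m t y' (y' + l1) <=
      m t y' (y' + l2) + M * (tau * (C * (2 * (l * (D * E)) + g0 * tau))).
    have [l12|/ltW l21] := leP l1 l2.
      rewrite (m_add t y' (y' + l1) (y' + l2)) ?lerDl ?lerD2l//.
      have := m_ge0 _ _ _ _ _ _ _ H t (y' + l1) (y' + l2) tT; rewrite lerD2l => /(_ l12).
      by have := mulr_ge0 M0 err0; clear; lra.
    rewrite (m_add t y' (y' + l2) (y' + l1)) ?lerDl ?lerD2l//.
    have /ler_normlP[_ h] := m_bound t (y' + l2) (y' + l1) tT (ltac:(by rewrite lerD2l)).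
    apply: le_trans h _; apply: ler_wpM2l => //; clear -l1l2; lra.
  have e1tau : tau * (M * C * g0) * tau <= e1 * tau.
    by apply: ler_wpM2r => //; apply: le_trans de1; apply: ler_wpM2r => //; exact: dt.
  rewrite xl' in Q1'.
  rewrite (_ : t2 = t + tau) in EE hx hy *; last by rewrite /tau; ring.
  exact: euler_step_arith _ _ _ _ _ _ _ _ _ _ _ _ _ _ _ _ _ _ (ltW e0) DE0 l0 tau0 laC EE D0 e1tau l1L hx hy My Q1'.
case/andP: (tT) => t0 _.
apply/ler_addgt0Pl => e e0.
have t1 : 0 < t + 1 by rewrite ltr_wpDl.
have := He (e / (t + 1)) (divr_gt0 e0 t1).
have : e / (t + 1) * t <= e by rewrite mulrAC ler_pdivrMr// ler_pM2l// lerDl.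
by clear; lra.
Qed.

End BackwardEuler.

(** * Integrals over the line *)

Section AffineChange.
Context {R : realType} (k c : R) (k0 : 0 < k).
Local Notation mu := (@lebesgue_measure R).
Let phi (x : measurableTypeR R) : measurableTypeR R := k * x + c.

Lemma measurable_affine : measurable_fun [set: R] (fun x : R => k * x + c).
Proof. by apply: measurable_funD => //; apply: measurable_funM. Qed.

(** k times the pushforward of Lebesgue measure by x -> k x + c agrees with it on half-open
    intervals, hence on all Borel sets by uniqueness. *)
Lemma lebesgue_measure_affine (A : set R) : measurable A ->
  mu ((fun x => k * x + c) @^-1` A) = ((k^-1)%:E * mu A)%E.
Proof.
move=> mA.
have mphi : measurable_fun [set: measurableTypeR R] phi := measurable_affine.
have kge0 : 0 <= k by exact: ltW.
pose nuM : {measure set (measurableTypeR R) -> \bar R} := pushforward mu phi.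
have -> : mu A = mscale (NngNum kge0) (nuM mphi) A.
  apply: lebesgue_measure_unique => // _ [[a b]] _ <-.
  change (mu `]a, b]%classic = (k%:E * mu (phi @^-1` `]a, b]%classic))%E).
  have -> : phi @^-1` `]a, b] = `](a - c) / k, (b - c) / k]%classic.
    apply/seteqP; split => x /=; rewrite !in_itv/= /phi ltr_pdivrMr// ler_pdivlMr// mulrC.
      by rewrite ltrBlDr lerBrDr.
    by rewrite ltrBlDr lerBrDr.
  rewrite !lebesgue_measure_itv/= !lte_fin ltr_pM2r ?invr_gt0// ltrD2r.
  case: ifPn => // _; last by rewrite mule0.
  by rewrite -EFinD -EFinD -EFinM; congr EFin; field; rewrite gt_eqF.
change (mu (phi @^-1` A) = ((k^-1)%:E * (k%:E * mu (phi @^-1` A)))%E).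
by rewrite muleA -EFinM mulVf ?gt_eqF// mul1e.
Qed.

Lemma ae_affine (P : R -> Prop) :
  (\forall x \ae mu, P x) -> \forall x \ae mu, P (k * x + c).
Proof.
move=> [N [mN N0 PN]].
exists ((fun x => k * x + c) @^-1` N); split.
- by rewrite -[X in measurable X]setTI; apply: measurable_affine.
- by rewrite lebesgue_measure_affine// N0 mule0.
- by move=> x /= nP; apply: PN.
Qed.

Lemma ge0_integral_affine (f : R -> \bar R) : measurable_fun [set: R] f ->
  (forall x, 0 <= f x)%E ->
  (\int[mu]_x f (k * x + c)%R = (k^-1)%:E * \int[mu]_x f x)%E.
Proof.
move=> mf f0.
have ki : 0 <= k^-1 by rewrite invr_ge0 ltW.
have -> : ((k^-1)%:E * \int[mu]_x f x = \int[mscale (NngNum ki) mu]_x f x)%E.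
  by rewrite ge0_integral_mscale.
have mphi : measurable_fun [set: measurableTypeR R] phi := measurable_affine.
transitivity (\int[pushforward mu phi]_x f x)%E.
  by rewrite ge0_integral_pushforward.
apply: eq_measure_integral => A mA _.
exact: (lebesgue_measure_affine A mA).
Qed.

Lemma integrable_affine (f : R -> R) : mu.-integrable [set: R] (EFin \o f) ->
  mu.-integrable [set: R] (EFin \o (fun x => f (k * x + c))).
Proof.
move=> /integrableP[/measurable_EFinP mf fi].
apply/integrableP; split.
  by apply/measurable_EFinP; apply: measurableT_comp => //; exact: measurable_affine.
have := ge0_integral_affine (fun x => `|f x|%:E).
rewrite /= => -> //; last by apply/measurable_EFinP; exact: measurableT_comp.
by rewrite lte_mul_pinfty// lee_fin invr_ge0 ltW.
Qed.

Lemma Rintegral_affine (f : R -> R) : mu.-integrable [set: R] (EFin \o f) ->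
  \int[mu]_x f (k * x + c) = k^-1 * \int[mu]_x f x.
Proof.
move=> fi.
have mf : measurable_fun setT (EFin \o f) by case/integrableP: fi.
rewrite /Rintegral integralE [in RHS]integralE.
have e1 : ((fun x => (f (k * x + c)%R)%:E)^\+ = (fun x => (EFin \o f)^\+ (k * x + c)%R))%E by apply/funext => x; rewrite !funeposE.
have e2 : ((fun x => (f (k * x + c)%R)%:E)^\- = (fun x => (EFin \o f)^\- (k * x + c)%R))%E by apply/funext => x; rewrite !funenegE.
rewrite e1 e2 !ge0_integral_affine//; [|exact: measurable_funeneg|exact: measurable_funepos].
have h1 := integrable_pos_fin_num measurableT fi; have h2 := integrable_neg_fin_num measurableT fi.
by rewrite -(fineK h1) -(fineK h2) -!EFinM -!EFinB /= mulrBr.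
Qed.

End AffineChange.

Set Implicit Arguments.
Unset Strict Implicit.

(** * Bounded measurable functions and Lebesgue points *)

Section BoundedFunctions.
Context {R : realType}.
Local Notation mu := (@lebesgue_measure R).

Lemma lebesgue_itv_lty (a b : R) (x y : bool) :
  (mu [set` Interval (BSide x a) (BSide y b)] < +oo)%E.
Proof.
rewrite lebesgue_measure_itv; case: ifP => // _.
by case: x y => -[]; rewrite /= -EFinB ltry.
Qed.

Lemma bounded_integrable_itv (f : R -> R) (M : R) (a b : R) (x y : bool) :
  measurable_fun [set: R] f -> (forall z, `|f z| <= M) ->
  mu.-integrable [set` Interval (BSide x a) (BSide y b)] (EFin \o f).
Proof.
move=> mf fM.
have fin := lebesgue_itv_lty a b x y.
apply: measurable_bounded_integrable => //.
- exact: measurable_funTS.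
- by exists M; split; [exact: num_real|move=> u Mu z _; apply: le_trans (fM z) (ltW Mu)].
Qed.

Lemma locally_integrable_bounded (f : R -> R) (M : R) :
  measurable_fun [set: R] f -> (forall z, `|f z| <= M) ->
  locally_integrable [set: R] f.
Proof.
move=> mf fM; split => //; first exact: openT.
move=> K _ cK.
have mK := compact_measurable cK.
have : mu.-integrable K (EFin \o f).
  apply: measurable_bounded_integrable => //.
  - exact: compact_finite_measure.
  - exact: measurable_funTS.
  - by exists M; split; [exact: num_real|move=> u Mu z _; apply: le_trans (fM z) (ltW Mu)].
by move/integrableP => [].
Qed.

(** At a Lebesgue point with D < f x, the mean of |f y - f x| over any ball around x is at least f x
    minus the mean of f, hence at least f x - D > 0, and cannot tend to 0. *)
Lemma ae_le_of_integrals (f : R -> R) (M D : R) :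
  measurable_fun [set: R] f -> (forall z, `|f z| <= M) ->
  (forall a b, a <= b -> \int[mu]_(x in `[a, b]) f x <= D * (b - a)) ->
  \forall x \ae mu, f x <= D.
Proof.
move=> mf fM fD.
have := lebesgue_differentiation (locally_integrable_bounded mf fM).
apply: filterS; first exact: (ae_filter_ringOfSetsType mu).
move=> x fx.
rewrite leNgt; apply/negP => Dfx.
have e0 : 0 < f x - D by rewrite subr_gt0.
have [r [r0 [rfin rlt]]] : exists r : R, 0 < r /\
    davg f x r \is a fin_num /\ fine (davg f x r) < f x - D.
  have [fn /cvgr_lt/(_ _ e0) flt] := (fine_cvgP _ _).1 fx.
  near (0 : R)^'+ => r; exists r; split; first by near: r; exact: nbhs_right_gt.
  by split; near: r.
have int : mu.-integrable `]x - r, x + r[ (EFin \o f) by exact: bounded_integrable_itv fM.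
have icst c : mu.-integrable `]x - r, x + r[ (EFin \o cst c).
  by apply: (@bounded_integrable_itv _ `|c|) => // z; exact: measurable_cst.
have intc : mu.-integrable `]x - r, x + r[ (EFin \o (fun y => f x - f y)).
  exact: (integrableB _ (icst (f x)) int).
have inta : mu.-integrable `]x - r, x + r[ (EFin \o (fun y => `|f y - f x|)).
  exact: (integrable_norm (integrableB _ int (icst (f x)))).
have : 2 * r * (f x - D) <= \int[mu]_(y in `]x - r, x + r[) `|f y - f x|.
  apply: (@le_trans _ _ (\int[mu]_(y in `]x - r, x + r[) (f x - f y))).
    rewrite RintegralB //; last exact: icst.
    have -> : \int[mu]_(_ in `]x - r, x + r[) f x = f x * fine (mu `]x - r, x + r[%classic).
      exact: Rintegral_cst.
    rewrite lebesgue_measure_itv /= lte_fin.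
    rewrite (_ : x - r < x + r) /=; last by lra.
    have := fD (x - r) (x + r) (ltac:(lra)).
    rewrite -Rintegral_itv_obnd_cbnd; last exact: bounded_integrable_itv fM.
    rewrite -Rintegral_itv_bndo_bndc //.
    by clear -r0; lra.
  apply: le_Rintegral => // y _.
  by rewrite distrC ler_norm.
have e1 : davg f x r = ((2 * r)^-1 * \int[mu]_(y in `]x - r, x + r[) `|f y - f x|)%:E.
  rewrite /davg /iavg lebesgue_measure_ball ?ltW// ball_itv inver mulrn_eq0/= gt_eqF//.
  rewrite -[r *+ 2]mulr_natl EFinM; congr (_ * _)%E.
  rewrite /Rintegral fineK//; exact: integrable_fin_num.
move: rlt; rewrite e1 /= mulrC ltr_pdivrMr ?mulr_gt0// => h1 h2; move: (le_lt_trans h2 h1);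
  rewrite mulrC ltxx.
Unshelve. all: by end_near. Qed.

End BoundedFunctions.

(** * Translations, comparison of integrals, interval indicators *)

Section Shift.
Context {R : realType}.
Local Notation mu := (@lebesgue_measure R).

Lemma ae_shift (c : R) (P : R -> Prop) :
  (\forall x \ae mu, P x) -> \forall x \ae mu, P (x + c).
Proof.
move=> /(ae_affine 1 c ltr01); apply: filterS; first exact: (ae_filter_ringOfSetsType mu).
by move=> x; rewrite mul1r.
Qed.

Lemma measurable_shift (c : R) (f : R -> R) : measurable_fun [set: R] f ->
  measurable_fun [set: R] (fun x => f (x + c)).
Proof.
by move=> mf; apply: measurableT_comp => //; apply: measurable_funD.
Qed.

Lemma integrable_shift (c : R) (f : R -> R) : mu.-integrable [set: R] (EFin \o f) ->
  mu.-integrable [set: R] (EFin \o (fun x => f (x + c))).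
Proof.
move=> fi; rewrite (_ : (fun x => f (x + c)) = (fun x => f (1 * x + c))).
  exact: integrable_affine.
by apply/funext => x; rewrite mul1r.
Qed.

Lemma Rintegral_shift (c : R) (f : R -> R) : mu.-integrable [set: R] (EFin \o f) ->
  \int[mu]_x f (x + c) = \int[mu]_x f x.
Proof.
move=> fi; rewrite -[RHS]mul1r -[X in X * _]invr1 -(Rintegral_affine 1 c ltr01)//.
by apply: eq_Rintegral => x _; rewrite mul1r.
Qed.

Lemma Rintegral_itv_shift (c a b : R) (f : R -> R) :
  mu.-integrable `[a + c, b + c] (EFin \o f) ->
  \int[mu]_(x in `[a, b]) f (x + c) = \int[mu]_(x in `[a + c, b + c]) f x.
Proof.
move=> fi; rewrite [RHS]Rintegral_mkcond -(Rintegral_shift c).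
  rewrite Rintegral_mkcond; apply: eq_Rintegral => x _.
  by rewrite !patchE !mem_setE !in_itv/= !lerD2r.
by rewrite -restrict_EFin -integrable_mkcond.
Qed.

Lemma integrable_Mbounded (D : set R) (f g : R -> R) (M : R) : measurable D ->
  mu.-integrable D (EFin \o f) -> measurable_fun [set: R] g ->
  (forall x, `|g x| <= M) -> mu.-integrable D (EFin \o (fun x => f x * g x)).
Proof.
move=> mD fi mg gM.
have mf : measurable_fun D f by apply/measurable_EFinP; case/integrableP: fi.
apply: (@le_integrable _ _ _ mu D mD _ (fun x => (M * f x)%:E));
  last exact: (@integrableZl _ _ _ mu D mD M _ fi).
- by apply/measurable_EFinP; apply: measurable_funM => //; exact: measurable_funTS.
- move=> x _; rewrite lee_fin !normrM mulrC ler_wpM2r//.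
  by apply: le_trans (gM x) _; exact: ler_norm.
Qed.

(** max(f, g) has the same integral as g and dominates f at every point. *)
Lemma ae_le_Rintegral (D : set R) (f g : R -> R) : measurable D ->
  mu.-integrable D (EFin \o f) -> mu.-integrable D (EFin \o g) ->
  (\forall x \ae mu, D x -> f x <= g x) ->
  \int[mu]_(x in D) f x <= \int[mu]_(x in D) g x.
Proof.
move=> mD fi gi fg.
have mf : measurable_fun D f by apply/measurable_EFinP; case/integrableP: fi.
have mg : measurable_fun D g by apply/measurable_EFinP; case/integrableP: gi.
have mm : measurable_fun D (fun x => Num.max (f x) (g x)) by exact: measurable_maxr.
have E : (\int[mu]_(x in D) (g x)%:E = \int[mu]_(x in D) (Num.max (f x) (g x))%:E)%E.
  apply: ae_eq_integral => //; [exact/measurable_EFinP|exact/measurable_EFinP|].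
  move: fg; apply: filterS; first exact: (ae_filter_ringOfSetsType mu).
  by move=> x fgx Dx; rewrite max_r// fgx.
have mi : mu.-integrable D (EFin \o (fun x => Num.max (f x) (g x))).
  apply: (@le_integrable _ _ _ mu D mD _ (fun x => (`|f x| + `|g x|)%:E));
    last exact: (@integrableD _ _ _ mu _ mD _ _ (integrable_norm fi) (integrable_norm gi)).
  - exact/measurable_EFinP.
  - move=> x _ /=; rewrite lee_fin [leRHS]ger0_norm ?addr_ge0//.
    by rewrite /Num.max; case: ifP => _; rewrite ?lerDl ?lerDr.
rewrite [leRHS]/Rintegral E -/(Rintegral _ _ _).
by apply: le_Rintegral => // x _; rewrite le_max lexx.
Qed.

Definition itv_ind (a b s : R) : R := if a <= s <= b then 1 else 0.

Lemma itv_ind_ge0 a b s : 0 <= itv_ind a b s.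
Proof. by rewrite /itv_ind; case: ifP. Qed.

Lemma itv_ind_restrict a b (f : R -> R) :
  (fun s => f s * itv_ind a b s) = f \_ `[a, b].
Proof.
apply/funext => s; rewrite patchE /itv_ind mem_setE in_itv/=.
by case: ifP => _; rewrite ?mulr1 ?mulr0.
Qed.

Lemma Rintegral_itv_ind a b (f : R -> R) :
  \int[mu]_s (f s * itv_ind a b s) = \int[mu]_(s in `[a, b]) f s.
Proof. by rewrite itv_ind_restrict -Rintegral_mkcond. Qed.

Lemma integrable_itv_ind a b (f : R -> R) : mu.-integrable `[a, b] (EFin \o f) ->
  mu.-integrable [set: R] (EFin \o (fun s => f s * itv_ind a b s)).
Proof. by rewrite itv_ind_restrict -restrict_EFin -integrable_mkcond. Qed.

Lemma Rintegral_itv_cst (a b c : R) (x y : bool) : a <= b ->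
  \int[mu]_(_ in [set` Interval (BSide x a) (BSide y b)]) c = c * (b - a).
Proof.
move=> ab.
transitivity (c * fine (mu [set` Interval (BSide x a) (BSide y b)])).
  by apply: Rintegral_cst; exact: measurable_itv.
rewrite lebesgue_measure_itv; congr (_ * _).
rewrite (_ : (_ < _)%E = (a < b)); last by case: x; case: y; rewrite /= lte_fin.
case: ltP => ba; first by case: x; case: y.
by rewrite (_ : b = a) ?subrr//; apply/eqP; rewrite eq_le ab ba.
Qed.

End Shift.

(** * The look-ahead operator *)

Section OneSidedKernel.
Context {R : realType}.
Local Notation mu := (@lebesgue_measure R).

(** Models s -> gamma(s / eta) / eta, extended by 0 to the left and normalized at every point. It
    decreases only on [0, oo); the jump at 0 goes up, by at most k0. *)
Record one_sided (K : R -> R) (k0 : R) : Prop := OneSided {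
  os_int : mu.-integrable [set: R] (EFin \o K);
  os_neg : forall s, s < 0 -> K s = 0;
  os_ge0 : forall s, 0 <= K s;
  os_le : forall s, K s <= k0;
  os_ni : forall s t, 0 <= s -> s <= t -> K t <= K s }.

Definition look_ahead (K v : R -> R) (x : R) : R := \int[mu]_y (K (y - x) * v y).

Variables (K : R -> R) (k0 : R).
Hypothesis HK : one_sided K k0.

Lemma one_sided_bound_ge0 : 0 <= k0.
Proof. exact: le_trans (os_ge0 HK 0) (os_le HK 0). Qed.

(* [P h] has integral 0 and is nonnegative off [0, h], so that the negative part
   of its mass is at most k0 h. *)
Let P h s := K (s - h) - K s.

Lemma increment_integrable h : mu.-integrable [set: R] (EFin \o P h).
Proof.
exact: (@integrableB _ _ _ mu _ _ _ _ (integrable_shift (- h) (os_int HK)) (os_int HK)).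
Qed.

Lemma increment_integral h : \int[mu]_s P h s = 0.
Proof.
rewrite RintegralB//; [|exact: integrable_shift (os_int HK)|exact: os_int HK].
by rewrite Rintegral_shift ?subrr//; exact: os_int HK.
Qed.

(** For h <= s both arguments lie where K is nonincreasing. For s < h the shifted kernel vanishes,
    and only - K s is left. *)
Lemma increment_lower h s : 0 <= h -> - (k0 * itv_ind 0 h s) <= P h s.
Proof.
move=> h0; rewrite /P /itv_ind; have k00 := one_sided_bound_ge0.
have [hs|sh] := leP h s.
  have : K s <= K (s - h) by apply: (os_ni HK); lra.
  case: ifP; lra.
rewrite (os_neg HK (s := s - h)) ?subr_lt0// add0r lerN2 (ltW sh) andbT.
have [s0|s0] := ltP s 0; first by rewrite (os_neg HK s0) mulr0.
by rewrite mulr1 (os_le HK).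
Qed.

Lemma look_aheadB (v : R -> R) (M x h : R) :
  measurable_fun [set: R] v -> (forall y, `|v y| <= M) ->
  look_ahead K v (x + h) - look_ahead K v x = \int[mu]_s (P h s * v (s + x)).
Proof.
move=> mv vM.
have i1 c : mu.-integrable [set: R] (EFin \o (fun y => K (y - c) * v y)).
  by apply: (integrable_Mbounded _ _ mv vM) => //; exact: integrable_shift (os_int HK).
rewrite /look_ahead -RintegralB//.
rewrite -(Rintegral_shift x (f := fun y => K (y - (x + h)) * v y - K (y - x) * v y)).
  by apply: eq_Rintegral => s _; rewrite /P -mulrBl opprD addrA addrK.
exact: (@integrableB _ _ _ mu _ _ _ _ (i1 _) (i1 _)).
Qed.

(** |P h| is at most P h plus 2 k0 on [0, h]. As [P h] has integral 0, its L^1 norm is at most 2 k0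
    h. *)
Lemma look_ahead_lipschitz (v : R -> R) (M x y : R) :
  measurable_fun [set: R] v -> (forall z, `|v z| <= M) ->
  `|look_ahead K v x - look_ahead K v y| <= 2 * M * k0 * `|x - y|.
Proof.
move=> mv vM.
wlog xy : x y / y <= x.
  move=> W; have [yx|/ltW xy] := leP y x; first exact: W.
  by rewrite distrC (distrC x); exact: W.
have h0 : 0 <= x - y by rewrite subr_ge0.
rewrite (ger0_norm h0) -{1}(subrKC y x).
rewrite (look_aheadB _ _ mv vM).
set h := x - y in h0 *.
have mv' : measurable_fun [set: R] (fun s => v (s + y)) by exact: measurable_shift.
have iPv : mu.-integrable [set: R] (EFin \o (fun s => P h s * v (s + y))).
  by apply: (integrable_Mbounded _ (increment_integrable h) mv' (M := M)).
apply: le_trans (le_normr_Rintegral measurableT iPv) _.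
have ibox : mu.-integrable [set: R] (EFin \o (fun s => 2 * k0 * itv_ind 0 h s)).
  apply: (integrable_itv_ind (f := cst (2 * k0))).
  by apply: (@bounded_integrable_itv _ _ `|2 * k0|) => // z; exact: measurable_cst.
have iP := increment_integrable h.
have iPb : mu.-integrable [set: R] (EFin \o (fun s => P h s + 2 * k0 * itv_ind 0 h s)).
  exact: (@integrableD _ _ _ mu _ _ _ _ iP ibox).
apply: (@le_trans _ _ (\int[mu]_s (M * (P h s + 2 * k0 * itv_ind 0 h s)))).
  apply: le_Rintegral => //.
  - exact: integrable_norm iPv.
  - exact: (@integrableZl _ _ _ mu _ _ M _ iPb).
  move=> s _; rewrite normrM mulrC; apply: ler_pM => //.
  have := increment_lower s h0; have : 0 <= k0 * itv_ind 0 h s.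
    by rewrite mulr_ge0 ?one_sided_bound_ge0// /itv_ind; case: ifP.
  move=> b0 Pb; apply/ler_normlP; split; lra.
rewrite RintegralZl// RintegralD// increment_integral add0r.
rewrite (Rintegral_itv_ind 0 h (cst (2 * k0))) Rintegral_itv_cst// subr0; lra.
Qed.

(** Write [P h] as the nonnegative function [P h] + k0 1 minus k0 1, with 1 the indicator of [0, h],
    and d = u(s + x) - u(s + y) <= D. The difference V(u(s + x)) - V(u(s + y)) lies between - LV D
    and LV (D - d); the lower bound serves against the first part, the upper bound against the
    second. *)
Lemma look_ahead_compare (V u : R -> R) (M N LV D x y h g : R) :
  measurable_fun [set: R] u -> (forall z, `|u z| <= M) ->
  measurable_fun [set: R] (V \o u) -> (forall z, `|V (u z)| <= N) ->
  (forall a b, `|a| <= M -> `|b| <= M -> a <= b -> V b <= V a <= V b + LV * (b - a)) ->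
  0 <= LV -> 0 <= D -> 0 <= h ->
  (\forall s \ae mu, u (s + x) - u (s + y) <= D) ->
  - g <= \int[mu]_(s in `[x, x + h]) u s - \int[mu]_(s in `[y, y + h]) u s ->
  - (LV * k0 * (2 * (h * D) + g)) <=
    (look_ahead K (V \o u) (x + h) - look_ahead K (V \o u) x) -
    (look_ahead K (V \o u) (y + h) - look_ahead K (V \o u) y).
Proof.
move=> mu' uM mVu VN VL LV0 D0 h0 uD Gg.
have k00 := one_sided_bound_ge0.
rewrite !(look_aheadB _ _ mVu VN).
have iP := increment_integrable h.
have iPv c : mu.-integrable [set: R] (EFin \o (fun s => P h s * (V \o u) (s + c))).
  by apply: (integrable_Mbounded _ iP (measurable_shift c mVu) (M := N)) => // z; exact: VN.
rewrite -RintegralB//.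
pose d s := u (s + x) - u (s + y).
have iu c : mu.-integrable `[0, h] (EFin \o (fun s => u (s + c))).
  apply: (@bounded_integrable_itv _ _ M); first exact: measurable_shift.
  by move=> z; exact: uM.
have icst c : mu.-integrable `[0, h] (EFin \o (cst c : R -> R)).
  by apply: (@bounded_integrable_itv _ _ `|c|) => // z; exact: measurable_cst.
have id : mu.-integrable `[0, h] (EFin \o d).
  exact: (@integrableB _ _ _ mu _ _ _ _ (iu x) (iu y)).
have iDd : mu.-integrable `[0, h] (EFin \o (fun s => 2 * D - d s)).
  exact: (@integrableB _ _ _ mu _ _ _ _ (icst (2 * D)) id).
(* The sum of the two bounds. [P h] now has a constant coefficient and integrates to 0; the rest
   integrates to 2 h D minus the gap, up to the factor - LV k0. *)
pose F s := - (LV * D) * P h s + - (LV * k0) * ((2 * D - d s) * itv_ind 0 h s).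
have i1 : mu.-integrable [set: R] (EFin \o (fun s => - (LV * D) * P h s)).
  exact: (@integrableZl _ _ _ mu _ _ (- (LV * D)) _ iP).
have i2' := integrable_itv_ind iDd.
have i2 : mu.-integrable [set: R] (EFin \o (fun s => - (LV * k0) * ((2 * D - d s) * itv_ind 0 h s))).
  exact: (@integrableZl _ _ _ mu _ _ (- (LV * k0)) _ i2').
have iF : mu.-integrable [set: R] (EFin \o F).
  exact: (@integrableD _ _ _ mu _ _ _ _ i1 i2).
have iu_itv z : mu.-integrable `[0 + z, h + z] (EFin \o u) by exact: bounded_integrable_itv uM.
have FE : \int[mu]_s F s = - (LV * k0) * (2 * D * h -
    (\int[mu]_(s in `[x, x + h]) u s - \int[mu]_(s in `[y, y + h]) u s)).
  rewrite /F RintegralD// !RintegralZl// increment_integral mulr0 add0r.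
  rewrite Rintegral_itv_ind RintegralB//; last exact: icst.
  have -> : \int[mu]_(_ in `[0, h]) (2 * D) = 2 * D * h by rewrite Rintegral_itv_cst// subr0.
  rewrite /d RintegralB//.
  by rewrite !Rintegral_itv_shift// !add0r ![h + _]addrC.
apply: (@le_trans _ _ (\int[mu]_s F s)).
  rewrite FE; set G := (X in _ * (_ - X)); have {}Gg : - g <= G := Gg.
  clearbody G.
  have LVk : 0 <= LV * k0 by rewrite mulr_ge0.
  have := ler_wpM2l LVk Gg; clear; lra.
apply: ae_le_Rintegral => //.
  exact: (@integrableB _ _ _ mu _ _ _ _ (iPv x) (iPv y)).
move: uD; apply: filterS; first exact: (ae_filter_ringOfSetsType mu).
move=> s; rewrite -/(d s) => ds _.
rewrite -mulrBr /F /=.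
have Pb := increment_lower s h0.
have b0 : 0 <= itv_ind 0 h s by rewrite /itv_ind; case: ifP.
have du : u (s + x) = u (s + y) + d s by rewrite /d; ring.
have := uM (s + x); have := uM (s + y); move: Pb b0 du ds.
move: (u (s + x)) (u (s + y)) (P h s) (itv_ind 0 h s) (d s) => a b p be de Pb b0 -> ds bM aM.
clear -VL LV0 D0 k00 Pb b0 ds bM aM.
have kb0 : 0 <= k0 * be by rewrite mulr_ge0.
have pk0 : 0 <= p + k0 * be by lra.
have [d0|/ltW d0] := leP de 0.
  have /andP[h1 h2] := VL _ _ aM bM (ltac:(lra)).
  have := ler_wpM2l pk0 (_ : 0 <= V (b + de) - V b).
  rewrite subr_ge0 => /(_ h1) t1.
  have t2 := ler_wpM2l kb0 h2.
  have t3 : 0 <= LV * D * (p + k0 * be) by rewrite mulr_ge0// mulr_ge0.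
  have t4 : 0 <= LV * D * (k0 * be) by rewrite mulr_ge0// mulr_ge0.
  clear -t1 t2 t3 t4; lra.
have /andP[h1 h2] := VL _ _ bM aM (ltac:(lra)).
have t1 := ler_wpM2l pk0 h2.
have t2 := ler_wpM2l kb0 h1.
have t3 : (p + k0 * be) * (LV * de) <= (p + k0 * be) * (LV * D) by rewrite ler_wpM2l// ler_wpM2l.
have t4 : LV * (k0 * be) * de <= LV * (k0 * be) * D by rewrite ler_wpM2l// mulr_ge0.
clear -t1 t2 t3 t4; lra.
Qed.

End OneSidedKernel.

(** * Test functions *)

Section SmoothStep.
Context {R : realType}.

Definition pos (u : R) : R := Num.max u 0.

(* Tent on [0, 2] of integral 1; [step], its primitive, is a C^1 step from 0
   to 1. *)
Definition hat (u : R) : R := pos u - 2 * pos (u - 1) + pos (u - 2).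

Definition step (u : R) : R :=
  (pos u ^+ 2 - 2 * pos (u - 1) ^+ 2 + pos (u - 2) ^+ 2) / 2.

Lemma posE (u : R) : pos u = if u <= 0 then 0 else u.
Proof. by rewrite /pos /Num.max; case: ltgtP => // ->. Qed.

Local Ltac pos_cases u :=
  case: (leP u 0) => ?; case: (leP (u - 1) 0) => ?; case: (leP (u - 2) 0) => ?.

Lemma hat_ge0 u : 0 <= hat u.
Proof. by rewrite /hat !posE; pos_cases u; lra. Qed.

Lemma hat_le1 u : hat u <= 1.
Proof. by rewrite /hat !posE; pos_cases u; lra. Qed.

Lemma hat_out u : ~~ (0 <= u <= 2) -> hat u = 0.
Proof.
by rewrite negb_and -!ltNge => /orP h; rewrite /hat !posE; pos_cases u; case: h => ?; lra.
Qed.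

Lemma hat_le0 u : u <= 0 -> hat u = 0.
Proof. by move=> u0; rewrite /hat !posE; pos_cases u; lra. Qed.

Lemma hat_ge2 u : 2 <= u -> hat u = 0.
Proof. by move=> u0; rewrite /hat !posE; pos_cases u; lra. Qed.

Lemma step_le0 u : u <= 0 -> step u = 0.
Proof. by move=> u0; rewrite /step !posE; pos_cases u; nra. Qed.

Lemma step_ge2 u : 2 <= u -> step u = 1.
Proof. by move=> u0; rewrite /step !posE; pos_cases u; nra. Qed.

Lemma step_ge0 u : 0 <= step u.
Proof. by rewrite /step !posE; pos_cases u; nra. Qed.

Lemma step_le1 u : step u <= 1.
Proof. by rewrite /step !posE; pos_cases u; nra. Qed.

Lemma normr_stepB (u v : R) : `|step u - step v| <= 1.
Proof.
have u0 := step_ge0 u; have u1 := step_le1 u; have v0 := step_ge0 v; have v1 := step_le1 v.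
by apply/ler_normlP; split; lra.
Qed.

Lemma pos_sqr_remainder (u h : R) :
  0 <= pos (u + h) ^+ 2 - pos u ^+ 2 - h * (2 * pos u) <= h ^+ 2.
Proof. by rewrite !posE; case: (leP (u + h) 0) => ?; case: (leP u 0) => ?; nra. Qed.

Lemma step_remainder (u h : R) : `|step (u + h) - step u - h * hat u| <= 2 * h ^+ 2.
Proof.
have /andP[a1 a2] := pos_sqr_remainder u h.
have := pos_sqr_remainder (u - 1) h; rewrite [u - 1 + h]addrAC => /andP[b1 b2].
have := pos_sqr_remainder (u - 2) h; rewrite [u - 2 + h]addrAC => /andP[c1 c2].
by rewrite /step /hat; apply/ler_normlP; split; lra.
Qed.

Lemma pos_continuous : continuous pos.
Proof.
move=> x; apply: (continuous_max (f := id) (g := cst 0)); first exact: cvg_id.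
exact: cvg_cst.
Qed.

Lemma hat_continuous : continuous hat.
Proof.
move=> x; have ps (c : R) : pos (u - c) @[u --> x] --> pos (x - c).
  have h : u - c @[u --> x] --> x - c by apply: cvgB; [exact: cvg_id|exact: cvg_cst].
  exact: (cvg_comp _ _ h (@pos_continuous (x - c))).
apply: cvgD; last exact: ps.
apply: cvgB; first exact: pos_continuous.
by apply: cvgM; [exact: cvg_cst|exact: ps].
Qed.

Lemma step_continuous : continuous step.
Proof.
move=> x; have ps (c : R) : pos (u - c) @[u --> x] --> pos (x - c).
  have h : u - c @[u --> x] --> x - c by apply: cvgB; [exact: cvg_id|exact: cvg_cst].
  exact: (cvg_comp _ _ h (@pos_continuous (x - c))).
apply: cvgM; last exact: cvg_cst.
apply: cvgD; last by apply: cvgM; exact: ps.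
apply: cvgB; first by apply: cvgM; exact: pos_continuous.
by apply: cvgM; [exact: cvg_cst|apply: cvgM; exact: ps].
Qed.

(** Reads a directional derivative off a quadratic remainder. With [step_remainder], which holds
    uniformly across the breakpoints, the polynomial pieces of [step] need not be glued. *)
Lemma is_derive_quadratic (V : normedModType R) (f : V -> R) (x v : V) (l C : R) :
  (forall h : R, `|f (h *: v + x) - f x - h * l| <= C * h ^+ 2) -> is_derive x v f l.
Proof.
move=> H.
have C0 : 0 <= C by have := le_trans (normr_ge0 _) (H 1); rewrite expr1n mulr1.
have L : h^-1 *: ((f \o shift x) (h *: v) - f x) @[h --> 0^'] --> (l : R).
  apply/cvgrPdist_le => e e0; near=> h.
  have h0 : h != 0 by near: h; exact: nbhs_dnbhs_neq.
  rewrite /= -[_ *: _]/(_ * _) distrC.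
  rewrite (_ : _ - l = h^-1 * (f (h *: v + x) - f x - h * l)); last by field.
  rewrite normrM normfV ler_pdivrMl ?normr_gt0//.
  apply: le_trans (H h) _; rewrite -real_normK ?num_real// expr2 mulrA mulrC.
  apply: ler_wpM2l => //.
  have he : `|h| <= e / (C + 1).
    near: h; apply: dnbhs0_le; rewrite divr_gt0//; lra.
  apply: le_trans (ler_wpM2l C0 he) _.
  by rewrite mulrCA ler_piMr ?(ltW e0)// ler_pdivrMr; lra.
split; first by apply/cvg_ex; exists l.
exact: cvg_lim.
Unshelve. all: by end_near. Qed.

(* A triple (p, q, r) encodes the affine function p t + q x + r. *)
Definition ramp (k : R * R * R) (p : R * R) : R :=
  step (k.1.1 * p.1 + k.1.2 * p.2 + k.2).

Definition dramp (k : R * R * R) (v p : R * R) : R :=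
  hat (k.1.1 * p.1 + k.1.2 * p.2 + k.2) * (k.1.1 * v.1 + k.1.2 * v.2).

Lemma is_derive_ramp (k : R * R * R) (p v : R * R) : is_derive p v (ramp k) (dramp k v p).
Proof.
apply: (@is_derive_quadratic _ _ _ _ _ (2 * (k.1.1 * v.1 + k.1.2 * v.2) ^+ 2)) => h.
rewrite /ramp /dramp /=.
set u := k.1.1 * p.1 + k.1.2 * p.2 + k.2; set w := k.1.1 * v.1 + _.
rewrite (_ : k.1.1 * (h * v.1 + p.1) + k.1.2 * (h * v.2 + p.2) + k.2 = u + h * w);
  last by rewrite /u /w; ring.
have := step_remainder u (h * w); rewrite exprMn => H.
rewrite (_ : h * (hat u * w) = h * w * hat u); last by ring.
by rewrite (_ : 2 * w ^+ 2 * h ^+ 2 = 2 * (h ^+ 2 * w ^+ 2)); last by ring.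
Qed.

Lemma affine_continuous (k : R * R * R) :
  continuous (fun p : R * R => k.1.1 * p.1 + k.1.2 * p.2 + k.2).
Proof.
move=> p; apply: cvgD; last exact: cvg_cst.
apply: cvgD; apply: cvgM; (try exact: cvg_cst); [exact: cvg_fst|exact: cvg_snd].
Qed.

Lemma ramp_continuous (k : R * R * R) : continuous (ramp k).
Proof.
move=> p; exact: (cvg_comp _ _ (@affine_continuous k p) (@step_continuous _)).
Qed.

Lemma dramp_continuous (k : R * R * R) v : continuous (dramp k v).
Proof.
move=> p; apply: cvgM; last exact: cvg_cst.
exact: (cvg_comp _ _ (@affine_continuous k p) (@hat_continuous _)).
Qed.

(** A difference of two ramps is a smoothed indicator. The first factor will be a cutoff in time,
    the second will follow a moving strip. *)
Definition bump (k1 k2 l1 l2 : R * R * R) (p : R * R) : R :=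
  (ramp k1 p - ramp k2 p) * (ramp l1 p - ramp l2 p).

Definition dbump (k1 k2 l1 l2 : R * R * R) (v p : R * R) : R :=
  (ramp k1 p - ramp k2 p) * (dramp l1 v p - dramp l2 v p) +
  (dramp k1 v p - dramp k2 v p) * (ramp l1 p - ramp l2 p).

Lemma is_derive_bump (k1 k2 l1 l2 : R * R * R) (p v : R * R) :
  is_derive p v (bump k1 k2 l1 l2) (dbump k1 k2 l1 l2 v p).
Proof.
have d1 := is_derive_ramp k1 p v; have d2 := is_derive_ramp k2 p v.
have d3 := is_derive_ramp l1 p v; have d4 := is_derive_ramp l2 p v.
have d12 : is_derive p v (fun p => ramp k1 p - ramp k2 p) (dramp k1 v p - dramp k2 v p).
  exact: is_deriveB.
have d34 : is_derive p v (fun p => ramp l1 p - ramp l2 p) (dramp l1 v p - dramp l2 v p).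
  exact: is_deriveB.
apply: (is_derive_eq (is_deriveM d12 d34)).
by rewrite /dbump [X in _ + X]mulrC.
Qed.

Lemma dbumpE (k1 k2 l1 l2 : R * R * R) (v : R * R) :
  'D_v (bump k1 k2 l1 l2) = dbump k1 k2 l1 l2 v.
Proof. by apply/funext => p; apply: derive_val; exact: is_derive_bump. Qed.

Lemma dbump_continuous (k1 k2 l1 l2 : R * R * R) v : continuous (dbump k1 k2 l1 l2 v).
Proof.
move=> p; apply: cvgD; apply: cvgM; apply: cvgB.
- exact: ramp_continuous.
- exact: ramp_continuous.
- exact: dramp_continuous.
- exact: dramp_continuous.
- exact: dramp_continuous.
- exact: dramp_continuous.
- exact: ramp_continuous.
- exact: ramp_continuous.
Qed.

Lemma bump_C1c (k1 k2 l1 l2 : R * R * R) (a b lo hi K : R) :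
  a < lo -> hi < b ->
  (forall p, bump k1 k2 l1 l2 p != 0 -> lo <= p.1 <= hi /\ `|p.2| <= K) ->
  C1c_strip a b (bump k1 k2 l1 l2).
Proof.
move=> alo hib supp.
have box : compact (`[lo, hi]%classic `*` `[- K, K]%classic : set (R * R)).
  by apply: compact_setX; exact: segment_compact.
have sub : closure [set p | bump k1 k2 l1 l2 p != 0] `<=` `[lo, hi] `*` `[- K, K].
  rewrite [X in _ `<=` X]((closure_id _).1 _); last first.
    by apply: compact_closed => //; exact: norm_hausdorff.
  apply: closureS => p /supp[p1 p2]; split; rewrite /= in_itv//=.
  by move: p2; rewrite ler_norml.
split.
- by move=> p; split; apply: ex_derive; exact: is_derive_bump.
- by rewrite dbumpE; exact: dbump_continuous.
- by rewrite dbumpE; exact: dbump_continuous.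
- by apply: subclosed_compact box sub; exact: closed_closure.
- apply: (subset_trans sub) => p [/= p1 _]; split => //=.
  by move: p1; rewrite !in_itv/= => /andP[p1 p1']; rewrite (lt_le_trans alo)//= (le_lt_trans p1').
Qed.

End SmoothStep.

(** * Mass in moving strips *)

Section FubiniStrip.
Context {R : realType}.
Local Notation mu := (@lebesgue_measure R).
Local Notation mu2 := (mu \x mu)%E.
Variables (F : R * R -> R) (a b C K : R).
Hypothesis mF : measurable_fun [set: R * R] F.
Hypothesis FC : forall p, `|F p| <= C.
Hypothesis F0 : forall p, K < `|p.2| -> F p = 0.

Let D : set (R * R) := `]a, b[ `*` [set: R].

Let mD : measurable D.
Proof. by apply: measurableX. Qed.

(** [D] is unbounded in space, but on it F lives in a box of finite measure. *)
Lemma strip_integrable : mu2.-integrable D (EFin \o F).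
Proof.
pose A : set (R * R) := `]a, b[%classic `*` `[- K, K]%classic.
have mA : measurable A by apply: measurableX.
have finA : (mu2 A < +oo)%E.
  rewrite /A product_measure1E; [|exact: measurable_itv|exact: measurable_itv].
  apply: lte_mul_pinfty => //; last exact: lebesgue_itv_lty.
  by rewrite ge0_fin_numE//; exact: lebesgue_itv_lty.
have iA : mu2.-integrable A (EFin \o F).
  apply: measurable_bounded_integrable => //; first exact: measurable_funTS.
  by exists C; split; [exact: num_real|move=> u Mu z _; apply: le_trans (FC z) (ltW Mu)].
have E : (EFin \o F) \_ D = (EFin \o F) \_ A.
  apply/funext => p; rewrite !patchE.
  have [pD|pD] := boolP (p \in D); have [pA|pA] := boolP (p \in A) => //=.
    rewrite F0//; rewrite notin_setE in pA; rewrite inE in pD.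
    rewrite ltNge; apply/negP => pK; apply: pA; split; first by case: pD.
    by rewrite /= in_itv/= -ler_norml.
  rewrite inE in pA; rewrite notin_setE in pD.
  by exfalso; apply: pD; split => //; case: pA.
by rewrite integrable_mkcond// E -integrable_mkcond.
Qed.

Lemma section_integrable t : mu.-integrable [set: R] (EFin \o (fun x => F (t, x))).
Proof.
have mFt : measurable_fun [set: R] (fun x => F (t, x)) by exact: measurableT_comp.
have iA : mu.-integrable `[- K, K] (EFin \o (fun x => F (t, x))).
  by apply: bounded_integrable_itv => // z; exact: FC.
have E : (EFin \o (fun x => F (t, x))) \_ [set: R] = (EFin \o (fun x => F (t, x))) \_ `[- K, K].
  apply/funext => x; rewrite !patchE in_setT.
  case: ifPn => //; rewrite notin_setE/= in_itv/= -ler_norml => /negP; rewrite -ltNge => h.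
  by rewrite F0.
by rewrite integrable_mkcond// E -integrable_mkcond.
Qed.

Lemma fubini_strip :
  mu.-integrable `]a, b[ (EFin \o (fun t => \int[mu]_x F (t, x))) /\
  \int[mu2]_(p in D) F p = \int[mu]_(t in `]a, b[) \int[mu]_x F (t, x).
Proof.
have iD := strip_integrable.
have iG : mu2.-integrable [set: R * R] ((EFin \o F) \_ D) by rewrite -integrable_mkcond.
have E t : (\int[mu]_x ((EFin \o F) \_ D) (t, x))%E =
    ((EFin \o (fun t => \int[mu]_x F (t, x))) \_ `]a, b[) t.
  rewrite patchE; case: ifPn => tI.
    rewrite /= /Rintegral fineK; last first.
      exact: (integrable_fin_num _ (section_integrable t)).
    apply: eq_integral => x _; rewrite patchE mem_set//.
    by split => //=; rewrite inE in tI.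
  rewrite (_ : (fun x => _) = cst 0%E) ?integral0//.
  apply/funext => x; rewrite patchE memNset//= => -[tI' _].
  by move: tI; rewrite notin_setE.
split.
  rewrite integrable_mkcond//.
  have := integrable_fubini_F iG.
  by rewrite /fubini_F (_ : (fun x => _) = ((EFin \o (fun t => \int[mu]_x F (t, x))) \_ `]a, b[))//; apply/funext.
rewrite /Rintegral integral_mkcond -(integral12_prod_meas1 iG) [in RHS]integral_mkcond.
by congr fine; apply: eq_integral => t _; rewrite -[LHS]/(\int[mu]_x ((EFin \o F) \_ D) (t, x))%E E.
Qed.

End FubiniStrip.

(** * The weak formulation tested with a time cutoff times a strip *)

Section Tested.
Context {R : realType}.
Local Notation mu := (@lebesgue_measure R).

Lemma step_measurable : measurable_fun [set: R] (@step R).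
Proof. exact: continuous_measurable_fun (@step_continuous R). Qed.

Lemma hat_measurable : measurable_fun [set: R] (@hat R).
Proof. exact: continuous_measurable_fun (@hat_continuous R). Qed.

Lemma affine2_measurable (k : R * R * R) :
  measurable_fun [set: R * R] (fun p : R * R => k.1.1 * p.1 + k.1.2 * p.2 + k.2).
Proof.
by apply: measurable_funD => //; apply: measurable_funD; apply: measurable_funM.
Qed.

Lemma ramp_measurable (k : R * R * R) : measurable_fun [set: R * R] (ramp k).
Proof. exact: measurableT_comp step_measurable (affine2_measurable k). Qed.

Lemma dramp_measurable (k : R * R * R) v : measurable_fun [set: R * R] (dramp k v).
Proof.
apply: measurable_funM => //.
exact: measurableT_comp hat_measurable (affine2_measurable k).
Qed.

Lemma normr_ramp (k : R * R * R) p : `|ramp k p| <= 1.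
Proof. by rewrite ger0_norm ?step_ge0// step_le1. Qed.

Lemma normr_dramp (k : R * R * R) v p :
  `|dramp k v p| <= `|k.1.1 * v.1 + k.1.2 * v.2|.
Proof. by rewrite /dramp normrM ler_piMl// ger0_norm ?hat_ge0// hat_le1. Qed.

(** What the mass balances use of a weak solution. The bounds are required at every point, which a
    truncated representative will provide, and the equation is kept for bumps only, with explicit
    derivatives. *)
Record weak_data (T M B L : R) (q W : R -> R -> R) (q0 : R -> R) : Prop := WeakData {
  wd_q : measurable_fun [set: R * R] (fun p => q p.1 p.2);
  wd_qM : forall t x, `|q t x| <= M;
  wd_W : measurable_fun [set: R * R] (fun p => W p.1 p.2);
  wd_WB : forall t x, `|W t x| <= B;
  wd_WL : forall t x y, `|W t x - W t y| <= L * `|x - y|;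
  wd_cont : forall t0, 0 <= t0 <= T -> forall K e : R, 0 < e ->
    exists2 d : R, 0 < d & forall s, 0 <= s <= T -> `|s - t0| <= d ->
      \int[mu]_(x in `[- K, K]) `|q s x - q t0 x| <= e;
  wd_q0 : measurable_fun [set: R] q0;
  wd_q0M : forall x, `|q0 x| <= M;
  wd_weak : forall k1 k2 l1 l2, C1c_strip (- 42%:R) T (bump k1 k2 l1 l2) ->
    \int[(mu \x mu)%E]_(p in `]0, T[ `*` [set: R])
       (q p.1 p.2 * (dbump k1 k2 l1 l2 (1, 0) p +
          W p.1 p.2 * dbump k1 k2 l1 l2 (0, 1) p)) +
    \int[mu]_(x in [set: R]) (q0 x * bump k1 k2 l1 l2 (0, x)) = 0 }.

Variables (T M B L : R) (q W : R -> R -> R) (q0 : R -> R).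
Hypothesis H : weak_data T M B L q W q0.

Definition tested_mass (l1 l2 : R * R * R) (t : R) : R :=
  \int[mu]_x (q t x * (ramp l1 (t, x) - ramp l2 (t, x))).

(** q is integrated against the derivative of the smoothed strip along (1, W); this is small when
    the sides of the strip nearly follow characteristics. *)
Definition tested_flux (l1 l2 : R * R * R) (t : R) : R :=
  \int[mu]_x (q t x *
    ((dramp l1 (1, 0) (t, x) - dramp l2 (1, 0) (t, x)) +
     W t x * (dramp l1 (0, 1) (t, x) - dramp l2 (0, 1) (t, x)))).

(** By the product rule and Fubini, S' multiplies the mass and S the flux, while the initial datum
    enters through S 0. *)
Lemma weak_tested (s1 r1 s2 r2 lo hi K : R) (l1 l2 : R * R * R) :
  let S t := step (s1 * t + r1) - step (s2 * t + r2) in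
  let S' t := s1 * hat (s1 * t + r1) - s2 * hat (s2 * t + r2) in
  - 42%:R < lo -> hi < T ->
  (forall t, ~~ (lo <= t <= hi) -> S t = 0 /\ S' t = 0) ->
  (forall t x, lo <= t <= hi -> K < `|x| -> ramp l1 (t, x) = ramp l2 (t, x) /\
     forall v, dramp l1 v (t, x) = 0 /\ dramp l2 v (t, x) = 0) ->
  [/\ mu.-integrable `]0, T[ (EFin \o (fun t => S' t * tested_mass l1 l2 t)),
      mu.-integrable `]0, T[ (EFin \o (fun t => S t * tested_flux l1 l2 t)) &
      \int[mu]_(t in `]0, T[) (S' t * tested_mass l1 l2 t) +
      \int[mu]_(t in `]0, T[) (S t * tested_flux l1 l2 t) +
      S 0 * \int[mu]_x (q0 x * (ramp l1 (0, x) - ramp l2 (0, x))) = 0].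
Proof.
move=> S S' lo42 hiT Sout Kout.
pose k1 : R * R * R := (s1, 0, r1); pose k2 : R * R * R := (s2, 0, r2).
have SE p : ramp k1 p - ramp k2 p = S p.1.
  by rewrite /ramp /S /= !mul0r !addr0.
have S'E p : dramp k1 (1, 0) p - dramp k2 (1, 0) p = S' p.1.
  by rewrite /dramp /S' /= !mul0r !addr0 !mulr1 mulrC [X in _ - X]mulrC.
have S0E p : dramp k1 (0, 1) p - dramp k2 (0, 1) p = 0.
  by rewrite /dramp /= !mul0r !mulr0 !addr0 !mulr0 subrr.
pose psi p := ramp l1 p - ramp l2 p.
pose Dpsi p := (dramp l1 (1, 0) p - dramp l2 (1, 0) p) +
     W p.1 p.2 * (dramp l1 (0, 1) p - dramp l2 (0, 1) p).
have C1c : C1c_strip (- 42%:R) T (bump k1 k2 l1 l2).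
  apply: (bump_C1c (K := K) lo42 hiT) => p; rewrite /bump SE mulf_eq0 negb_or.
  move=> /andP[St pt].
  have tI : lo <= p.1 <= hi.
    by apply/negPn/negP => /Sout[S0 _]; rewrite S0 eqxx in St.
  split => //; rewrite leNgt; apply/negP => pK.
  by have [+ _] := Kout _ _ tI pK; case: p {St tI pK} pt => t x /= + E; rewrite E subrr eqxx.
have mS : measurable_fun [set: R * R] (fun p : R * R => S p.1).
  rewrite (_ : (fun p => _) = (fun p => ramp k1 p - ramp k2 p));
    last by apply/funext => p; rewrite SE.
  by apply: measurable_funB; exact: ramp_measurable.
have mS' : measurable_fun [set: R * R] (fun p : R * R => S' p.1).
  rewrite (_ : (fun p => _) = (fun p => dramp k1 (1, 0) p - dramp k2 (1, 0) p));
    last by apply/funext => p; rewrite S'E.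
  by apply: measurable_funB; exact: dramp_measurable.
have mpsi : measurable_fun [set: R * R] psi.
  by apply: measurable_funB; exact: ramp_measurable.
have mDpsi : measurable_fun [set: R * R] Dpsi.
  apply: measurable_funD; first by apply: measurable_funB; exact: dramp_measurable.
  apply: measurable_funM; first exact: (wd_W H).
  by apply: measurable_funB; exact: dramp_measurable.
pose F1 p := q p.1 p.2 * (S' p.1 * psi p).
pose F2 p := q p.1 p.2 * (S p.1 * Dpsi p).
have mF1 : measurable_fun [set: R * R] F1.
  by apply: measurable_funM; [exact: (wd_q H)|exact: measurable_funM].
have mF2 : measurable_fun [set: R * R] F2.
  by apply: measurable_funM; [exact: (wd_q H)|exact: measurable_funM].
have psi2 p : `|psi p| <= 2.
  by apply: le_trans (ler_normB _ _) _; apply: (lerD (normr_ramp _ _) (normr_ramp _ _)).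
have S2 t : `|S t| <= 2.
  by rewrite -(SE (t, 0));
    apply: le_trans (ler_normB _ _) _; apply: (lerD (normr_ramp _ _) (normr_ramp _ _)).
pose cS' : R := `|s1| + `|s2|.
have S'C t : `|S' t| <= cS'.
  apply: le_trans (ler_normB _ _) _; by apply: lerD;
    rewrite normrM ler_piMr// ger0_norm ?hat_ge0// hat_le1.
pose cD : R := (`|l1.1.1| + `|l2.1.1|) + B * (`|l1.1.2| + `|l2.1.2|).
have DC p : `|Dpsi p| <= cD.
  apply: le_trans (ler_normD _ _) _; apply: lerD.
    apply: le_trans (ler_normB _ _) _; apply: lerD; apply: le_trans (normr_dramp _ _ _) _;
      by rewrite /= mulr1 mulr0 addr0.
  rewrite normrM; apply: ler_pM => //; first exact: (wd_WB H).
  apply: le_trans (ler_normB _ _) _; apply: lerD; apply: le_trans (normr_dramp _ _ _) _;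
    by rewrite /= mulr1 mulr0 add0r.
have F1C p : `|F1 p| <= M * (cS' * 2).
  rewrite !normrM; have h := ler_pM (normr_ge0 (S' p.1)) (normr_ge0 (psi p)) (S'C p.1) (psi2 p).
  exact: (ler_pM (normr_ge0 _) (mulr_ge0 (normr_ge0 _) (normr_ge0 _)) (wd_qM H _ _) h).
have F2C p : `|F2 p| <= M * (2 * cD).
  rewrite !normrM; have h := ler_pM (normr_ge0 (S p.1)) (normr_ge0 (Dpsi p)) (S2 p.1) (DC p).
  exact: (ler_pM (normr_ge0 _) (mulr_ge0 (normr_ge0 _) (normr_ge0 _)) (wd_qM H _ _) h).
have out (p : R * R) : K < `|p.2| -> S' p.1 * psi p = 0 /\ S p.1 * Dpsi p = 0.
  move=> pK; have [tI|/Sout[-> ->]] := boolP (lo <= p.1 <= hi); last by rewrite !mul0r.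
  have [E1 E2] := Kout _ _ tI pK; rewrite /psi /Dpsi.
  case: p {pK tI} E1 E2 => t x /= E1 E2.
  by rewrite E1 !(E2 _).1 !(E2 _).2 !subrr !mulr0 addr0 mulr0.
have F1K (p : R * R) : K < `|p.2| -> F1 p = 0 by move=> /out[E _]; rewrite /F1 E mulr0.
have F2K (p : R * R) : K < `|p.2| -> F2 p = 0 by move=> /out[_ E]; rewrite /F2 E mulr0.
have [i1 f1] := fubini_strip 0 T mF1 F1C F1K.
have [i2 f2] := fubini_strip 0 T mF2 F2C F2K.
have s1i := strip_integrable 0 T mF1 F1C F1K.
have s2i := strip_integrable 0 T mF2 F2C F2K.
have sec t (g : R -> R) (c : R) :
    mu.-integrable [set: R] (EFin \o (fun x => q t x * (c * g x))) ->
    \int[mu]_x (q t x * (c * g x)) = c * \int[mu]_x (q t x * g x).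
  (* Integrability is known only with the factor c inside; it can be divided out unless c = 0. *)
  move=> gi; have [->|c0] := eqVneq c 0.
    rewrite mul0r (_ : (fun x => _) = cst 0) ?Rintegral_cst ?mul0r//.
    by apply/funext => x; rewrite mul0r mulr0.
  transitivity (c * \int[mu]_x (c^-1 * (q t x * (c * g x)))).
    by rewrite RintegralZl// mulrA divff// mul1r.
  by congr (_ * _); apply: eq_Rintegral => x _; field.
have E1 t : \int[mu]_x F1 (t, x) = S' t * tested_mass l1 l2 t.
  exact: (sec t (fun x => psi (t, x)) (S' t) (section_integrable mF1 F1C F1K t)).
have E2 t : \int[mu]_x F2 (t, x) = S t * tested_flux l1 l2 t.
  exact: (sec t (fun x => Dpsi (t, x)) (S t) (section_integrable mF2 F2C F2K t)).
have E1' : (fun t => \int[mu]_x F1 (t, x)) = (fun t => S' t * tested_mass l1 l2 t) by exact/funext.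
have E2' : (fun t => \int[mu]_x F2 (t, x)) = (fun t => S t * tested_flux l1 l2 t) by exact/funext.
rewrite E1' in i1 f1; rewrite E2' in i2 f2.
split => //.
rewrite -f1 -f2 -RintegralD//; last by apply: measurableX.
rewrite -[RHS](wd_weak H C1c).
congr (_ + _).
  apply: eq_Rintegral => p _; rewrite /F1 /F2 /dbump SE S'E S0E /Dpsi /psi; ring.
rewrite (_ : (fun x => _ * bump _ _ _ _ _) = (fun x => S 0 * (q0 x * psi (0, x)))); last first.
  by apply/funext => x; rewrite /bump SE mulrCA.
have [->|S00] := eqVneq (S 0) 0.
  rewrite mul0r (_ : (fun x => _) = cst 0) ?Rintegral_cst ?mul0r//.
  by apply/funext => x; rewrite mul0r.
rewrite RintegralZl//.
(* S 0 is nonzero here, so 0 is a time at which [Kout] confines the strip to a compact set. *)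
have t0 : lo <= 0 <= hi by apply/negPn/negP => /Sout[S0 _]; rewrite S0 eqxx in S00.
have E : (EFin \o (fun x => q0 x * psi (0, x))) = (EFin \o (fun x => q0 x * psi (0, x))) \_ `[- K, K].
  apply/funext => x; rewrite patchE.
  case: ifPn => //; rewrite notin_setE/= in_itv/= -ler_norml => /negP; rewrite -ltNge => h.
  by rewrite /psi (Kout _ _ t0 h).1 subrr mulr0.
rewrite E -integrable_mkcond//.
apply: (bounded_integrable_itv (M := M * 2)).
  apply: measurable_funM; first exact: (wd_q0 H).
  exact: (measurableT_comp mpsi).
move=> x; rewrite normrM; apply: (ler_pM (normr_ge0 _) (normr_ge0 _) (wd_q0M H _) (psi2 _)).
Qed.

End Tested.

(** * Approximate Dirac masses in time *)

Section Average.
Context {R : realType}.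
Local Notation mu := (@lebesgue_measure R).

Lemma is_derive_step (x : R) : is_derive x 1 (@step R) (hat x).
Proof.
apply: (@is_derive_quadratic _ _ _ _ _ _ 2) => h.
by rewrite -[h *: 1]/(h * 1) mulr1 [h + x]addrC step_remainder.
Qed.

Lemma hat_restrict : @hat R = (@hat R) \_ `[0, 2].
Proof.
apply/funext => x; rewrite patchE mem_setE in_itv/=.
by case: ifPn => // /hat_out.
Qed.

Lemma hat_integrable : mu.-integrable [set: R] (EFin \o @hat R).
Proof.
rewrite hat_restrict -restrict_EFin -integrable_mkcond//.
apply: (bounded_integrable_itv (M := 1)); first exact: hat_measurable.
by move=> z; rewrite ger0_norm ?hat_ge0// hat_le1.
Qed.

Lemma hat_integral : \int[mu]_x hat x = 1 :> R.
Proof.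
rewrite hat_restrict -Rintegral_mkcond /Rintegral.
rewrite (@continuous_FTC2 _ _ (@step R)) //.
- by rewrite -EFinB /= step_ge2// step_le0// subr0.
- by apply: continuous_subspaceT; exact: hat_continuous.
- split.
  + by move=> x _; apply: ex_derive; exact: is_derive_step.
  + exact/cvg_at_right_filter/step_continuous.
  + exact/cvg_at_left_filter/step_continuous.
- by move=> x _; rewrite derive1E; apply: derive_val; exact: is_derive_step.
Qed.

(** A weight of integral 1 on [tau, tau + 2 d], in the shape in which it occurs in S' in
    [weak_tested]. *)
Definition time_hat (d tau t : R) : R := d^-1 * hat (d^-1 * t + - (tau / d)).

Lemma time_hat_ge0 d tau t : 0 < d -> 0 <= time_hat d tau t.
Proof. by move=> d0; rewrite mulr_ge0 ?hat_ge0// invr_ge0 ltW. Qed.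

Lemma time_hat_out d tau t : 0 < d -> ~~ (tau < t < tau + 2 * d) -> time_hat d tau t = 0.
Proof.
move=> d0; rewrite negb_and -!leNgt => h; rewrite /time_hat.
rewrite (_ : d^-1 * t + - (tau / d) = (t - tau) / d); last by field; exact: lt0r_neq0.
case/orP: h => h.
  by rewrite hat_le0 ?mulr0// ler_pdivrMr// mul0r subr_le0.
rewrite hat_ge2 ?mulr0// ler_pdivlMr//; clear -h; lra.
Qed.

Lemma time_hat_integral (T d tau : R) : 0 < d -> 0 <= tau -> tau + 2 * d <= T ->
  mu.-integrable `]0, T[ (EFin \o time_hat d tau) /\
  \int[mu]_(t in `]0, T[) time_hat d tau t = 1.
Proof.
move=> d0 tau0 tauT.
have di0 : 0 < d^-1 by rewrite invr_gt0.
have E : time_hat d tau = (time_hat d tau) \_ `]0, T[.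
  apply/funext => t; rewrite patchE mem_setE in_itv/=.
  case: ifPn => // h; rewrite time_hat_out//; apply: contra h => /andP[t1 t2].
  by apply/andP; split; lra.
have i1 := integrable_affine d^-1 (- (tau / d)) di0 _ hat_integrable.
have i2 : mu.-integrable [set: R] (EFin \o time_hat d tau).
  exact: (@integrableZl _ _ _ mu _ _ d^-1 _ i1).
split.
  by rewrite integrable_mkcond// restrict_EFin -E.
rewrite Rintegral_mkcond -E RintegralZl// (Rintegral_affine d^-1 _ di0)//;
  last exact: hat_integrable.
by rewrite hat_integral invrK mulr1 mulVf// lt0r_neq0.
Qed.

End Average.

(** * Smoothed strips with straight sides *)

Section Edges.
Context {R : realType}.
Local Notation mu := (@lebesgue_measure R).

(* The ramp from 0 to 1, of width 2 eps, starting on the line of slope c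
   that passes through (tau, a). *)
Definition edge (eps a c tau : R) : R * R * R :=
  (- (c / eps), eps^-1, - ((a - tau * c) / eps)).

Lemma ramp_edge (eps a c tau t x : R) : 0 < eps ->
  ramp (edge eps a c tau) (t, x) = step ((x - (a - (tau - t) * c)) / eps).
Proof. by move=> e0; rewrite /ramp /=; congr step; field; exact: lt0r_neq0. Qed.

Lemma dramp_edge (eps a c tau t x : R) v : 0 < eps ->
  dramp (edge eps a c tau) v (t, x) =
    hat ((x - (a - (tau - t) * c)) / eps) * ((v.2 - c * v.1) / eps).
Proof.
by move=> e0; rewrite /dramp /=; congr (hat _ * _); field; exact: lt0r_neq0.
Qed.

Lemma hat_div_le (eps a x : R) : 0 < eps ->
  hat ((x - a) / eps) <= itv_ind a (a + 2 * eps) x.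
Proof.
move=> e0; rewrite /itv_ind; case: ifPn => [_|h]; first exact: hat_le1.
rewrite hat_out//; apply: contra h.
by rewrite ler_pdivlMr// ler_pdivrMr// mul0r => /andP[h1 h2]; apply/andP; split; lra.
Qed.

Lemma Rintegral_le_ind (g : R -> R) (k l a b : R) : measurable_fun [set: R] g -> 0 <= l ->
  (forall x, `|g x| <= k * (itv_ind a (a + l) x + itv_ind b (b + l) x)) ->
  mu.-integrable [set: R] (EFin \o g) /\ `|\int[mu]_x g x| <= 2 * k * l.
Proof.
move=> mg l0 gk.
have ii c : mu.-integrable [set: R] (EFin \o (fun x => k * itv_ind c (c + l) x)).
  apply: (integrable_itv_ind (f := cst k)).
  by apply: (@bounded_integrable_itv _ _ `|k|) => // z; exact: measurable_cst.
have i2 : mu.-integrable [set: R]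
    (EFin \o (fun x => k * itv_ind a (a + l) x + k * itv_ind b (b + l) x)).
  exact: (@integrableD _ _ _ mu _ _ _ _ (ii a) (ii b)).
have gi : mu.-integrable [set: R] (EFin \o g).
  apply: (@le_integrable _ _ _ mu _ _ _ _ _ _ i2) => //; first exact/measurable_EFinP.
  by move=> x _ /=; rewrite lee_fin -mulrDr; apply: le_trans (gk x) (ler_norm _).
split => //; apply: le_trans (le_normr_Rintegral measurableT gi) _.
apply: (@le_trans _ _ (\int[mu]_x (k * itv_ind a (a + l) x + k * itv_ind b (b + l) x))).
  apply: le_Rintegral => //; first exact: integrable_norm gi.
  by move=> x _; rewrite -mulrDr.
rewrite RintegralD//.
rewrite !(Rintegral_itv_ind _ _ (cst k)) !Rintegral_itv_cst ?lerDl//.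
by rewrite !(addrC _ l) !addrK; clear; lra.
Qed.

Lemma step_lipschitz (u h : R) : `|step (u + h) - step u| <= `|h| + 2 * h ^+ 2.
Proof.
have := step_remainder u h.
have : `|h * hat u| <= `|h|.
  by rewrite normrM ler_piMr// ger0_norm ?hat_ge0// hat_le1.
rewrite -[X in _ -> _ -> `|X| <= _](subrK (h * hat u)) => h1 h2.
by apply: le_trans (ler_normD _ _) _; rewrite [leRHS]addrC; exact: lerD.
Qed.

Variables (T M B L : R) (q W : R -> R -> R) (q0 : R -> R).
Hypothesis H : weak_data T M B L q W q0.

Lemma M_ge0 : 0 <= M.
Proof. exact: le_trans (normr_ge0 _) (wd_qM H 0 0). Qed.

Lemma L_ge0 : 0 <= L.
Proof.
by have := le_trans (normr_ge0 _) (wd_WL H 0 1 0); rewrite subr0 normr1 mulr1.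
Qed.

Lemma section_measurable (F : R * R -> R) (t : R) :
  measurable_fun [set: R * R] F -> measurable_fun [set: R] (fun x => F (t, x)).
Proof. by move=> mF; exact: measurableT_comp. Qed.

(** Differentiating a side of slope c along (1, W) gives at most |W - c| / eps on a layer of width 2
    eps, where |W - c| <= w + 2 L eps. The width cancels 1 / eps, and two sides give the factor
    4. *)
Lemma flux_bound (eps a b c c' tau w t : R) : 0 < eps ->
  `|W t (a - (tau - t) * c) - c| <= w -> `|W t (b - (tau - t) * c') - c'| <= w ->
  `|tested_flux q W (edge eps a c tau) (edge eps b c' tau) t| <= 4 * M * (w + 2 * L * eps).
Proof.
move=> e0 ac bc.
set al := a - _ in ac; set be := b - _ in bc.
rewrite /tested_flux.
set g := (fun x : R => _).
have gE x : g x = q t x * (hat ((x - al) / eps) * ((W t x - c) / eps) -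
    hat ((x - be) / eps) * ((W t x - c') / eps)).
  by rewrite /g !dramp_edge//=; congr (_ * _); rewrite -/al -/be; field; exact: lt0r_neq0.
have mg : measurable_fun [set: R] g.
  apply: measurable_funM; first exact: (section_measurable _ (wd_q H)).
  apply: measurable_funD.
    apply: measurable_funB; apply: section_measurable; exact: dramp_measurable.
  apply: measurable_funM; first exact: (section_measurable _ (wd_W H)).
  apply: measurable_funB; apply: section_measurable; exact: dramp_measurable.
have e20 : 0 <= 2 * eps by rewrite mulr_ge0// ltW.
pose k := M * ((w + 2 * L * eps) / eps).
have w0 : 0 <= w by exact: le_trans ac.
have wL0 : 0 <= (w + 2 * L * eps) / eps.
  by rewrite divr_ge0 ?(ltW e0)// addr_ge0// !mulr_ge0 ?L_ge0// ltW.
have bnd z d x : `|W t z - d| <= w ->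
    `|hat ((x - z) / eps) * ((W t x - d) / eps)| <=
      (w + 2 * L * eps) / eps * itv_ind z (z + 2 * eps) x.
  move=> zd; rewrite normrM mulrC.
  have := hat_div_le z x e0; rewrite {2}/itv_ind /itv_ind; case: ifPn => zx hx; last first.
    rewrite (_ : hat _ = 0) ?normr0 ?mulr0//.
    by apply/eqP; rewrite eq_le hx hat_ge0.
  apply: ler_pM => //; last by rewrite ger0_norm ?hat_ge0.
  rewrite normrM normfV (gtr0_norm e0) ler_pM2r ?invr_gt0//.
  rewrite (_ : W t x - d = (W t z - d) + (W t x - W t z)); last by ring.
  apply: le_trans (ler_normD _ _) _; apply: lerD => //.
  apply: le_trans (wd_WL H _ _ _) _.
  rewrite (_ : 2 * L * eps = L * (2 * eps)); last by ring.
  apply: ler_wpM2l; first exact: L_ge0.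
  by case/andP: zx => z1 z2; rewrite ger0_norm ?subr_ge0//; lra.
have gk x : `|g x| <= k * (itv_ind al (al + 2 * eps) x + itv_ind be (be + 2 * eps) x).
  rewrite gE normrM /k -mulrA; apply: ler_pM => //; first exact: (wd_qM H).
  by apply: le_trans (ler_normB _ _) _; rewrite mulrDr; apply: lerD; exact: bnd.
have [_ h] := Rintegral_le_ind mg e20 gk.
apply: le_trans h _; rewrite /k le_eqVlt; apply/orP; left; apply/eqP.
by field; exact: lt0r_neq0.
Qed.

(** The smoothed and the sharp indicator differ by at most 1, and only on two layers of width 2 eps
    to the right of a and b. *)
Lemma smooth_indicator_approx (f : R -> R) (N eps a b : R) : 0 < eps -> a <= b ->
  measurable_fun [set: R] f -> (forall x, `|f x| <= N) ->
  `|\int[mu]_x (f x * (step ((x - a) / eps) - step ((x - b) / eps))) - \int[mu]_(x in `[a, b]) f x|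
    <= 4 * N * eps.
Proof.
move=> e0 ab mq fM.
have e20 : 0 <= 2 * eps by rewrite mulr_ge0// ltW.
have iq : mu.-integrable `[a, b] (EFin \o f).
  by apply: (bounded_integrable_itv (M := N)) => // z; exact: fM.
pose p x := step ((x - a) / eps) - step ((x - b) / eps).
have mp : measurable_fun [set: R] p.
  have mst z : measurable_fun [set: R] (fun x : R => step ((x - z) / eps)).
    apply: (measurableT_comp step_measurable); apply: measurable_funM => //.
    by apply: measurable_funB.
  exact: measurable_funB.
have ii : mu.-integrable [set: R] (EFin \o (fun x => f x * itv_ind a b x)).
  exact: integrable_itv_ind.
have mi : measurable_fun [set: R] (itv_ind a b).
  have := integrable_itv_ind (f := cst 1) (a := a) (b := b).
  have i1 : mu.-integrable `[a, b] (EFin \o (cst 1 : R -> R)).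
    by apply: (@bounded_integrable_itv _ _ 1) => // z; rewrite normr1.
  move=> /(_ i1) /(measurable_int mu) /measurable_EFinP.
  by rewrite (_ : (fun x => _) = itv_ind a b)//; apply/funext => x; rewrite mul1r.
pose g x := f x * (p x - itv_ind a b x).
have mg : measurable_fun [set: R] g.
  by apply: measurable_funM => //; exact: measurable_funB.
have pi x : `|p x - itv_ind a b x| <= itv_ind a (a + 2 * eps) x + itv_ind b (b + 2 * eps) x.
  have s01 (u : R) : 0 <= step u <= 1 by rewrite step_ge0 step_le1.
  have lo (z : R) : x <= z -> step ((x - z) / eps) = 0.
    by move=> xz; rewrite step_le0// ler_pdivrMr// mul0r subr_le0.
  have hi (z : R) : z + 2 * eps <= x -> step ((x - z) / eps) = 1.
    by move=> zx; rewrite step_ge2// ler_pdivlMr//; lra.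
  have /andP[A0 A1] := s01 ((x - a) / eps); have /andP[B0 B1] := s01 ((x - b) / eps).
  rewrite /p /itv_ind.
  have [xa|ax] := ltP x a.
    rewrite !lo ?(ltW xa)//; last by apply: le_trans (ltW xa) ab.
    by rewrite /= !subrr normr0; do 2!case: ifP => _ //=; rewrite ?addr0 ?add0r ?ler01.
  have [xb|bx] := leP x b; rewrite /= ?andbT.
    rewrite (lo b)//= subr0.
    have [xe|ex] := leP x (a + 2 * eps); last first.
      rewrite hi ?(ltW ex)// subrr normr0; case: ifP => _; rewrite ?addr0 ?add0r//=.
    by rewrite ler_norml; case: ifP => _; lra.
  rewrite (ltW bx)/= subr0.
  have [xe|ex] := leP x (b + 2 * eps); last first.
    rewrite !hi ?(ltW ex)//; first by rewrite subrr normr0; case: ifP => _; rewrite addr0.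
    by lra.
  by rewrite ler_norml; case: ifP => _; lra.
have gk x : `|g x| <= N * (itv_ind a (a + 2 * eps) x + itv_ind b (b + 2 * eps) x).
  by rewrite normrM; apply: ler_pM => //; exact: fM.
have [ig hg] := Rintegral_le_ind mg e20 gk.
rewrite (_ : \int[mu]_x (f x * p x) = \int[mu]_x g x + \int[mu]_(x in `[a, b]) f x).
  rewrite addrK; apply: le_trans hg _; lra.
rewrite -(Rintegral_itv_ind a b f) -RintegralD//.
by apply: eq_Rintegral => x _; rewrite /g; ring.
Qed.

Lemma mass_approx (eps a b c c' tau : R) : 0 < eps -> a <= b ->
  `|tested_mass q (edge eps a c tau) (edge eps b c' tau) tau - \int[mu]_(x in `[a, b]) q tau x|
    <= 4 * M * eps.
Proof.
move=> e0 ab.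
rewrite (_ : tested_mass _ _ _ _ = \int[mu]_x (q tau x *
    (step ((x - a) / eps) - step ((x - b) / eps)))); last first.
  by apply: eq_Rintegral => x _; rewrite !ramp_edge// subrr !mul0r !subr0.
apply: smooth_indicator_approx => //; first exact: (section_measurable tau (wd_q H)).
by move=> z; exact: (wd_qM H).
Qed.

End Edges.

(** * Continuity in time of the smoothed mass *)

Section Mass.
Context {R : realType}.
Local Notation mu := (@lebesgue_measure R).

(** A side may be anchored at any of its points, so that [mass_approx] applies at both ends of a
    strip. *)
Lemma edge_shift (eps a c tau t : R) : edge eps a c tau = edge eps (a - (tau - t) * c) c t.
Proof. by rewrite /edge; congr (_, _, - (_ / _)); ring. Qed.

Lemma edges_out (eps a b c c' tau t x K : R) : 0 < eps ->
  `|a - (tau - t) * c| + 2 * eps <= K -> `|b - (tau - t) * c'| + 2 * eps <= K -> K < `|x| ->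
  ramp (edge eps a c tau) (t, x) = ramp (edge eps b c' tau) (t, x) /\
  forall v, dramp (edge eps a c tau) v (t, x) = 0 /\ dramp (edge eps b c' tau) v (t, x) = 0.
Proof.
move=> e0; set al := a - _; set be := b - _ => aK bK Kx.
have out z : `|z| + 2 * eps <= K -> (x - z) / eps <= 0 /\ x < 0 \/ 2 <= (x - z) / eps /\ 0 <= x.
  move=> zK; have /ler_normlP[z1 z2] := lexx `|z|.
  have [x0|x0] := leP 0 x.
    right; split => //; rewrite ler_pdivlMr//; move: Kx; rewrite ger0_norm//; lra.
  by left; split => //; rewrite ler_pdivrMr// mul0r; move: Kx; rewrite ltr0_norm//; lra.
split=> [|v]; rewrite ?ramp_edge ?dramp_edge// -/al -/be.
  case: (out _ aK) => -[h1 h1']; case: (out _ bK) => -[h2 h2'];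
    by [rewrite !step_le0 | rewrite !step_ge2 | move: (lt_le_trans h1' h2'); rewrite ltxx
       | move: (lt_le_trans h2' h1'); rewrite ltxx].
by split; [case: (out _ aK)|case: (out _ bK)] => -[h _]; rewrite ?(hat_le0 h) ?(hat_ge2 h) mul0r.
Qed.

Lemma edge_pos_bound (a c tau t N : R) : `|t| <= N ->
  `|a - (tau - t) * c| <= `|a| + (`|tau| + N) * `|c|.
Proof.
move=> tN; apply: le_trans (ler_normB _ _) _; rewrite lerD2l normrM ler_wpM2r//.
by apply: le_trans (ler_normB _ _) _; rewrite lerD2l.
Qed.

Lemma Rintegral_supp (f : R -> R) (K : R) : (forall x, K < `|x| -> f x = 0) ->
  \int[mu]_x f x = \int[mu]_(x in `[- K, K]) f x.
Proof.
move=> f0; rewrite [RHS]Rintegral_mkcond; apply: eq_Rintegral => x _.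
rewrite patchE mem_setE in_itv/= -ler_norml; case: ifPn => //.
by rewrite -ltNge => /f0.
Qed.

(** Meant for F = S' J with h1 and h2 the rise and fall of the cutoff S: where these weights live, J
    is within e of j1 and j2. *)
Lemma averaged (D : set R) (F h1 h2 : R -> R) (j1 j2 e : R) : measurable D ->
  mu.-integrable D (EFin \o F) -> mu.-integrable D (EFin \o h1) ->
  mu.-integrable D (EFin \o h2) ->
  (forall t, D t -> `|F t - (j1 * h1 t - j2 * h2 t)| <= e * h1 t + e * h2 t) ->
  \int[mu]_(t in D) h1 t = 1 -> \int[mu]_(t in D) h2 t = 1 ->
  `|\int[mu]_(t in D) F t - (j1 - j2)| <= 2 * e.
Proof.
move=> mD iF i1 i2 Fh I1 I2.
have iz j (h : R -> R) : mu.-integrable D (EFin \o h) ->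
    mu.-integrable D (EFin \o (fun t => j * h t)).
  by move=> ih; exact: (@integrableZl _ _ _ mu _ mD j _ ih).
have i12 : mu.-integrable D (EFin \o (fun t => j1 * h1 t - j2 * h2 t)).
  exact: (@integrableB _ _ _ mu _ mD _ _ (iz j1 _ i1) (iz j2 _ i2)).
have E : j1 - j2 = \int[mu]_(t in D) (j1 * h1 t - j2 * h2 t).
  rewrite RintegralB//; [|exact: iz|exact: iz].
  by rewrite !RintegralZl// I1 I2 !mulr1.
have iFB : mu.-integrable D (EFin \o (fun t => F t - (j1 * h1 t - j2 * h2 t))).
  exact: (@integrableB _ _ _ mu _ mD _ _ iF i12).
rewrite E -RintegralB//.
apply: le_trans (@le_normr_Rintegral _ _ _ mu D _ mD iFB) _.
have ie : mu.-integrable D (EFin \o (fun t => e * h1 t + e * h2 t)).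
  exact: (@integrableD _ _ _ mu _ mD _ _ (iz e _ i1) (iz e _ i2)).
apply: (@le_trans _ _ (\int[mu]_(t in D) (e * h1 t + e * h2 t))).
  by apply: le_Rintegral => //; exact: integrable_norm iFB.
rewrite RintegralD//; [|exact: iz|exact: iz].
by rewrite !RintegralZl// I1 I2; lra.
Qed.

Variables (T M B L : R) (q W : R -> R -> R) (q0 : R -> R).
Hypothesis H : weak_data T M B L q W q0.

(** q is continuous in L^1_loc, the smoothed strip is Lipschitz in time, and for |s - t0| <= 1 the
    strip stays in one window. *)
Lemma mass_continuous (eps a b c c' tau t0 e : R) : 0 < eps -> 0 <= t0 <= T -> 0 < e ->
  let J := tested_mass q (edge eps a c tau) (edge eps b c' tau) in
  exists2 d : R, 0 < d & forall s, 0 <= s <= T -> `|s - t0| <= d -> `|J s - J t0| <= e.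
Proof.
move=> e0 t0T epos J.
pose N := `|t0| + 1.
pose Ka := `|a| + (`|tau| + N) * `|c| + 2 * eps.
pose Kb := `|b| + (`|tau| + N) * `|c'| + 2 * eps.
pose K := Ka + Kb.
have N0 : 0 <= N by rewrite addr_ge0.
have Ka0 : 0 <= Ka by rewrite !addr_ge0// ?mulr_ge0 ?addr_ge0// ltW.
have Kb0 : 0 <= Kb by rewrite !addr_ge0// ?mulr_ge0 ?addr_ge0// ltW.
pose psi s x := ramp (edge eps a c tau) (s, x) - ramp (edge eps b c' tau) (s, x).
have out s x : `|s| <= N -> K < `|x| -> psi s x = 0.
  move=> sN Kx; apply/eqP; rewrite subr_eq0; apply/eqP.
  apply: (edges_out e0 _ _ Kx).1.
    by apply: (le_trans (lerD (edge_pos_bound a c tau sN) (lexx (2 * eps)))); rewrite lerDl.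
  by apply: (le_trans (lerD (edge_pos_bound b c' tau sN) (lexx (2 * eps)))); rewrite lerDr.
have JE s : `|s| <= N -> J s = \int[mu]_(x in `[- K, K]) (q s x * psi s x).
  by move=> sN; apply: Rintegral_supp => x Kx; rewrite -/(psi s x) (out s x sN Kx) mulr0.
pose th (z : R) := `|z / eps| + 2 * (z / eps) ^+ 2.
have th0 z : 0 <= th z by rewrite addr_ge0// mulr_ge0// sqr_ge0.
pose Th := th c + th c'.
have Th0 : 0 <= Th by rewrite addr_ge0.
have psiL s x : `|s - t0| <= 1 -> `|psi s x - psi t0 x| <= Th * `|s - t0|.
  move=> s1.
  have one (z d : R) : `|ramp (edge eps z d tau) (s, x) - ramp (edge eps z d tau) (t0, x)|
      <= th d * `|s - t0|.
    rewrite !ramp_edge//.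
    rewrite (_ : (x - (z - (tau - s) * d)) / eps =
      (x - (z - (tau - t0) * d)) / eps + (- (s - t0) * (d / eps))); last first.
      by field; exact: lt0r_neq0.
    apply: le_trans (step_lipschitz _ _) _.
    rewrite /th; set k := d / eps; set h := s - t0 in s1 *.
    have hh : h ^+ 2 <= `|h| by rewrite -real_normK ?num_real// expr2 ler_piMr.
    have k2 := ler_wpM2r (sqr_ge0 k) hh.
    by rewrite normrM normrN exprMn sqrrN; lra.
  rewrite (_ : psi s x - psi t0 x =
    (ramp (edge eps a c tau) (s, x) - ramp (edge eps a c tau) (t0, x)) -
    (ramp (edge eps b c' tau) (s, x) - ramp (edge eps b c' tau) (t0, x)));
      last by rewrite /psi; ring.
  by apply: le_trans (ler_normB _ _) _; rewrite /Th mulrDl; apply: lerD; exact: one.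
(* A quarter of e, because the difference of ramps is bounded by 2; the other half of e pays for the
   motion of the strip. *)
have [d1 d10 Hd] := wd_cont H t0T K (divr_gt0 epos (ltr0n R 4)).
pose cst0 := M * Th * (2 * K).
have M0 := M_ge0 H.
have c00 : 0 <= cst0 by rewrite /cst0 !mulr_ge0// addr_ge0.
pose d := Num.min d1 (Num.min 1 (e / (2 * (cst0 + 1)))).
have d0 : 0 < d by rewrite !lt_min d10 ltr01/= divr_gt0// mulr_gt0//; lra.
exists d => // s sT sd.
have sd1 : `|s - t0| <= d1 by apply: le_trans sd _; rewrite ge_min lexx.
have s1 : `|s - t0| <= 1 by apply: le_trans sd _; rewrite !ge_min lexx orbT.
have sde : `|s - t0| <= e / (2 * (cst0 + 1)) by apply: le_trans sd _; rewrite !ge_min lexx !orbT.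
have sN : `|s| <= N by rewrite -(subrK t0 s) addrC;
  apply: le_trans (ler_normD _ _) _; rewrite lerD2l.
have tN : `|t0| <= N by rewrite lerDl.
rewrite (JE s sN) (JE t0 tN).
have ipsi t : mu.-integrable `[- K, K] (EFin \o (fun x => q t x * psi t x)).
  apply: (bounded_integrable_itv (M := M * 2)).
    apply: measurable_funM; first exact: (section_measurable t (wd_q H)).
    by apply: measurable_funB; apply: section_measurable; exact: ramp_measurable.
  move=> x; rewrite normrM; apply: ler_pM => //; first exact: (wd_qM H).
  apply: le_trans (ler_normB _ _) _; exact: (lerD (normr_ramp _ _) (normr_ramp _ _)).
have iqq : mu.-integrable `[- K, K] (EFin \o (fun x => `|q s x - q t0 x|)).
  apply: (bounded_integrable_itv (M := M + M)).
    apply: measurableT_comp => //; apply: measurable_funB;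
      exact: (section_measurable _ (wd_q H)).
  move=> x; rewrite normr_id; apply: le_trans (ler_normB _ _) _.
  exact: (lerD (wd_qM H _ _) (wd_qM H _ _)).
have i1 : mu.-integrable `[- K, K] (EFin \o (fun x => 2 * `|q s x - q t0 x|)).
  exact: (@integrableZl _ _ _ mu _ _ 2 _ iqq).
pose k := M * (Th * `|s - t0|).
have i2 : mu.-integrable `[- K, K] (EFin \o (cst k : R -> R)).
  by apply: (bounded_integrable_itv (M := `|k|)).
rewrite -RintegralB//.
have iB := @integrableB _ _ _ mu _ (measurable_itv `[- K, K]) _ _ (ipsi s) (ipsi t0).
apply: le_trans (@le_normr_Rintegral _ _ _ mu _ _ _ iB) _ => //.
apply: (@le_trans _ _ (\int[mu]_(x in `[- K, K]) (2 * `|q s x - q t0 x| + k))).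
  apply: le_Rintegral => //; first exact: integrable_norm iB.
    exact: (@integrableD _ _ _ mu _ (measurable_itv _) _ _ i1 i2).
  move=> x _ /=.
  rewrite (_ : q s x * psi s x - q t0 x * psi t0 x =
    psi s x * (q s x - q t0 x) + q t0 x * (psi s x - psi t0 x)); last by ring.
  apply: le_trans (ler_normD _ _) _; rewrite !normrM; apply: lerD.
    apply: ler_wpM2r => //.
    apply: le_trans (ler_normB _ _) _; exact: (lerD (normr_ramp _ _) (normr_ramp _ _)).
  by apply: ler_pM => //; [exact: (wd_qM H)|exact: psiL].
rewrite RintegralD// RintegralZl//.
have KK : - K <= K by rewrite ge0_cp// addr_ge0.
rewrite Rintegral_itv_cst//.
have h1 := Hd s sT sd1.
have h2 : cst0 * `|s - t0| <= cst0 * (e / (2 * (cst0 + 1))) by rewrite ler_wpM2l.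
have h3 : cst0 * (e / (2 * (cst0 + 1))) <= e / 2.
  rewrite (_ : cst0 * _ = e / 2 * (cst0 / (cst0 + 1))); last by field; lra.
  by rewrite ler_piMr// ?divr_ge0 ?(ltW epos)// ler_pdivrMr; lra.
have h4 : k * (K - - K) = cst0 * `|s - t0| by rewrite /k /cst0; ring.
rewrite h4; move: h1; set I := Rintegral _ _ _ => h1; lra.
Qed.

End Mass.

(** * Mass balance of a moving strip between two times *)

Section StripMass.
Context {R : realType}.
Local Notation mu := (@lebesgue_measure R).
Variables (T M B L : R) (q W : R -> R -> R) (q0 : R -> R).
Hypothesis H : weak_data T M B L q W q0.

Lemma cutoff_flux_bound (S F : R -> R) (k t1 t2 : R) : t1 <= t2 -> 0 <= k ->
  mu.-integrable `]0, T[ (EFin \o (fun t => S t * F t)) ->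
  (forall t, `|S t| <= 1) -> (forall t, 0 < t < T -> ~~ (t1 <= t <= t2) -> S t = 0) ->
  (forall t, 0 < t < T -> t1 <= t <= t2 -> `|F t| <= k) ->
  `|\int[mu]_(t in `]0, T[) (S t * F t)| <= k * (t2 - t1).
Proof.
move=> t12 k0 iSF S1 Sout Fk.
rewrite Rintegral_mkcond.
have iG : mu.-integrable [set: R] (EFin \o ((fun t => S t * F t) \_ `]0, T[)).
  by rewrite -restrict_EFin -integrable_mkcond.
apply: le_trans (le_normr_Rintegral measurableT iG) _.
have ik : mu.-integrable [set: R] (EFin \o (fun t => k * itv_ind t1 t2 t)).
  apply: (integrable_itv_ind (f := cst k)).
  by apply: (bounded_integrable_itv (M := `|k|)).
apply: (@le_trans _ _ (\int[mu]_t (k * itv_ind t1 t2 t))).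
  apply: le_Rintegral => //; first exact: integrable_norm iG.
  move=> t _; rewrite patchE mem_setE in_itv/=.
  have kk : 0 <= k * itv_ind t1 t2 t by rewrite mulr_ge0// itv_ind_ge0.
  case: ifPn => [tT|_]; last by rewrite normr0.
  move: kk; rewrite /itv_ind; case: ifPn => [t12'|/(Sout _ tT) ->]; last by rewrite mul0r normr0.
  by move=> _; rewrite normrM mulrC ler_pM// Fk.
by rewrite (Rintegral_itv_ind _ _ (cst k)) Rintegral_itv_cst.
Qed.

Lemma time_margins (t1 t2 d T' : R) : 0 < d -> 5 * d <= t2 - t1 -> 0 <= t1 -> t2 <= T' ->
  [/\ 0 <= t2 - 3 * d, t2 - 3 * d + 2 * d <= T', t1 + 2 * d <= T' & t2 - d < T'].
Proof. by move=> *; split; lra. Qed.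

Lemma time_gap (t t2 d : R) : 0 < d -> t2 - 3 * d < t -> t < t2 - 3 * d + 2 * d ->
  t - t2 <= 0 /\ - (t - t2) <= 3 * d.
Proof. by move=> *; split; lra. Qed.

Lemma balance_bound (X Y j1 j2 m1 m2 k e1 e2 : R) : X + Y = 0 ->
  `|X - (j1 - j2)| <= e1 -> `|Y| <= k -> `|j1 - m1| <= e2 -> `|j2 - m2| <= e2 ->
  `|m2 - m1| <= k + e1 + 2 * e2.
Proof.
move=> XY /ler_normlP[x1 x2] /ler_normlP[y1 y2] /ler_normlP[u1 u2] /ler_normlP[v1 v2].
by apply/ler_normlP; split; lra.
Qed.

(** With a cutoff rising just after t1 and falling just before t2, the integral of S' J is nearly
    J(t1) - J(t2), and the flux term balances it. *)
Lemma strip_mass_eps (t1 t2 a b c c' w eps e : R) : 0 < eps -> 0 < e ->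
  0 <= t1 -> t1 < t2 -> t2 <= T ->
  a <= b -> a - (t2 - t1) * c <= b - (t2 - t1) * c' ->
  (forall s, t1 <= s <= t2 -> `|W s (a - (t2 - s) * c) - c| <= w /\
     `|W s (b - (t2 - s) * c') - c'| <= w) ->
  `|\int[mu]_(x in `[a, b]) q t2 x -
    \int[mu]_(x in `[a - (t2 - t1) * c, b - (t2 - t1) * c']) q t1 x| <=
  4 * M * (w + 2 * L * eps) * (t2 - t1) + 2 * e + 8 * M * eps.
Proof.
move=> eps0 e0 t10 t12 t2T ab ab' Ww.
have t1T : 0 <= t1 <= T by rewrite t10 (le_trans (ltW t12)).
have t2T' : 0 <= t2 <= T by rewrite t2T (le_trans t10)// ltW.
pose l1 := edge eps a c t2; pose l2 := edge eps b c' t2.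
pose J := tested_mass q l1 l2.
have J2 := mass_approx H c c' t2 eps0 ab; rewrite -/l1 -/l2 -/J in J2.
have J1 := mass_approx H c c' t1 eps0 ab'.
rewrite -!edge_shift -/l1 -/l2 -/J in J1.
have [d1 d10 Hd1] := mass_continuous H a b c c' t2 eps0 t1T e0.
have [d2 d20 Hd2] := mass_continuous H a b c c' t2 eps0 t2T' e0.
rewrite -/l1 -/l2 -/J in Hd1 Hd2.
pose d := Num.min (d1 / 2) (Num.min (d2 / 3) ((t2 - t1) / 5)).
have d0 : 0 < d by rewrite !lt_min !divr_gt0// subr_gt0.
have dd1 : 2 * d <= d1.
  have h : d <= d1 / 2 by rewrite ge_min lexx.
  lra.
have dd2 : 3 * d <= d2.
  have h : d <= d2 / 3 by rewrite !ge_min lexx orbT.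
  lra.
have dt : 5 * d <= t2 - t1.
  have h : d <= (t2 - t1) / 5 by rewrite !ge_min lexx !orbT.
  lra.
clearbody d.
(* The fall takes place on [t2 - 3 d, t2 - d], so that the test function vanishes near T even if t2
   = T. As 5 d <= t2 - t1, the rise on [t1, t1 + 2 d] ends before. *)
pose t2' := t2 - 3 * d.
have [t2'0 t2'T t1dT hiT] := time_margins d0 dt t10 t2T.
have di0 : 0 < d^-1 by rewrite invr_gt0.
have argE u t : d^-1 * t + - (u / d) = (t - u) / d by field; exact: lt0r_neq0.
pose S t := step (d^-1 * t + - (t1 / d)) - step (d^-1 * t + - (t2' / d)).
have S1 t : `|S t| <= 1 by exact: normr_stepB.
have lowside u t : t <= u -> (t - u) / d <= 0.
  by move=> tu; rewrite ler_pdivrMr// mul0r subr_le0.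
have highside u t : u + 2 * d <= t -> 2 <= (t - u) / d.
  by move=> tu; rewrite ler_pdivlMr//; lra.
have Sout t : ~~ (t1 <= t <= t2 - d) -> S t = 0 /\
    d^-1 * hat (d^-1 * t + - (t1 / d)) - d^-1 * hat (d^-1 * t + - (t2' / d)) = 0.
  rewrite negb_and -!ltNge /S !argE => /orP[h|h].
    have h1 : t <= t1 by exact: ltW.
    have h2 : t <= t2' by rewrite /t2'; lra.
    by rewrite !step_le0 ?hat_le0 ?lowside// !mulr0 subrr.
  have h1 : t1 + 2 * d <= t by lra.
  have h2 : t2' + 2 * d <= t by rewrite /t2'; lra.
  by rewrite !step_ge2 ?hat_ge2 ?highside// !mulr0 !subrr.
pose K := (`|a| + (`|t2| + T) * `|c| + 2 * eps) + (`|b| + (`|t2| + T) * `|c'| + 2 * eps).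
have T0 : 0 <= T by exact: le_trans t10 (le_trans (ltW t12) t2T).
have eps2 : 0 <= 2 * eps by rewrite mulr_ge0// ltW.
have Kout t x : t1 <= t <= t2 - d -> K < `|x| -> ramp l1 (t, x) = ramp l2 (t, x) /\
    forall v, dramp l1 v (t, x) = 0 /\ dramp l2 v (t, x) = 0.
  move=> /andP[tl th] Kx.
  have tN : `|t| <= T by rewrite ger0_norm ?(le_trans t10)// (le_trans th)// ltW.
  apply: (edges_out eps0 _ _ Kx).
    apply: (le_trans (lerD (edge_pos_bound a c t2 tN) (lexx (2 * eps)))).
    by rewrite lerDl !addr_ge0// mulr_ge0// addr_ge0.
  apply: (le_trans (lerD (edge_pos_bound b c' t2 tN) (lexx (2 * eps)))).
  by rewrite lerDr !addr_ge0// mulr_ge0// addr_ge0.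
have lo42 : - 42%:R < t1 by apply: lt_le_trans t10; rewrite oppr_lt0.
have [iJ iF] := weak_tested H lo42 hiT Sout Kout.
rewrite -/(S 0) -/J.
have S0 : S 0 = 0.
  by rewrite /S !argE !step_le0 ?subrr// lowside.
rewrite S0 mul0r addr0 => WI.
have [i1 I1] := time_hat_integral d0 t10 t1dT.
have [i2 I2] := time_hat_integral d0 t2'0 t2'T.
have avg := @averaged _ `]0, T[ _ _ _ (J t1) (J t2) e (measurable_itv _) iJ i1 i2 _ I1 I2.
have flux : `|\int[mu]_(t in `]0, T[) (S t * tested_flux q W l1 l2 t)| <=
    4 * M * (w + 2 * L * eps) * (t2 - t1).
  apply: cutoff_flux_bound => //; first exact: ltW.
  - have := Ww t2; rewrite subrr mul0r subr0 lexx (ltW t12) => /(_ isT) [h _].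
    rewrite !mulr_ge0 ?(M_ge0 H)// addr_ge0 ?(le_trans _ h)//.
    by rewrite !mulr_ge0 ?(L_ge0 H)// ltW.
  - move=> t _ tn; apply: (Sout t _).1; apply: contra tn => /andP[u1 u2].
    by rewrite u1 (le_trans u2)// gerBl ltW.
  - by move=> t _ ts; have [w1 w2] := Ww t ts; exact: (flux_bound H eps0 w1 w2).
have {}avg : `|\int[mu]_(t in `]0, T[) ((d^-1 * hat (d^-1 * t + - (t1 / d)) -
    d^-1 * hat (d^-1 * t + - (t2' / d))) * J t) - (J t1 - J t2)| <= 2 * e.
  apply: avg => t /=; rewrite in_itv/= => /andP[tl th].
  rewrite -/(time_hat d t1 t) -/(time_hat d t2' t).
  rewrite (_ : (time_hat d t1 t - time_hat d t2' t) * J t -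
      (J t1 * time_hat d t1 t - J t2 * time_hat d t2' t) =
    time_hat d t1 t * (J t - J t1) - time_hat d t2' t * (J t - J t2)); last by ring.
  have tT : 0 <= t <= T by rewrite !ltW.
  apply: le_trans (ler_normB _ _) _;
    rewrite (normrM (time_hat d t1 t)) (normrM (time_hat d t2' t)) ![e * _]mulrC.
  rewrite !(ger0_norm (time_hat_ge0 _ _ d0)); apply: lerD.
    have [/andP[u1 u2]|/time_hat_out ->] := boolP (t1 < t < t1 + 2 * d); rewrite ?mul0r//.
    apply: ler_wpM2l; first exact: time_hat_ge0.
    apply: Hd1 => //; rewrite ger0_norm ?subr_ge0 ?(ltW u1)//.
    by apply: le_trans dd1; rewrite lerBlDl ltW.
  have [/andP[u1 u2]|/time_hat_out ->] := boolP (t2' < t < t2' + 2 * d); rewrite ?mul0r//.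
  apply: ler_wpM2l; first exact: time_hat_ge0.
  have [g1 g2] := time_gap d0 u1 u2; apply: Hd2 => //.
  by rewrite ler0_norm// (le_trans _ dd2).
rewrite (_ : 8 * M * eps = 2 * (4 * M * eps)); last by ring.
exact: (balance_bound WI avg flux J1 J2).
Qed.

Lemma strip_mass (t1 t2 a b c c' w : R) :
  0 <= t1 -> t1 <= t2 -> t2 <= T ->
  a <= b -> a - (t2 - t1) * c <= b - (t2 - t1) * c' ->
  (forall s, t1 <= s <= t2 -> `|W s (a - (t2 - s) * c) - c| <= w /\
     `|W s (b - (t2 - s) * c') - c'| <= w) ->
  `|\int[mu]_(x in `[a, b]) q t2 x -
    \int[mu]_(x in `[a - (t2 - t1) * c, b - (t2 - t1) * c']) q t1 x| <=
  4 * M * w * (t2 - t1).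
Proof.
move=> t10 t12 t2T ab ab' Ww.
move: t12; rewrite le_eqVlt => /predU1P[E|t12].
  by rewrite -E subrr !mul0r !subr0 mulr0 subrr normr0.
apply/ler_addgt0Pl => e e0.
(* The sum of the coefficients of eps and e in [strip_mass_eps], both of which are set to e / k. *)
pose k := 8 * M * L * (t2 - t1) + 2 + 8 * M.
have M0 := M_ge0 H; have L0 := L_ge0 H.
have k0 : 0 < k.
  have h : 0 <= 8 * M * L * (t2 - t1) by rewrite !mulr_ge0// subr_ge0 ltW.
  by rewrite /k; lra.
have ek0 : 0 < e / k by rewrite divr_gt0.
apply: le_trans (strip_mass_eps ek0 ek0 t10 t12 t2T ab ab' Ww) _.
rewrite le_eqVlt; apply/orP; left; apply/eqP.
rewrite [RHS](_ : _ = e / k * k + 4 * M * w * (t2 - t1)); first by rewrite /k; ring.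
by rewrite divfK// lt0r_neq0.
Qed.

End StripMass.

(** * Agreement with the initial datum *)

Section InitialMass.
Context {R : realType}.
Local Notation mu := (@lebesgue_measure R).
Variables (T M B L : R) (q W : R -> R -> R) (q0 : R -> R).
Hypothesis H : weak_data T M B L q W q0.

Lemma initial_balance (X Y j j0 m m0 k1 k2 k3 : R) : X + (Y + j0) = 0 ->
  `|X - (0 - j)| <= k1 -> `|Y| <= k2 -> `|j0 - m0| <= k3 -> `|j - m| <= k3 ->
  `|m - m0| <= k1 + k2 + 2 * k3.
Proof.
move=> XY /ler_normlP[x1 x2] /ler_normlP[y1 y2] /ler_normlP[u1 u2] /ler_normlP[v1 v2].
by apply/ler_normlP; split; lra.
Qed.

(** The cutoff equals 1 at time 0 and falls on [d, 3 d], while the strip is at rest: the flux is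
    O(d), and J varies little up to time 3 d. *)
Lemma initial_mass (a b : R) : 0 < T -> a <= b ->
  \int[mu]_(x in `[a, b]) q 0 x = \int[mu]_(x in `[a, b]) q0 x.
Proof.
move=> T0 ab.
have M0 := M_ge0 H; have L0 := L_ge0 H.
have B0 : 0 <= B by exact: le_trans (wd_WB H 0 0).
have T00 : (0 : R) <= 0 <= T by apply/andP; split => //; exact: ltW.
suff near eps : 0 < eps ->
    `|\int[mu]_(x in `[a, b]) q 0 x - \int[mu]_(x in `[a, b]) q0 x| <= (3 + 8 * M) * eps.
  apply/eqP; rewrite -subr_eq0 -normr_le0; apply/ler_addgt0Pl => e e0; rewrite addr0.
  have k0 : 0 < 3 + 8 * M by rewrite ltr_pwDl// mulr_ge0.
  by apply: le_trans (near _ (divr_gt0 e0 k0)) _; rewrite mulrC divfK// lt0r_neq0.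
move=> eps0.
pose l1 := edge eps a 0 0; pose l2 := edge eps b 0 0.
pose J := tested_mass q l1 l2.
have J2 := mass_approx H 0 0 0 eps0 ab; rewrite -/l1 -/l2 -/J in J2.
pose J0 := \int[mu]_x (q0 x * (ramp l1 (0, x) - ramp l2 (0, x))).
have J1 : `|J0 - \int[mu]_(x in `[a, b]) q0 x| <= 4 * M * eps.
  rewrite (_ : J0 = \int[mu]_x (q0 x * (step ((x - a) / eps) - step ((x - b) / eps)))).
    exact: (smooth_indicator_approx eps0 ab (wd_q0 H) (wd_q0M H)).
  by apply: eq_Rintegral => x _; rewrite !ramp_edge// !mulr0 !subr0.
have [d1 d10 Hd1] := mass_continuous H a b 0 0 0 eps0 T00 eps0.
rewrite -/l1 -/l2 -/J in Hd1.
pose k := 4 * M * (B + 2 * L * eps).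
have k0 : 0 <= k by rewrite !mulr_ge0// addr_ge0// !mulr_ge0// ltW.
pose d := Num.min (d1 / 3) (Num.min (T / 4) (eps / (3 * (k + 1)))).
have k10 : 0 < 3 * (k + 1) by rewrite mulr_gt0// ltr_wpDl.
have d0 : 0 < d by rewrite !lt_min !divr_gt0.
have dd1 : 3 * d <= d1.
  by rewrite mulrC -ler_pdivlMr// ge_min lexx.
have dT : 4 * d <= T.
  by rewrite mulrC -ler_pdivlMr// !ge_min lexx orbT.
have dk : 3 * (k + 1) * d <= eps.
  by rewrite mulrC -ler_pdivlMr// !ge_min lexx !orbT.
clearbody d.
have di0 : 0 < d^-1 by rewrite invr_gt0.
have argE u t : d^-1 * t + - (u / d) = (t - u) / d by field; exact: lt0r_neq0.
(* The rise takes place on [- 10, - 8], after the lower bound - 42 of the admissible times and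
   before the domain of integration ]0, T[, where S' therefore shows the fall alone. *)
pose S t := step (1 * t + 10%:R) - step (d^-1 * t + - (d / d)).
have lowside t : t <= d -> (t - d) / d <= 0.
  by move=> tu; rewrite ler_pdivrMr// mul0r subr_le0.
have highside t : 3 * d <= t -> 2 <= (t - d) / d.
  by move=> tu; rewrite ler_pdivlMr//; lra.
have Sout t : ~~ (- 10%:R <= t <= 3 * d) -> S t = 0 /\
    1 * hat (1 * t + 10%:R) - d^-1 * hat (d^-1 * t + - (d / d)) = 0.
  rewrite negb_and -!ltNge /S !argE mul1r => /orP[h|h].
    have h1 : t + 10%:R <= 0 by rewrite -lerBrDr sub0r ltW.
    have h2 : t <= d by apply: le_trans (ltW h) _; apply: le_trans (ltW d0); rewrite oppr_le0.
    by rewrite !step_le0 ?hat_le0 ?lowside// !mulr0 subrr.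
  have h1 : 2 <= t + 10%:R.
    have : 0 <= t by apply: le_trans (ltW h); rewrite mulr_ge0// ltW.
    by lra.
  by rewrite !step_ge2 ?hat_ge2 ?highside ?(ltW h)// !mulr0 !subrr.
pose K := (`|a| + 2 * eps) + (`|b| + 2 * eps).
have eps2 : 0 <= 2 * eps by rewrite mulr_ge0// ltW.
have Kout t x : - 10%:R <= t <= 3 * d -> K < `|x| -> ramp l1 (t, x) = ramp l2 (t, x) /\
    forall v, dramp l1 v (t, x) = 0 /\ dramp l2 v (t, x) = 0.
  move=> _ Kx; apply: (edges_out eps0 _ _ Kx); rewrite mulr0 subr0.
    by rewrite lerDl addr_ge0.
  by rewrite lerDr addr_ge0.
have lo42 : - 42%:R < - 10%:R :> R by rewrite ltrN2 ltr_nat.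
have hiT : 3 * d < T by lra.
have [iJ iF] := weak_tested H lo42 hiT Sout Kout.
rewrite -/(S 0) -/J -/J0.
have -> : S 0 = 1.
  rewrite /S !argE [X in _ - X]step_le0 ?lowside ?(ltW d0)// step_ge2 ?subr0//.
  by rewrite mulr0 add0r ler_nat.
rewrite mul1r => WI.
have dT3 : d + 2 * d <= T by rewrite (_ : d + 2 * d = 3 * d) ?ltW//; ring.
have [i2 I2] := time_hat_integral d0 (ltW d0) dT3.
(* The value 0 stands for the rise, which happens outside ]0, T[; the weight of the fall fills both
   places. *)
have avg := @averaged _ `]0, T[ _ _ _ 0 (J 0) eps (measurable_itv _) iJ i2 i2 _ I2 I2.
have flux : `|\int[mu]_(t in `]0, T[) (S t * tested_flux q W l1 l2 t)| <= k * (3 * d - 0).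
  apply: cutoff_flux_bound => //.
  - by rewrite mulr_ge0// ltW.
  - by move=> t; exact: normr_stepB.
  - move=> t /andP[t0 _] tn; apply: (Sout t _).1; apply: contra tn => /andP[_ u2].
    by rewrite u2 (ltW t0).
  - by move=> t _ _; apply: (flux_bound H eps0); rewrite mulr0 !subr0; exact: (wd_WB H).
have {}avg : `|\int[mu]_(t in `]0, T[) ((1 * hat (1 * t + 10%:R) -
    d^-1 * hat (d^-1 * t + - (d / d))) * J t) - (0 - J 0)| <= 2 * eps.
  apply: avg => t /=; rewrite in_itv/= => /andP[tl th].
  rewrite -/(time_hat d d t) hat_ge2; last first.
    by rewrite mul1r (@le_trans _ _ 10%:R) ?ler_nat// lerDr ltW.
  rewrite (_ : (1 * 0 - time_hat d d t) * J t - (0 * time_hat d d t - J 0 * time_hat d d t) =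
    - (time_hat d d t * (J t - J 0))); last by ring.
  have tT : 0 <= t <= T by rewrite (ltW tl) (ltW th).
  have h0 := time_hat_ge0 d t d0.
  rewrite normrN (normrM (time_hat d d t)) (ger0_norm h0).
  apply: (@le_trans _ _ (eps * time_hat d d t)); last by rewrite lerDl mulr_ge0// ltW.
  rewrite mulrC.
  have [/andP[u1 u2]|/time_hat_out ->] := boolP (d < t < d + 2 * d); rewrite ?mulr0//.
  apply: ler_wpM2r => //; apply: Hd1 => //; rewrite subr0 ger0_norm ?(ltW tl)//.
  by apply: le_trans dd1; apply: le_trans (ltW u2) _; rewrite -[X in X + _]mul1r -mulrDl.
have {}WI : Rintegral mu `]0, T[ (fun t => (1 * hat (1 * t + 10%:R) -
    d^-1 * hat (d^-1 * t + - (d / d))) * J t) +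
  (Rintegral mu `]0, T[ (fun t => S t * tested_flux q W l1 l2 t) + J0) = 0.
  by rewrite addrA.
apply: le_trans (initial_balance WI avg flux J1 J2) _.
have kd : k * (3 * d - 0) <= eps.
  apply: le_trans dk; rewrite subr0 mulrA ler_wpM2r ?(ltW d0)// mulrC ler_wpM2l//.
  by rewrite lerDl.
rewrite (_ : (3 + 8 * M) * eps = 2 * eps + eps + 2 * (4 * M * eps)); last by ring.
by rewrite lerD2r lerD2l.
Qed.

End InitialMass.

(** * From weak solutions to bounded representatives *)

Section AlmostEverywhere.
Context {R : realType}.
Local Notation mu := (@lebesgue_measure R).

Lemma aeS (P Q : R -> Prop) : (forall x, P x -> Q x) ->
  (\forall x \ae mu, P x) -> \forall x \ae mu, Q x.
Proof. by move=> PQ; apply: filterS => //; exact: (ae_filter_ringOfSetsType mu). Qed.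

Lemma ae_conj (P Q : R -> Prop) : (\forall x \ae mu, P x) -> (\forall x \ae mu, Q x) ->
  \forall x \ae mu, P x /\ Q x.
Proof. by move=> ? ?; apply: filterI => //; exact: (ae_filter_ringOfSetsType mu). Qed.

Lemma ae_exists (a b : R) (P : R -> Prop) : a < b -> (\forall x \ae mu, P x) ->
  exists2 x, a < x < b & P x.
Proof.
move=> ab [N [mN N0 PN]].
apply: contrapT => nP.
have sub : `]a, b[ `<=` N.
  move=> x /=; rewrite in_itv/= => xab; apply: PN => /= Px.
  by apply: nP; exists x.
have : (mu `]a, b[ <= mu N)%E by apply: le_measure => //; rewrite inE.
rewrite N0 lebesgue_measure_itv/= lte_fin ab -EFinB lee_fin subr_le0.
by rewrite leNgt ab.
Qed.

Lemma Linfty_ae_bound (f : R -> R) (M : \bar R) :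
  ('N[mu]_(+oo)[EFin \o f] <= M)%E -> \forall x \ae mu, (`|f x|%:E <= M)%E.
Proof.
(* The norm of index +oo is the essential supremum only on a space of positive measure. *)
rewrite unlock /Lnorm ifT; last first.
  have : (mu `]0%R, 1%R[%classic <= mu [set: R])%E by apply: le_measure => //; rewrite inE.
  apply: lt_le_trans; rewrite lebesgue_measure_itv/= lte_fin ltr01 -EFinB lte_fin subr0.
  exact: ltr01.
by move=> /ess_supP; apply: aeS => x /=.
Qed.

Lemma C1_decreasing_law (V : R -> R) (M : R) : class_C 3 V -> (forall x, derive1 V x <= 0) ->
  exists LV N : R, [/\ 0 <= LV, continuous V, forall a, `|a| <= M -> `|V a| <= N &
    forall a b, `|a| <= M -> `|b| <= M -> a <= b -> V b <= V a <= V b + LV * (b - a)].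
Proof.
move=> [dV _] V0.
have dV0 x : derivable V x 1 by exact: (dV 0%N).
have dV1 x : derivable (derive1 V) x 1 by have := dV 1%N isT x; rewrite /derive1n.
have cV : continuous V by move=> x; apply: differentiable_continuous; apply/derivable1_diffP.
have cV' : continuous (derive1 V) by move=> x;
  apply: differentiable_continuous; apply/derivable1_diffP.
have bounded (f : R -> R) : continuous f -> exists C, forall a, `|a| <= M -> `|f a| <= C.
  move=> cf.
  have : compact (f @` `[- M, M]).
    by apply: continuous_compact; [exact: continuous_subspaceT|exact: segment_compact].
  move=> /compact_bounded[C [_ HC]]; exists (C + 1) => a aM.
  apply: HC; first by rewrite ltrDl.
  by exists a => //=; rewrite in_itv/= -ler_norml.
have [LV HLV] := bounded _ cV'; have [N HN] := bounded _ cV.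
(* The maximum covers the case where [- M, M] is empty and the bound [LV] is arbitrary. *)
exists (Num.max LV 0), N; split => //; first by rewrite le_max lexx orbT.
move=> a b aM bM ab.
have [c cab E] : exists2 c, c \in `[a, b]%R & V b - V a = derive1 V c * (b - a).
  apply: MVT_segment => //; last exact: continuous_subspaceT.
  by move=> x _; rewrite derive1E; apply: derivableP.
have ba : 0 <= b - a by rewrite subr_ge0.
have cM : `|c| <= M.
  move: cab aM bM; rewrite in_itv/= !ler_norml => /andP[ac cb] /andP[a1 _] /andP[_ b1].
  by rewrite (le_trans a1)//= (le_trans cb).
apply/andP; split.
  by rewrite -subr_le0 E mulr_le0_ge0.
have h : - derive1 V c <= Num.max LV 0.
  by rewrite le_max (le_trans _ (HLV c cM))// -normrN ler_norm.
have := ler_wpM2r ba h; rewrite mulNr -E; lra.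
Qed.

Lemma L1loc_close (T : R) (f : R -> R -> R) (t0 K e : R) : continuous_L1loc T f ->
  0 <= t0 <= T -> 0 < e -> exists2 d : R, 0 < d &
    forall t, 0 <= t <= T -> `|t - t0| <= d ->
      (\int[mu]_(x in `[(- K)%R, K]) (`|f t x - f t0 x|%R%:E) <= e%:E)%E.
Proof.
move=> [_ cf] t0T e0.
have t0I : t0 \in `[0, T] by rewrite in_itv.
have /fine_cvgP[fn /cvgrPdist_le /(_ _ e0) H] := cf t0 t0I _ (@segment_compact R (- K) K).
have : \forall t \near within `[0, T] (nbhs t0),
    (\int[mu]_(x in `[(- K)%R, K]) (`|f t x - f t0 x|%R%:E) <= e%:E)%E.
  near=> t.
  have fin : (\int[mu]_(x in `[(- K)%R, K]) `|f t x - f t0 x|%R%:E)%E \is a fin_num by near: t.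
  rewrite -(fineK fin) lee_fin.
  have : `|0 - fine (\int[mu]_(x in `[(- K)%R, K]) `|f t x - f t0 x|%R%:E)%E| <= e by near: t.
  by rewrite sub0r normrN; apply: le_trans; exact: ler_norm.
rewrite withinE/= => -[P /nbhs_ballP[d d0 dP] EP].
exists (d / 2); first by rewrite divr_gt0.
move=> t tT td.
have : (P `&` `[0, T]) t.
  split; last by rewrite /= in_itv.
  apply: dP; rewrite /ball/= distrC; apply: le_lt_trans td _.
  by rewrite ltr_pdivrMr// ltr_pMr// ltr1n.
by rewrite -EP => -[].
Unshelve. all: by end_near. Qed.

End AlmostEverywhere.

(** * A pointwise representative of the kernel *)

Section Kernel.
Context {R : realType}.
Local Notation mu := (@lebesgue_measure R).

(** The nonincreasing representative g is nonnegative at every s >= 0: somewhere to the right of s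
    it equals gamma at a point where gamma is nonnegative. *)
Lemma kernel_one_sided (eta : R) (gamma : R -> R) : 0 < eta ->
  ae_nneg `[0, +oo[ gamma ->
  mu.-integrable `[0, +oo[ (EFin \o gamma) ->
  ae_nonincreasing `[0, +oo[ gamma ->
  exists K k0, one_sided K k0 /\
    forall x, \forall y \ae mu, x <= y -> gamma ((y - x) / eta) = eta * K (y - x).
Proof.
move=> eta0 gnn gi [g gni gE].
have inD (s : R) : 0 <= s -> s \in `[0, +oo[%classic by move=> s0; rewrite mem_setE in_itv/= s0.
have g0 s : 0 <= s -> 0 <= g s.
  move=> s0; have s1 : s < s + 1 by rewrite ltrDl.
  have [y /andP[sy _] [gy1 gy2]] := ae_exists s1 (ae_conj gnn gE).
  have y0 : 0 <= y by rewrite (le_trans s0)// ltW.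
  have yD : `[0, +oo[%classic y by rewrite /= in_itv/= y0.
  apply: (@le_trans _ _ (g y)); first by rewrite -gy2// gy1.
  by apply: gni; rewrite ?inD// ltW.
(* Freezing g at g 0 on the left makes it monotone on the whole line, hence measurable. *)
pose gm s := g (Num.max s 0).
have max0 (s : R) : 0 <= Num.max s 0 by rewrite le_max lexx orbT.
have gm_ni : nonincreasing_fun gm.
  move=> x y xy; apply: gni; rewrite ?inD//.
  by rewrite ge_max !le_max xy lexx !orbT.
pose G := gm \_ `[0, +oo[.
have mgm : measurable_fun [set: R] gm by apply: nonincreasing_measurable => //; exact: gm_ni.
have iG : mu.-integrable [set: R] (EFin \o G).
  rewrite /G -restrict_EFin -integrable_mkcond//.
  case/integrableP: (gi) => mgam foo; apply/integrableP; split.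
    by apply/measurable_EFinP; exact: measurable_funTS.
  move: foo; congr (_ < _)%E; apply: ae_eq_integral => //.
  - by apply: measurableT_comp.
  - apply: measurableT_comp => //; apply/measurable_EFinP; exact: measurable_funTS.
  move: gE; apply: aeS => s gs sD; rewrite /= gs//.
  by rewrite /gm max_l//; move: sD; rewrite /= in_itv/= andbT.
pose K s := eta^-1 * G (eta^-1 * s + 0).
have ei0 : 0 < eta^-1 by rewrite invr_gt0.
have GE s : G s = if 0 <= s then g s else 0.
  rewrite /G patchE mem_setE in_itv/= andbT; case: ifP => // s0.
  by rewrite /gm max_l.
have KE s : K s = if 0 <= s then eta^-1 * g (s / eta) else 0.
  rewrite /K GE addr0 pmulr_rge0// [eta^-1 * s]mulrC.
  by case: ifP => // _; rewrite mulr0.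
exists K, (eta^-1 * g 0); split.
  split.
  - exact: (@integrableZl _ _ _ mu _ _ eta^-1 _ (integrable_affine eta^-1 0 ei0 _ iG)).
  - by move=> s s0; rewrite KE leNgt s0.
  - move=> s; rewrite KE; case: ifPn => // s0; rewrite mulr_ge0// ?(ltW ei0)// g0//.
    by rewrite divr_ge0// ltW.
  - move=> s; rewrite KE; case: ifPn => s0; last by rewrite mulr_ge0// ?(ltW ei0)// g0.
    have se : 0 <= s / eta by rewrite divr_ge0// ltW.
    by rewrite ler_pM2l//; apply: gni; rewrite ?inD.
  - move=> s t s0 st; rewrite !KE s0 (le_trans s0 st) ler_pM2l//.
    have se : 0 <= s / eta by rewrite divr_ge0// ltW.
    have te : 0 <= t / eta by rewrite divr_ge0 ?(ltW eta0)// (le_trans s0 st).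
    by apply: gni; rewrite ?inD// ler_pM2r.
move=> x; have := ae_affine eta^-1 (- (x / eta)) ei0 _ gE.
apply: aeS => y gy xy.
have yx : 0 <= y - x by rewrite subr_ge0.
have E : eta^-1 * y + - (x / eta) = (y - x) / eta by field; exact: lt0r_neq0.
rewrite KE yx mulrA divff ?lt0r_neq0// mul1r -E; apply: gy.
by rewrite E /= in_itv/= andbT divr_ge0// ltW.
Qed.

End Kernel.

Section TimeBounds.
Context {R : realType}.
Local Notation mu := (@lebesgue_measure R).

(** The excess max(|q(t0)| - M, 0) is at most |q(t) - q(t0)| for every good time t. Good times
    accumulate at t0, so by L^1_loc continuity the excess has integral 0 on each [- n, n]. *)
Lemma bounded_all_times (T M : R) (q : R -> R -> R) : 0 < T ->
  continuous_L1loc T q ->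
  (\forall t \ae mu, 0 < t < T -> \forall x \ae mu, `|q t x| <= M) ->
  forall t : R, 0 <= t <= T -> \forall x \ae mu, `|q t x| <= M.
Proof.
move=> T0 qc good t0 t0T.
have mq (t : R) : 0 <= t <= T -> measurable_fun [set: R] (q t).
  by move=> tT; case: (qc.1 t _) => //; rewrite in_itv.
pose f (x : R) : R := Num.max (`|q t0 x| - M) 0.
have f0 x : 0 <= f x by rewrite le_max lexx orbT.
have mf : measurable_fun [set: R] f.
  apply: measurable_maxr => //; apply: measurable_funB => //.
  by apply: measurableT_comp => //; exact: mq.
have key (n : nat) : (\int[mu]_(x in `[(- n%:R)%R, n%:R%R]) `|(f x)%:E| = 0)%E.
  apply/eqP; rewrite eq_le integral_ge0 ?andbT//.
  apply/lee_addgt0Pr => e e0; rewrite add0e.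
  have [d d0 Hd] := L1loc_close n%:R qc t0T e0.
  have [t tI tgood] : exists2 t, Num.max 0 (t0 - d) < t < Num.min T (t0 + d) &
      (0 < t < T -> \forall x \ae mu, `|q t x| <= M).
    apply: ae_exists good.
    by case/andP: t0T => *;
      rewrite gt_max !lt_min T0 /=; apply/andP; split; [lra|apply/andP; split; lra].
  move: tI; rewrite gt_max lt_min => /andP[/andP[t1 t2] /andP[t3 t4]].
  have tT : 0 <= t <= T by rewrite (ltW t1) (ltW t3).
  have tb : \forall x \ae mu, `|q t x| <= M by apply: tgood; rewrite t1 t3.
  have td : `|t - t0| <= d by apply/ler_normlP; split; lra.
  apply: le_trans (Hd t tT td).
  apply: ae_ge0_le_integral => //.
  - by apply/measurable_EFinP; apply: measurable_funTS; exact: measurableT_comp.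
  - apply/measurable_EFinP; apply: measurable_funTS; apply: measurableT_comp => //.
    by apply: measurable_funB; exact: mq.
  move: tb; apply: aeS => x qM _.
  rewrite lee_fin ger0_norm// /f ge_max normr_ge0 andbT lerBlDr.
  by have := ler_normB (q t x) (q t x - q t0 x); rewrite subKr; lra.
have all_n (n : nat) : \forall x \ae mu, `[- n%:R, n%:R]%classic x -> f x = 0.
  have mfn : measurable_fun (`[- n%:R, n%:R]%classic : set R) (EFin \o f).
    by apply/measurable_EFinP; exact: measurable_funTS.
  have := (ae_eq_integral_abs mu (measurable_itv _) mfn).1 (key n).
  by apply: aeS => x h xn; have [] := h xn.
have : \forall x \ae mu, forall n : nat, `[- n%:R, n%:R]%classic x -> f x = 0.
  exact/ae_foralln.
apply: aeS => x h.
have := h (Num.bound `|x|); rewrite /= in_itv/= -ler_norml ltW ?archi_boundP//.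
by move=> /(_ isT) fx; rewrite -subr_le0 -fx /f le_max lexx.
Qed.

End TimeBounds.

Section Truncation.
Context {R : realType}.
Local Notation mu := (@lebesgue_measure R).

Definition clamp (M u : R) : R := Num.max (- M) (Num.min u M).

Lemma clamp_bound M u : 0 <= M -> `|clamp M u| <= M.
Proof.
move=> M0; rewrite ler_norml /clamp le_max lexx/= ge_max.
by rewrite ge_min lexx orbT andbT ge0_cp.
Qed.

Lemma clamp_id M u : `|u| <= M -> clamp M u = u.
Proof.
by rewrite ler_norml => /andP[u1 u2]; rewrite /clamp min_l// max_r.
Qed.

Lemma clamp_lipschitz M u v : `|clamp M u - clamp M v| <= `|u - v|.
Proof.
have h1 := ler_norm (u - v); have h2 := ler_norm (v - u).
rewrite (distrC v) in h2; have h0 := normr_ge0 (u - v).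
move: h1 h2 h0; set d := `|u - v|; clearbody d => h1 h2 h0.
rewrite /clamp; apply/ler_normlP.
have [?|?] := leP u M; have [?|?] := leP v M;
  [have [?|?] := leP (- M) u; have [?|?] := leP (- M) v
  |have [?|?] := leP (- M) u; have [?|?] := leP (- M) M
  |have [?|?] := leP (- M) M; have [?|?] := leP (- M) v
  |have [?|?] := leP (- M) M]; split; lra.
Qed.

Lemma clamp_measurable d (X : measurableType d) (D : set X) (M : R) (f : X -> R) :
  measurable_fun D f -> measurable_fun D (fun x => clamp M (f x)).
Proof.
move=> mf; apply: measurable_maxr => //.
by apply: measurable_minr.
Qed.

(* A representative of q that is bounded at every point, where q is only bounded
   almost everywhere. *)
Definition truncated (T M : R) (q : R -> R -> R) (t x : R) : R :=
  if 0 <= t <= T then clamp M (q t x) else 0.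

Lemma truncated_measurable (T M : R) (q : R -> R -> R) :
  measurable_fun (`[0, T] `*` [set: R]) (fun p : R * R => q p.1 p.2) ->
  measurable_fun [set: R * R] (fun p : R * R => truncated T M q p.1 p.2).
Proof.
move=> mq.
have mD : measurable (`[0, T]%classic `*` [set: R] : set (R * R)) by apply: measurableX.
rewrite (_ : (fun p => _) = (fun p : R * R => clamp M (q p.1 p.2)) \_ (`[0, T] `*` [set: R])).
  exact: ((measurable_restrictT _ mD).1 (clamp_measurable M mq)).
apply/funext => -[t x]; rewrite patchE /truncated /=.
rewrite (_ : ((t, x) \in _) = (0 <= t <= T))//.
by apply/idP/idP; rewrite inE/= in_itv/= => // -[].
Qed.

Lemma truncated_bound (T M : R) q t x : 0 <= M -> `|truncated T M q t x| <= M.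
Proof. by move=> M0; rewrite /truncated; case: ifP => _; [exact: clamp_bound|rewrite normr0]. Qed.

(** Adding N to v makes the integrand nonnegative, so that Tonelli gives joint measurability; the
    correction N times the integral of K is constant. *)
Lemma look_ahead_measurable (K : R -> R) (k0 N : R) (v : R * R -> R) : one_sided K k0 ->
  measurable_fun [set: R * R] v -> (forall p, `|v p| <= N) ->
  measurable_fun [set: R * R] (fun p => look_ahead K (fun y => v (p.1, y)) p.2).
Proof.
move=> HK mv vN.
have mK : measurable_fun [set: R] K by apply/measurable_EFinP; case/integrableP: (os_int HK).
pose f (z : (R * R) * R) : \bar R := (K (z.2 - z.1.2) * (v (z.1.1, z.2) + N))%:E.
have mf : measurable_fun [set: (R * R) * R] f.
  apply/measurable_EFinP; apply: measurable_funM.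
    apply: measurableT_comp => //; apply: measurable_funB => //.
    exact: (measurableT_comp measurable_snd).
  apply: measurable_funD => //; apply: (measurableT_comp mv).
  apply: measurable_fun_pair => //.
  exact: (measurableT_comp measurable_fst).
have f0 z : (0 <= f z)%E.
  rewrite lee_fin mulr_ge0 ?(os_ge0 HK)// -lerBlDr sub0r.
  by have := vN (z.1.1, z.2); rewrite ler_norml => /andP[].
have := measurable_fun_fubini_tonelli_F (m2 := mu) f mf f0.
move=> mF.
rewrite (_ : (fun p => _) = (fun p => fine (fubini_F mu f p) - N * \int[mu]_y K y)).
  apply: measurable_funB => //; exact: measurableT_comp.
apply/funext => -[t x].
rewrite /fubini_F -/(Rintegral mu setT (fun y => K (y - x) * (v (t, y) + N))).
have mvt : measurable_fun [set: R] (fun y => v (t, y)) by exact: measurableT_comp.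
have iK := integrable_shift (- x) (os_int HK).
have i1 := integrable_Mbounded measurableT iK mvt (fun y => vN (t, y)).
have i2 : mu.-integrable [set: R] (EFin \o (fun y => N * K (y - x))).
  exact: (@integrableZl _ _ _ mu _ _ N _ iK).
rewrite (_ : Rintegral _ _ _ = \int[mu]_y (K (y - x) * v (t, y) + N * K (y - x))); last first.
  by apply: eq_Rintegral => y _; ring.
rewrite RintegralD// RintegralZl// (Rintegral_shift _ (os_int HK)).
by rewrite addrK.
Qed.

End Truncation.

Section NonlocalTerm.
Context {R : realType}.
Local Notation mu := (@lebesgue_measure R).

Lemma nonlocal_look_ahead (eta : R) (gamma K : R -> R) (k0 N : R) (u : R -> R -> R)
    (v : R -> R) (t x : R) : 0 < eta -> measurable_fun (`[0%R, +oo[%classic : set R) gamma ->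
  one_sided K k0 ->
  (\forall y \ae mu, x <= y -> gamma ((y - x) / eta) = eta * K (y - x)) ->
  measurable_fun [set: R] (u t) -> measurable_fun [set: R] v -> (forall y, `|v y| <= N) ->
  (\forall y \ae mu, u t y = v y) ->
  nonlocal eta gamma u t x = look_ahead K v x.
Proof.
move=> eta0 mg HK gK mu_t mv vN uv.
have iK := integrable_shift (- x) (os_int HK).
have iKv := integrable_Mbounded measurableT iK mv vN.
have mD : measurable (`[x, +oo[%classic : set R) by [].
have iD : mu.-integrable `[x, +oo[ (EFin \o (fun y => K (y - x) * v y)).
  exact: integrableS iKv.
rewrite /nonlocal.
have -> : \int[mu]_(y in `[x, +oo[) (gamma ((y - x) / eta) * u t y) =
    \int[mu]_(y in `[x, +oo[) (eta * (K (y - x) * v y)).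
  congr fine; apply: ae_eq_integral => //.
  - apply/measurable_EFinP; apply: measurable_funM; last exact: measurable_funTS.
    apply: (measurable_comp (F := (`[0%R, +oo[%classic : set R)) _ _ mg) => //.
      move=> _ [y /= + <-]; rewrite !in_itv/= !andbT => xy.
      by rewrite divr_ge0 ?subr_ge0// ltW.
    by apply: measurable_funM => //; apply: measurable_funB.
  - apply/measurable_EFinP; apply: measurable_funM => //.
    by apply/measurable_EFinP; case/integrableP: iD.
  move: (ae_conj gK uv); apply: aeS => y [gy uy] /=; rewrite in_itv/= andbT => xy.
  by rewrite gy// uy mulrA.
rewrite RintegralZl// mulrA mulVf ?gt_eqF// mul1r Rintegral_mkcond.
apply: eq_Rintegral => y _; rewrite patchE mem_setE in_itv/= andbT.
by case: ifPn => //; rewrite -ltNge => yx; rewrite (os_neg HK) ?mul0r ?subr_lt0.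
Qed.

Lemma look_ahead_bound (K v : R -> R) (k0 N x : R) : one_sided K k0 ->
  measurable_fun [set: R] v -> (forall y, `|v y| <= N) ->
  `|look_ahead K v x| <= N * \int[mu]_s K s.
Proof.
move=> HK mv vN.
have iK := integrable_shift (- x) (os_int HK).
have iKv := integrable_Mbounded measurableT iK mv vN.
apply: le_trans (@le_normr_Rintegral _ _ _ mu [set: R] _ measurableT iKv) _.
rewrite -(Rintegral_shift (- x) (os_int HK)) -RintegralZl//.
apply: le_Rintegral => //.
- exact: (@integrable_norm _ _ _ mu _ _ iKv).
- exact: (@integrableZl _ _ _ mu _ _ N _ iK).
by move=> y _; rewrite normrM (ger0_norm (os_ge0 HK _)) mulrC ler_wpM2r ?(os_ge0 HK).
Qed.

(** The set where f and g differ is measurable with null sections, hence null for the product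
    measure. *)
Lemma ae_eq_strip (T : R) (f g : R * R -> R) :
  measurable_fun (`]0, T[ `*` [set: R]) f -> measurable_fun (`]0, T[ `*` [set: R]) g ->
  (forall t, 0 < t < T -> \forall x \ae mu, f (t, x) = g (t, x)) ->
  \int[(mu \x mu)%E]_(p in `]0, T[ `*` [set: R]) f p =
  \int[(mu \x mu)%E]_(p in `]0, T[ `*` [set: R]) g p.
Proof.
move=> mf mg fg.
pose D : set (R * R) := `]0, T[ `*` [set: R].
have mD : measurable D by apply: measurableX.
congr fine; apply: ae_eq_integral => //.
- exact/measurable_EFinP.
- exact/measurable_EFinP.
exists (D `&` (fun p => f p - g p) @^-1` [set~ 0]); split.
- have := measurable_funB mf mg; apply => //.
  exact: measurableC.
- rewrite /= /product_measure1; apply: integral0_eq => t _ /=.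
  have mS : measurable (xsection (D `&` (fun p => f p - g p) @^-1` [set~ 0]) t).
    apply: measurable_xsection; have := measurable_funB mf mg; apply => //.
    exact: measurableC.
  apply: measure_negligible => //.
  have [tT|tT] := boolP (0 < t < T); last first.
    rewrite (_ : xsection _ _ = set0); first exact: negligible_set0.
    rewrite -subset0 => x; rewrite /xsection/= inE => -[[]] /=.
    by rewrite in_itv/= (negbTE tT).
  have := fg t tT; apply: negligibleS => x.
  by rewrite /xsection/= inE => -[_] /= + E; rewrite E subrr.
move=> p /= fgp; apply: contrapT => h; apply: fgp => Dp.
apply/congr1/eqP; rewrite -subr_eq0; apply/eqP.
by apply: contrapT => h'; apply: h; split.
Qed.

End NonlocalTerm.

(** * From L^1_loc to locally uniform continuity of the velocity in time *)

Section TimeContinuity.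
Context {R : realType}.
Local Notation mu := (@lebesgue_measure R).
Variables (T L : R) (W : R -> R -> R).
Hypothesis W_cont : continuous_L1loc T W.
Hypothesis L0 : 0 <= L.
Hypothesis W_lip : forall t x y : R, 0 <= t <= T -> `|W t x - W t y| <= L * `|x - y|.

(** If the two velocities differ by g at x, the Lipschitz bound keeps them at least g - 2 L r apart
    on [x, x + r]. An L^1 distance of at most (e / 2) r then forces g <= e / 2 + 2 L r, and r is
    chosen with L r <= e / 4. *)
Lemma locally_uniform_at (t0 K e : R) : 0 <= t0 <= T -> 0 < e ->
  exists2 d : R, 0 < d & forall t x : R, 0 <= t <= T -> `|t - t0| <= d -> `|x| <= K ->
    `|W t x - W t0 x| <= e.
Proof.
move=> t0T e0.
pose r : R := Num.min 1 (e / 4 / (L + 1)).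
have L1 : 0 < L + 1 by rewrite ltr_pwDr.
have r0 : 0 < r by rewrite lt_min ltr01 !divr_gt0.
have r1 : r <= 1 by rewrite ge_min lexx.
have Lr : L * r <= e / 4.
  have : r <= e / 4 / (L + 1) by rewrite ge_min lexx orbT.
  rewrite ler_pdivlMr// => h; apply: le_trans h.
  by rewrite mulrDr mulr1 mulrC lerDl ltW.
have e2r : 0 < e / 2 * r by rewrite mulr_gt0// divr_gt0.
have [d d0 Hd] := L1loc_close (K + 1) W_cont t0T e2r.
exists d => // t x tT td xK.
have := Hd t tT td.
pose g : R := `|W t x - W t0 x|; rewrite -/g => HI.
have [gs|gL] := leP g (2 * (L * r)).
  by apply: (le_trans gs); have := Lr; have := e0; move=> *; lra.
have mW (s : R) : 0 <= s <= T -> measurable_fun [set: R] (W s).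
  by move=> sT; case: (W_cont.1 s _) => //; rewrite in_itv.
have mf : measurable_fun [set: R] (fun y => `|W t y - W t0 y|%R%:E).
  apply/measurable_EFinP; apply: measurableT_comp => //.
  by apply: measurable_funB; exact: mW.
have lower : (((g - 2 * (L * r)) * r)%R%:E <= \int[mu]_(y in `[x, (x + r)%R]) (`|W t y - W t0 y|%R%:E))%E.
  have -> : (((g - 2 * (L * r)) * r)%R%:E = \int[mu]_(y in `[x, (x + r)%R]) (g - 2 * (L * r))%R%:E)%E.
    rewrite integral_cst//= lebesgue_measure_itv/= lte_fin ltrDl r0 -EFinB -EFinM.
    by rewrite addrAC subrr add0r.
  apply: ge0_le_integral => //.
  - by move=> y _; rewrite lee_fin subr_ge0 ltW.
  - exact: measurable_funTS.
  move=> y /=; rewrite in_itv/= => /andP[xy yx].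
  rewrite lee_fin.
  have yr : `|x - y| <= r by rewrite distrC ger0_norm ?subr_ge0// lerBlDl.
  have h1 := le_trans (W_lip x y tT) (ler_wpM2l L0 yr).
  have h2 := le_trans (W_lip x y t0T) (ler_wpM2l L0 yr).
  rewrite lerBlDr /g.
  have -> : W t x - W t0 x = (W t y - W t0 y) + ((W t x - W t y) - (W t0 x - W t0 y)) by ring.
  apply: le_trans (ler_normD _ _) _; rewrite lerD2l.
  apply: le_trans (ler_normB _ _) _.
  have -> : 2 * (L * r) = L * r + L * r by ring.
  exact: lerD.
have upper : (\int[mu]_(y in `[x, (x + r)%R]) (`|W t y - W t0 y|%R%:E) <= (e / 2 * r)%:E)%E.
  apply: le_trans HI; apply: ge0_subset_integral => //.
    exact: measurable_funTS.
  move=> y /=; rewrite !in_itv/= => /andP[xy yx].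
  move: xK; rewrite ler_norml => /andP[x1 x2].
  apply/andP; split.
    by apply: le_trans xy; apply: le_trans x1; rewrite lerN2 lerDl.
  by apply: le_trans yx _; apply: lerD.
have := le_trans lower upper; rewrite lee_fin ler_pM2r// lerBlDr.
by move=> h; have := Lr; move=> ?; lra.
Qed.

Lemma locally_uniform_in_time (K e : R) : 0 < e -> exists2 d : R, 0 < d &
  forall s t x : R, 0 <= s <= T -> 0 <= t <= T -> `|s - t| <= d -> `|x| <= K ->
    `|W s x - W t x| <= e.
Proof.
move=> e0.
pose P (d t : R) := 0 <= t <= T -> forall s x : R, 0 <= s <= T -> `|s - t| <= d -> `|x| <= K ->
    `|W s x - W t x| <= e.
have cvr := (compact_near_coveringP _).1 (@segment_compact R 0 T).
have H : forall t0, `[0, T]%classic t0 -> \forall t \near t0 & d \near 0^'+, P d t.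
  move=> t0 /=; rewrite in_itv/= => t0T.
  have [d d0 Hd] := locally_uniform_at K t0T (divr_gt0 e0 (ltr0Sn R 1)).
  exists (ball t0 (d / 2), [set r : R | 0 < r < d / 2]).
    split; first by apply: nbhsx_ballx; rewrite divr_gt0.
    near=> r; rewrite /=; apply/andP; split; near: r.
      exact: nbhs_right_gt.
    by apply: nbhs_right_lt; rewrite divr_gt0.
  move=> [t r] /= [tt0 /andP[r0 rd]] tT s x sT sr xK.
  have t1 : `|t - t0| <= d / 2 by rewrite distrC; apply: ltW.
  have a1 : `|t - t0| <= d by apply: le_trans t1 _; rewrite ler_pdivrMr// ler_pMr// ler1n.
  have a2 : `|s - t0| <= d.
    rewrite -(subrK t s) -addrA; apply: le_trans (ler_normD _ _) _.
    rewrite [leRHS](splitr d); apply: lerD => //.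
    by apply: le_trans sr (ltW rd).
  rewrite -(subrK (W t0 x) (W s x)) -addrA.
  apply: le_trans (ler_normD _ _) _; rewrite [leRHS](splitr e); apply: lerD; first exact: Hd.
  by rewrite distrC; apply: Hd.
have nb := cvr _ _ P _ H.
have /filter_ex[d [d0 Hd]] : \forall d \near 0^'+, 0 < d /\ (`[0, T] `<=` P d).
  near=> d; split; first by near: d; exact: nbhs_right_gt.
  by near: d; exact: nb.
exists d => // s t x sT tT; apply: Hd => //.
Unshelve. all: by end_near. Qed.

End TimeContinuity.

Section WeakSolutions.
Context {R : realType}.
Local Notation mu := (@lebesgue_measure R).

Lemma ae_bound_exists (T : R) (q0 : R -> R) (q : R -> R -> R) :
  Linfty [set: R] q0 -> bounded_LinftyTV T q ->
  exists M : R, [/\ 0 <= M, \forall x \ae mu, `|q0 x| <= M &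
    \forall t \ae mu, 0 < t < T -> \forall x \ae mu, `|q t x| <= M].
Proof.
rewrite /Linfty patch_setT => -[_ fin0] [M1 HM1].
have e0 := Linfty_ae_bound (lexx ('N[mu]_(+oo)[EFin \o q0])%E).
have fn : ('N[mu]_(+oo)[EFin \o q0])%E \is a fin_num by rewrite ge0_fin_numE ?Lnorm_ge0.
exists (Num.max (Num.max M1 (fine 'N[mu]_(+oo)[EFin \o q0])%E) 0); split.
- by rewrite le_max lexx orbT.
- by move: e0; apply: aeS => x; rewrite -{1}(fineK fn) lee_fin !le_max => ->; rewrite orbT.
move: HM1; apply: aeS => t Ht tT; have [_ /Linfty_ae_bound h _] := Ht tT.
by move: h; apply: aeS => x; rewrite lee_fin !le_max => ->.
Qed.

Lemma truncated_ae (T M : R) (q : R -> R -> R) (t : R) : 0 <= t <= T ->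
  (\forall x \ae mu, `|q t x| <= M) -> \forall x \ae mu, q t x = truncated T M q t x.
Proof. by move=> tT; apply: aeS => x qM; rewrite /truncated tT clamp_id. Qed.

Lemma truncated_close (T M : R) (q : R -> R -> R) (t0 K e : R) : 0 <= M ->
  measurable_fun [set: R * R] (fun p : R * R => truncated T M q p.1 p.2) ->
  continuous_L1loc T q -> 0 <= t0 <= T -> 0 < e ->
  exists2 d : R, 0 < d & forall s, 0 <= s <= T -> `|s - t0| <= d ->
    \int[mu]_(x in `[- K, K]) `|truncated T M q s x - truncated T M q t0 x| <= e.
Proof.
move=> M0 mu_ qc t0T e0; have [d d0 Hd] := L1loc_close K qc t0T e0.
exists d => // s sT sd; have := Hd s sT sd.
have mq (t : R) : 0 <= t <= T -> measurable_fun [set: R] (q t).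
  by move=> tT; case: (qc.1 t _) => //; rewrite in_itv.
have mt (t : R) : measurable_fun [set: R] (truncated T M q t).
  exact: (section_measurable t mu_).
set X := (X in (X <= e%:E)%E) => Xe.
have le : (\int[mu]_(x in `[(- K)%R, K]) (`|truncated T M q s x - truncated T M q t0 x|%R%:E) <= X)%E.
  apply: ge0_le_integral => //.
  - apply/measurable_EFinP; apply: measurable_funTS; apply: measurableT_comp => //.
    by apply: measurable_funB; exact: mt.
  - apply/measurable_EFinP; apply: measurable_funTS; apply: measurableT_comp => //.
    by apply: measurable_funB; exact: mq.
  by move=> x _; rewrite lee_fin /truncated sT t0T clamp_lipschitz.
have {Xe le} := le_trans le Xe; rewrite /Rintegral.
set Y := (Y in (Y <= _)%E) => Ye.
have Y0 : (0 <= Y)%E by exact: integral_ge0.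
by rewrite -lee_fin fineK// ge0_fin_numE// (le_lt_trans Ye)// ltry.
Qed.

(** q and q0 are truncated at a common almost everywhere bound M and the velocity is recomputed from
    the truncation, which makes all bounds hold at every point without changing the equation. *)
Lemma weak_solution_data (T eta : R) (gamma V q0 : R -> R) (q : R -> R -> R) :
  0 < T -> 0 < eta -> Linfty `[0, +oo[ gamma -> ae_nneg `[0, +oo[ gamma ->
  mu.-integrable `[0, +oo[ (EFin \o gamma) -> ae_nonincreasing `[0, +oo[ gamma ->
  class_C 3 V -> (forall x, derive1 V x <= 0) -> Linfty [set: R] q0 ->
  weak_solution T eta gamma V q0 q ->
  exists (M N LV k0 : R) (K : R -> R),
    let u := truncated T M q in
    let W t := look_ahead K (V \o u t) in
    [/\ 0 <= LV, continuous V, one_sided K k0,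
      (forall a, `|a| <= M -> `|V a| <= N) /\
      (forall a b, `|a| <= M -> `|b| <= M -> a <= b -> V b <= V a <= V b + LV * (b - a)) &
      [/\ weak_data T M (N * \int[mu]_s K s) (2 * N * k0) u W (fun x => clamp M (q0 x)),
        (forall t, 0 <= t <= T -> \forall x \ae mu, q t x = u t x),
        (\forall x \ae mu, q0 x = clamp M (q0 x)) &
        forall K e : R, 0 < e -> exists2 d : R, 0 < d &
          forall s t x : R, 0 <= s <= T -> 0 <= t <= T -> `|s - t| <= d -> `|x| <= K ->
          `|W s x - W t x| <= e]].
Proof.
move=> T0 eta0 gLi gnn gi gni VC V0 q0L [mq qc qb Wc weak].
have [M [M0 q0M qM]] := ae_bound_exists q0L qb.
have qM' := bounded_all_times T0 qc qM.
have [LV [N [LV0 cV VN Vlip]]] := C1_decreasing_law M VC V0.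
have [K [k0 [HK gK]]] := kernel_one_sided eta0 gnn gi gni.
exists M, N, LV, k0, K => u W.
have mV : measurable_fun [set: R] V := continuous_measurable_fun cV.
have uE t : 0 <= t <= T -> \forall x \ae mu, q t x = u t x.
  by move=> tT; apply: truncated_ae tT (qM' t tT).
have mu_ : measurable_fun [set: R * R] (fun p : R * R => u p.1 p.2) by exact: truncated_measurable.
have uM t x : `|u t x| <= M by exact: truncated_bound.
have mut t : measurable_fun [set: R] (u t).
  exact: (section_measurable t mu_).
have mVu t : measurable_fun [set: R] (V \o u t) by exact: measurableT_comp.
have VuN t y : `|(V \o u t) y| <= N by apply: VN; exact: uM.
have N0 : 0 <= N := le_trans (normr_ge0 _) (VuN 0 0).
have k00 := one_sided_bound_ge0 HK.
have mqt (t : R) : 0 <= t <= T -> measurable_fun [set: R] (q t).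
  by move=> tT; case: (qc.1 t _) => //; rewrite in_itv.
(* Equality at every x, not only almost every x: the integral in y ignores the null set where q was
   changed. *)
have WE t x : 0 <= t <= T -> nonlocal eta gamma (fun t x => V (q t x)) t x = W t x.
  move=> tT; apply: (@nonlocal_look_ahead R eta gamma K k0 N _ (V \o u t) t x eta0 gLi.1 HK (gK x)) => //.
    by apply: measurableT_comp => //; exact: mqt.
  by have := uE t tT; apply: aeS => y ->.
have Wlip t x y : `|W t x - W t y| <= 2 * N * k0 * `|x - y| by exact: (look_ahead_lipschitz HK).
have mW : measurable_fun [set: R * R] (fun p => W p.1 p.2).
  apply: (@look_ahead_measurable R K k0 N (fun p => V (u p.1 p.2)) HK).
    exact: (measurableT_comp mV mu_).
  by move=> p; exact: VN.
split => //; split => //; last first.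
- move=> K' e e0.
  have L0 : 0 <= 2 * N * k0 by rewrite !mulr_ge0.
  have Wl t x y : 0 <= t <= T -> `|nonlocal eta gamma (fun t x => V (q t x)) t x -
      nonlocal eta gamma (fun t x => V (q t x)) t y| <= 2 * N * k0 * `|x - y|.
    by move=> tT; rewrite !WE.
  have [d d0 Hd] := locally_uniform_in_time Wc L0 Wl K' e0.
  by exists d => // s t x sT tT sd xK; have := Hd s t x sT tT sd xK; rewrite !WE.
- by move: q0M; apply: aeS => x qx; rewrite clamp_id.
have mq0 : measurable_fun [set: R] q0 by exact: q0L.1.
have mq0c : measurable_fun [set: R] (fun x => clamp M (q0 x)) by exact: (clamp_measurable M mq0).
split => //.
- by move=> t x; exact: (look_ahead_bound _ HK).
- by move=> t0 t0T K' e e0; exact: truncated_close.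
- by move=> x; exact: clamp_bound.
move=> k1 k2 l1 l2 HC; apply: (etrans _ (weak _ HC)).
have dE v p : 'D_v (bump k1 k2 l1 l2) p = dbump k1 k2 l1 l2 v p by rewrite -dbumpE.
have mdb v : measurable_fun [set: R * R] (dbump k1 k2 l1 l2 v).
  by apply: measurable_funD; apply: measurable_funM; apply: measurable_funB;
     (exact: ramp_measurable || exact: dramp_measurable).
have mX : measurable_fun [set: R * R] (fun p => dbump k1 k2 l1 l2 (1, 0) p +
    W p.1 p.2 * dbump k1 k2 l1 l2 (0, 1) p).
  by apply: measurable_funD => //; apply: measurable_funM.
congr (_ + _).
  transitivity (\int[(mu \x mu)%E]_(p in `]0, T[ `*` [set: R])
    (q p.1 p.2 * (dbump k1 k2 l1 l2 (1, 0) p + W p.1 p.2 * dbump k1 k2 l1 l2 (0, 1) p))).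
    apply: ae_eq_strip.
    - by apply: measurable_funTS; exact: measurable_funM.
    - apply: measurable_funM; last exact: measurable_funTS.
      apply: measurable_funS mq => //; first exact: measurableX.
      move=> [t x] /= [+ _]; rewrite in_itv/= => /andP[t0 tT]; split => //.
      by rewrite /= in_itv/= !ltW.
    move=> t /andP[t0 tT]; have tI : 0 <= t <= T by rewrite !ltW.
    by have := uE t tI; apply: aeS => x /= ->.
  apply: eq_Rintegral => -[t x] /set_mem[/= + _]; rewrite in_itv/= => /andP[t0 tT].
  by rewrite !dE WE// !ltW.
congr fine; apply: ae_eq_integral => //.
- apply/measurable_EFinP; apply: measurable_funM => //.
  apply: (@section_measurable R (bump k1 k2 l1 l2)).
  by apply: measurable_funM; apply: measurable_funB; exact: ramp_measurable.
- apply/measurable_EFinP; apply: measurable_funM => //.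
  apply: (@section_measurable R (bump k1 k2 l1 l2)).
  by apply: measurable_funM; apply: measurable_funB; exact: ramp_measurable.
by move: q0M; apply: aeS => x qx _; rewrite /= clamp_id.
Qed.

End WeakSolutions.

(** * Preservation of monotonicity *)

Section MonotoneRepresentative.
Context {R : realType}.
Local Notation mu := (@lebesgue_measure R).

(** Averages over [x, x + 1/(n + 1)] rather than over balls, because the ordering of masses is
    stated for intervals with left end x. *)
Lemma ae_forward_average (f : R -> R) (M : R) :
  measurable_fun [set: R] f -> (forall z, `|f z| <= M) ->
  \forall x \ae mu,
    n.+1%:R * \int[mu]_(y in `[x, x + n.+1%:R^-1]) f y @[n --> \oo] --> f x.
Proof.
move=> mf fM; have lf := locally_integrable_bounded mf fM.
pose d (n : nat) : R := n.+1%:R^-1.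
have d0 n : 0 < d n by rewrite invr_gt0.
pose E (x : R) (n : nat) : set R := `[x, x + d n]%classic.
have muE x n : mu (E x n) = (d n)%:E.
  by rewrite /E lebesgue_measure_itv/= lte_fin ltrDl d0 -EFinD addrAC subrr add0r.
have nice x : nicely_shrinking x (E x).
  split=> [n|]; first exact: measurable_itv.
  have d20 n : 0 < 2 * d n by rewrite mulr_gt0.
  (* The open ball must contain the closed interval of length [d n]; radius 2 [d n] does, and its
     measure is 4 times that of the interval. *)
  exists (4, fun n => PosNum (d20 n)); split => //=.
  - rewrite -[X in _ --> X](mulr0 2); apply: cvgM; first exact: cvg_cst.
    exact: cvg_harmonic.
  - move=> n z; rewrite /E/= in_itv/= /ball/= ltr_distlC => /andP[xz zx].
    have := d0 n; move=> ?; apply/andP; split; lra.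
  move=> n; rewrite (lebesgue_measure_ball _ (ltW (d20 n))) muE -EFinM lee_fin.
  by rewrite mulr2n; lra.
have := lebesgue_differentiation lf; apply: aeS => x fx.
have := nice_lebesgue_differentiation nice lf fx.
move=> /fine_cvgP[_]; apply: cvg_trans; apply: near_eq_cvg.
near=> n => /=; rewrite muE inver gt_eqF// invrK.
rewrite -[LHS]/(fine (n.+1%:R%:E * \int[mu]_(y in E x n) (f y)%:E)%E) fineM//.
apply: integrable_fin_num; first exact: measurable_itv.
exact: (@bounded_integrable_itv _ f M x (x + d n) true false mf fM).
Unshelve. all: by end_near. Qed.

(** On the full-measure set S where the forward averages converge, f is a limit of ordered averages.
    The representative, which must be monotone at every point, is the supremum of f over the points
    of S to the left. *)
Lemma ae_nondecreasing_of_integrals (f : R -> R) (M : R) :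
  measurable_fun [set: R] f -> (forall z, `|f z| <= M) ->
  (forall x y l, x <= y -> 0 <= l ->
    \int[mu]_(s in `[x, x + l]) f s <= \int[mu]_(s in `[y, y + l]) f s) ->
  ae_nondecreasing [set: R] f.
Proof.
move=> mf fM fI; have av := ae_forward_average mf fM.
pose S : set R := [set x : R |
  n.+1%:R * \int[mu]_(y in `[x, x + n.+1%:R^-1]) f y @[n --> \oo] --> f x].
have Smono x y : S x -> S y -> x <= y -> f x <= f y.
  move=> Sx Sy xy; apply: (ler_cvg_to Sx Sy).
  by apply: nearW => n; rewrite ler_wpM2l// fI// invr_ge0.
pose A (x : R) : set R := [set f y | y in [set y | S y /\ y <= x]].
have An0 x : A x !=set0.
  have x1 : x - 1 < x by rewrite gtrBl.
  have [y /andP[_ yx] Sy] := ae_exists x1 av.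
  by exists (f y), y => //; split => //; exact: ltW.
have Aub x : ubound (A x) M.
  by move=> _ [y _ <-]; apply: le_trans (ler_norm _) (fM y).
have Asup x : has_sup (A x) by split => //; exists M.
exists (fun x => sup (A x)).
  move=> x y _ _ xy; apply: sup_le; [|exact: An0|exact: Asup].
  move=> _ [z [Sz zx] <-]; exists (f z); split => //.
  by exists z => //; split => //; exact: le_trans zx xy.
move: av; apply: aeS => x Sx _; apply/eqP; rewrite eq_le; apply/andP; split.
  by apply: ub_le_sup; [exists M|exists x].
apply: ge_sup => // _ [y [Sy yx] <-]; exact: Smono.
Qed.

Lemma shifted_integral_le (f : R -> R) (M x y l : R) :
  measurable_fun [set: R] f -> (forall z, `|f z| <= M) ->
  (\forall s \ae mu, f (s + x) <= f (s + y)) ->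
  \int[mu]_(s in `[x, x + l]) f s <= \int[mu]_(s in `[y, y + l]) f s.
Proof.
move=> mf fM fxy.
have E z : \int[mu]_(s in `[z, z + l]) f s = \int[mu]_(s in `[0, l]) f (s + z).
  rewrite Rintegral_itv_shift ?add0r 1?[l + _]addrC//.
  exact: (@bounded_integrable_itv _ _ M).
have I z : mu.-integrable `[0, l] (EFin \o (fun s => f (s + z))).
  by apply: (@bounded_integrable_itv _ _ M) => //; exact: measurable_shift.
rewrite !E; apply: ae_le_Rintegral => //.
by move: fxy; apply: aeS => s h _.
Qed.

End MonotoneRepresentative.

(** * Iteration of the gap estimate *)

Section IntervalOrder.
Context {R : realType}.
Local Notation mu := (@lebesgue_measure R).

Lemma itv_mass_bound (f : R -> R) (M a b : R) : measurable_fun [set: R] f ->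
  (forall z, `|f z| <= M) -> a <= b -> `|\int[mu]_(x in `[a, b]) f x| <= M * (b - a).
Proof.
move=> mf fM ab.
have i1 : mu.-integrable `[a, b] (EFin \o f) by exact: (@bounded_integrable_itv _ f M).
have i2 : mu.-integrable `[a, b] (EFin \o (fun=> M)).
  by apply: (@bounded_integrable_itv _ (fun=> M) `|M|).
rewrite -(Rintegral_itv_cst _ true false ab).
apply: le_trans (@le_normr_Rintegral _ _ _ mu _ _ (measurable_itv _) i1) _.
apply: le_Rintegral => //; exact: (@integrable_norm _ _ _ mu _ _ i1).
Qed.

Lemma itv_mass_add (f : R -> R) (M a b c : R) : measurable_fun [set: R] f ->
  (forall z, `|f z| <= M) -> a <= b -> b <= c ->
  \int[mu]_(x in `[a, c]) f x = \int[mu]_(x in `[a, b]) f x + \int[mu]_(x in `[b, c]) f x.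
Proof.
move=> mf fM ab bc; apply/eqP; rewrite addrC -subr_eq; apply/eqP.
rewrite Rintegral_itvB ?bnd_simp//; last exact: (@bounded_integrable_itv _ f M).
by rewrite Rintegral_itv_obnd_cbnd//; exact: (@bounded_integrable_itv _ f M).
Qed.

Lemma halving_le0 (X a : R) : (forall n, X <= a / 2 ^+ n) -> X <= 0.
Proof.
move=> H.
have h : a / 2 ^+ n @[n --> \oo] --> (0 : R).
  rewrite (_ : (fun n => _) = (fun n => a * (2^-1) ^+ n)); last first.
    by apply/funext => n; rewrite exprVn.
  rewrite -[X in _ --> X](mulr0 a); apply: cvgM; first exact: cvg_cst.
  by apply: cvg_expr; rewrite ger0_norm// invf_lt1// ltr1n.
rewrite -(cvg_lim _ h)//.
apply: limr_ge; first by apply/cvg_ex; exists 0.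
exact: nearW.
Qed.

Variables (T M N LV k0 : R) (K V q0 : R -> R) (u : R -> R -> R) (up : bool).
Let W t := look_ahead K (V \o u t).
Hypotheses (T0 : 0 < T) (LV0 : 0 <= LV) (cV : continuous V) (HK : one_sided K k0).
Hypothesis VN : forall a, `|a| <= M -> `|V a| <= N.
Hypothesis V_law : forall a b, `|a| <= M -> `|b| <= M -> a <= b ->
  V b <= V a <= V b + LV * (b - a).
Hypothesis H : weak_data T M (N * \int[mu]_s K s) (2 * N * k0) u W q0.
Hypothesis W_unif : forall K e : R, 0 < e -> exists2 d : R, 0 < d &
  forall s t x : R, 0 <= s <= T -> 0 <= t <= T -> `|s - t| <= d -> `|x| <= K ->
  `|W s x - W t x| <= e.
Hypothesis q0_ge0 : \forall x \ae mu, 0 <= q0 x.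
Hypothesis q0_ord : forall x y, before up x y -> \forall s \ae mu, q0 (s + x) <= q0 (s + y).

Let m t a b := \int[mu]_(x in `[a, b]) u t x.

Lemma solution_transported :
  transported T M (2 * N * k0) (N * \int[mu]_s K s) (4 * M) m W.
Proof.
have M0 := M_ge0 H; have mut t := section_measurable t (wd_q H).
split => //.
- exact: (L_ge0 H).
- exact: le_trans (normr_ge0 _) (wd_WB H 0 0).
- by rewrite mulr_ge0.
- by move=> t x y _; exact: (wd_WL H).
- by move=> t x _; exact: (wd_WB H).
- by move=> t a b c _; exact: itv_mass_add (mut t) (wd_qM H t).
- by move=> t a b _; exact: itv_mass_bound (mut t) (wd_qM H t).
- by move=> t1 t2 a b c c' w; exact: (strip_mass H).
move=> a b ab; rewrite /m (initial_mass H)//.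
have -> : 0 = \int[mu]_(x in `[a, b]) cst (0 : R) x by rewrite Rintegral_cst ?mul0r.
apply: ae_le_Rintegral => //.
- by apply: (@bounded_integrable_itv _ (cst 0) 0) => // z; rewrite normr0.
- exact: (@bounded_integrable_itv _ q0 M _ _ _ _ (wd_q0 H) (wd_q0M H)).
by move: q0_ge0; apply: aeS => x h _.
Qed.

(** Differentiating the bounds on all gaps gives u(s + x) - u(s + y) <= D for almost every s, which
    is the form [look_ahead_compare] takes; this is where C = LV k0 comes from. *)
Lemma velocity_gap (t D x y l g : R) : 0 <= D ->
  (forall x y l, before up x y -> 0 <= l -> m t x (x + l) - m t y (y + l) <= l * D) ->
  before up x y -> 0 <= l -> - g <= m t x (x + l) - m t y (y + l) ->
  - (LV * k0 * (2 * (l * D) + g)) <= (W t (x + l) - W t x) - (W t (y + l) - W t y).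
Proof.
move=> D0 HD xy l0 Hg; have mut := section_measurable t (wd_q H).
have mV := continuous_measurable_fun cV.
have uM := wd_qM H t.
apply: (@look_ahead_compare _ _ _ HK V (u t) M N LV D x y l g) => //.
- exact: measurableT_comp.
- by move=> z; exact: VN.
apply: (@ae_le_of_integrals _ _ (M + M)).
- by apply: measurable_funB; exact: measurable_shift.
- by move=> z; apply: le_trans (ler_normB _ _) _; exact: lerD.
move=> a b ab.
have I z : mu.-integrable `[a, b] (EFin \o (fun s => u t (s + z))).
  by apply: (@bounded_integrable_itv _ _ M) => //; exact: measurable_shift.
rewrite RintegralB//.
rewrite !Rintegral_itv_shift; [|exact: (@bounded_integrable_itv _ _ M)..].
have := HD (a + x) (a + y) (b - a).
rewrite /m (mulrC D) ![a + _ + (b - a)]addrAC !subrKC; apply; last by rewrite subr_ge0.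
by move: xy; rewrite /before; case: up; rewrite lerD2l.
Qed.

(** The iteration starts from D = 2 M, as each mass is at most M l, and keeps the same [la]
    throughout, so that n halvings give 2 M / 2^n. *)
Lemma interval_order (t x y l : R) : 0 <= t <= T -> before up x y -> 0 <= l ->
  m t x (x + l) <= m t y (y + l).
Proof.
move=> tT xy l0; have tr := solution_transported.
have M0 := M_ge0 H; have k00 := one_sided_bound_ge0 HK.
pose la := 2 * N * k0 + 4 * M * (LV * k0).
have N0 : 0 <= 2 * N * k0 := L_ge0 H.
have la0 : 0 <= la by rewrite addr_ge0// !mulr_ge0.
have step n : forall t x y l : R, 0 <= t <= T -> before up x y -> 0 <= l ->
    m t x (x + l) - m t y (y + l) <= l * (2 * M / 2 ^+ n * expR (la * t)).
  elim: n => [|n IH].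
    move=> {}t {}x {}y {}l {}tT {}xy {}l0.
    have mut := section_measurable t (wd_q H).
    have b1 := @itv_mass_bound _ M x (x + l) mut (wd_qM H t) ltac:(by rewrite lerDl).
    have b2 := @itv_mass_bound _ M y (y + l) mut (wd_qM H t) ltac:(by rewrite lerDl).
    have e1 : 1 <= expR (la * t) by rewrite -expR0 ler_expR mulr_ge0//; case/andP: tT.
    apply: (@le_trans _ _ (l * (2 * M))); last first.
      by rewrite ler_wpM2l// expr0 divr1 ler_peMr// mulr_ge0.
    rewrite -/(m t x (x + l)) -/(m t y (y + l)) in b1 b2.
    apply: le_trans (ler_norm _) _; apply: le_trans (ler_normB _ _) _.
    apply: le_trans (lerD b1 b2) _; rewrite [x + l]addrC [y + l]addrC !addrK.
    by rewrite (_ : _ + _ = l * (2 * M))//; ring.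
  move=> {}t {}x {}y {}l {}tT {}xy {}l0.
  have -> : 2 * M / 2 ^+ n.+1 = 2 * M / 2 ^+ n / 2 by rewrite exprSr invfM mulrA.
  have C0 : 0 <= LV * k0 by rewrite mulr_ge0.
  have D0 : 0 <= 2 * M / 2 ^+ n by rewrite divr_ge0 ?mulr_ge0// exprn_ge0.
  apply: (deviation_halves _ _ _ _ _ _ _ _ tr up _ la C0 D0 (lexx _) IH) => //.
    move=> t' D x' y' l' g _ D0' HD xy' l0' _ Hg; exact: velocity_gap HD xy' l0' Hg.
  move=> x' y' l' xy' l0'.
  rewrite subr_le0 /m !(initial_mass H) ?lerDl//.
  exact: shifted_integral_le (wd_q0 H) (wd_q0M H) (q0_ord xy').
rewrite -subr_le0; apply: (@halving_le0 _ (l * (2 * M * expR (la * t)))) => n.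
rewrite (_ : l * (2 * M * expR (la * t)) / 2 ^+ n = l * (2 * M / 2 ^+ n * expR (la * t))).
  exact: step.
by ring.
Qed.

End IntervalOrder.

Definition ae_monotone {R : realType} (up : bool) (f : R -> R) : Prop :=
  if up then ae_nondecreasing [set: R] f else ae_nonincreasing [set: R] f.

Section Preservation.
Context {R : realType}.
Local Notation mu := (@lebesgue_measure R).

Lemma ae_monotone_shift (up : bool) (f g : R -> R) (x y : R) :
  ae_monotone up f -> (\forall s \ae mu, f s = g s) -> before up x y ->
  \forall s \ae mu, g (s + x) <= g (s + y).
Proof.
move=> fm fg xy.
have [h hm hg] : exists2 h : R -> R, (forall s, h (s + x) <= h (s + y)) &
    \forall s \ae mu, g s = h s.
  move: fm xy; rewrite /ae_monotone /before.
  case: up => -[h hm fh] xy; (exists h; first by move=> s; apply: hm; rewrite ?inE// lerD2l);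
    by move: (ae_conj fg fh); apply: aeS => s [<- fs]; exact: fs.
move: (ae_conj (ae_shift x hg) (ae_shift y hg)).
by apply: aeS => s [-> ->].
Qed.

Lemma ae_monotone_of_integrals (up : bool) (f g : R -> R) (M : R) :
  measurable_fun [set: R] f -> (forall z, `|f z| <= M) ->
  (forall x y l, before up x y -> 0 <= l ->
    \int[mu]_(s in `[x, x + l]) f s <= \int[mu]_(s in `[y, y + l]) f s) ->
  (\forall s \ae mu, g s = f s) -> ae_monotone up g.
Proof.
move=> mf fM; rewrite /ae_monotone /before; case: up => fI gf.
  have [h hm fh] := ae_nondecreasing_of_integrals mf fM fI.
  exists h => //; move: (ae_conj gf fh); apply: aeS => s [-> fs] _; exact: fs.
(* The decreasing case is the increasing one for - f. *)
have [||x y l xy l0|h hm fh] := @ae_nondecreasing_of_integrals _ (fun s => - f s) M.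
- exact: measurableT_comp.
- by move=> z; rewrite normrN.
- have I z : mu.-integrable `[z, z + l] (EFin \o f) by exact: (@bounded_integrable_itv _ f M).
  have E z : \int[mu]_(s in `[z, z + l]) - f s = - \int[mu]_(s in `[z, z + l]) f s.
    under eq_Rintegral do rewrite -mulN1r.
    by rewrite RintegralZl// mulN1r.
  by rewrite !E lerN2 fI.
exists (fun s => - h s).
  by move=> x y xT yT xy; rewrite lerN2; exact: hm.
move: (ae_conj gf fh); apply: aeS => s [-> fs] _.
by rewrite -fs// opprK.
Qed.

Lemma monotonicity_preserved (up : bool) (T eta : R) (gamma V q0 : R -> R) (q : R -> R -> R) :
  0 < T -> 0 < eta -> Linfty `[0, +oo[ gamma -> ae_nneg `[0, +oo[ gamma ->
  mu.-integrable `[0, +oo[ (EFin \o gamma) -> ae_nonincreasing `[0, +oo[ gamma ->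
  class_C 3 V -> (forall x, derive1 V x <= 0) ->
  Linfty [set: R] q0 -> ae_nneg [set: R] q0 ->
  weak_solution T eta gamma V q0 q -> ae_monotone up q0 ->
  forall t, 0 <= t <= T -> ae_monotone up (q t).
Proof.
move=> T0 eta0 gL gnn gi gni VC V0 q0L q0nn qs q0m t tT.
have [M [N [LV [k0 [K]]]]] := weak_solution_data T0 eta0 gL gnn gi gni VC V0 q0L qs.
set u := truncated T M q => -[LV0 cV HK [VN Vl] [H qu q0c W_unif]].
have q0c_ge0 : \forall x \ae mu, 0 <= clamp M (q0 x).
  by move: (ae_conj q0nn q0c); apply: aeS => x [h <-]; exact: h.
apply: (ae_monotone_of_integrals (M := M) _ _ _ (qu t tT)).
- exact: (section_measurable t (wd_q H)).
- exact: (wd_qM H).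
move=> x y l xy l0.
apply: (interval_order T0 LV0 cV HK VN Vl H W_unif q0c_ge0 _ tT xy l0).
by move=> x' y' xy'; exact: (ae_monotone_shift q0m q0c xy').
Qed.

End Preservation.
Unset Implicit Arguments.

Theorem theorem5p1 (R : realType) (T eta : R) (gamma V q0 : R -> R)
    (q : R -> R -> R)
    (T_gt0 : 0 < T) (eta_gt0 : 0 < eta)
    (gamma_Linfty : Linfty `[0, +oo[ gamma)
    (gamma_nneg : ae_nneg `[0, +oo[ gamma)
    (gamma_L1 : (@lebesgue_measure R).-integrable `[0, +oo[ (EFin \o gamma))
    (gamma_decr : ae_nonincreasing `[0, +oo[ gamma)
    (V_C3 : class_C 3 V)
    (V'_le0 : forall x, derive1 V x <= 0)
    (q0_Linfty : Linfty [set: R] q0)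
    (q0_nneg : ae_nneg [set: R] q0)
    (q0_TV : finite_total_variation q0)
    (q0_mono : ae_nondecreasing [set: R] q0 \/ ae_nonincreasing [set: R] q0)
    (q_sol : weak_solution T eta gamma V q0 q) :
  (ae_nondecreasing [set: R] q0 ->
     forall t, 0 <= t <= T -> ae_nondecreasing [set: R] (q t)) /\
  (ae_nonincreasing [set: R] q0 ->
     forall t, 0 <= t <= T -> ae_nonincreasing [set: R] (q t)).
Proof.
split=> q0m t tT.
  exact: (@monotonicity_preserved R true T eta gamma V q0 q).
exact: (@monotonicity_preserved R false T eta gamma V q0 q).
Qed.
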